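(* Assume all of the following. (A0) The sequence $I_n:\mathcal P(\Xi)\to[0,+\infty]$ $\Gamma$-converges to a functional $I^{(0)}:\mathcal P(\Xi)\to[0,+\infty]$, and there is a finite set $\{x_1,\dots,x_{\mathfrak n_1}\}\subset\Xi$ of distinct points such that $\{\mu\in\mathcal P(\Xi): I^{(0)}(\mu)=0\}=\{\sum_{j\in S_1}\omega_j\delta_{x_j}:\omega\in\mathcal P(S_1)\}$, where $S_1=\{1,\dots,\mathfrak n_1\}$. (A1) There exist $\mathfrak q\ge1$, time-scales $1\prec\theta^{(1)}_n\prec\cdots\prec\theta^{(\mathfrak q)}_n$ and partitions $\mathfrak V_p=\{\mathcal V^{p,1}_n,\dots,\mathcal V^{p,\mathfrak n_p}_n,\Delta^{(p)}_n\}$ of $\Xi_n$, $1\le p\le\mathfrak q$ (with $\mathfrak n_1$ as in (A0)), such that for every $1\le p\le\mathfrak q$ and $i\neq j\in S_p:=\{1,\dots,\mathfrak n_p\}$ the limit $r^{(p)}(i,j):=\lim_{n\to\infty}\theta^{(p)}_n\,r^{\mathfrak V_p}_n(i,j)$ exists and is finite; moreover for each $p$, $r^{(p)}(i,j)>0$ for some $j\ne i\in S_p$. (A2) For $1\le p<\mathfrak q$, the number $\mathfrak u_p$ of closed irreducible classes $\mathfrak R^{(p)}_1,\dots,\mathfrak R^{(p)}_{\mathfrak u_p}$ of $\mathbb X^{(p)}_t$ equals $\mathfrak n_{p+1}$, and $\mathcal V^{p+1,m}_n=\bigcup_{j\in\mathfrak R^{(p)}_m}\mathcal V^{p,j}_n$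 for $m\in S_{p+1}$. (A3) The chain $\mathbb X^{(\mathfrak q)}_t$ has a unique closed irreducible class. (A4a) $\pi_n(\mathcal V^{(1)}_n)\to1$, and for each $j\in S_1$ the measure $\pi^{1,j}_n:=\pi_n(\,\cdot\mid\mathcal V^{1,j}_n)$ converges weakly to $\delta_{x_j}$. (A5) There exists a sequence $\beta_n\prec\theta^{(1)}_n$ such that for all $j\in S_1$ and $h:\mathcal V^{1,j}_n\to\mathbb R$, $$\max_{x\in\mathcal V^{1,j}_n}\sum_{y\in\mathcal V^{1,j}_n}\pi^{1,j}_n(y)\{h(y)-h(x)\}^2\le\beta_n\,D_n(\mathcal V^{1,j}_n,h).$$ (A6a) There exists $c_0>0$ such that $\pi_n(\mathcal V^{p,j}_n)/\pi_n(\mathcal V^{(p)}_n)\ge c_0$ for all $1\le p\le\mathfrak q$, $j\in S_p$, $n\ge1$. (A6b) For every $1\le p\le\mathfrak q$: if $\mu_n\in\mathcal P(\Xi_n)$ is a sequence converging weakly to $\sum_{j\in S_1}\omega_j\delta_{x_j}$ for some $\omega\in\mathcal P(S_1)$ and $\liminf_{n\to\infty}\theta^{(p)}_nI_n(\mu_n)<\infty$, then $\lim_{n\to\infty}\mu_n(\mathcal V^{1,j}_n)=\omega_j$ for all $j\in S_1$. Then a full $\Gamma$-expansion of $I_n$ is given by the speeds $(\theta^{(p)}_n:n\ge1)$, $1\le p\le\mathfrak q$, and the functionals $I^{(p)}:\mathcal P(\Xi)\to[0,+\infty]$, $0\le p\le\mathfrak q$, where $I^{(0)}$ is the functional in (A0)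 and $I^{(p)}$, $1\le p\le\mathfrak q$, is defined in the context.
   Context: Setting. $\Xi$ is the closure of an open bounded subset of $\mathbb R^d$, or the $d$-dimensional torus; $\Xi_n=\Xi\cap(n^{-1}\mathbb Z^d)$, $n\ge1$. For each $n$, $X^{(n)}_t$ is a $\Xi_n$-valued, irreducible, continuous-time Markov chain with jump rates $R_n(x,y)$, generator $(\mathcal L_nf)(x)=\sum_{y\in\Xi_n}R_n(x,y)\{f(y)-f(x)\}$, holding rates $\lambda_n(x)=\sum_yR_n(x,y)$, and unique stationary state $\pi_n$, which satisfies detailed balance $\pi_n(x)R_n(x,y)=\pi_n(y)R_n(y,x)$. $\mathbf P^{(n)}_x$ is the law of the chain started at $x$. $\mathcal P(\Omega)$ denotes probability measures on $\Omega$ with the weak topology; $\mathcal P(\Xi_n)\subset\mathcal P(\Xi)$. For positive sequences, $\alpha_n\prec\beta_n$ means $\alpha_n/\beta_n\to0$. Rate functional. For $\mu\in\mathcal P(\Xi_n)$, $I_n(\mu)=\sup_u-\sum_{x\in\Xi_n}\frac{(\mathcal L_nu)(x)}{u(x)}\mu(x)$, supremum over $u:\Xi_n\to(0,\infty)$; $I_n(\mu)=+\infty$ for $\mu\in\mathcal P(\Xi)\setminus\mathcal P(\Xi_n)$. $\Gamma$-convergence. $U_n:\mathcal X\to[0,+\infty]$ $\Gamma$-converges to $U:\mathcal X\to[0,+\infty]$ ($\mathcal X$ Polish) if (i) $\liminf_nU_n(x_n)\ge U(x)$ whenever $x_n\to x$; (ii) for each $x$ there is $x_n\to x$ with $\limsup_nU_n(x_n)\le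 U(x)$. Full $\Gamma$-expansion. Speeds $(\theta^{(p)}_n)_{n\ge 1}$, $1\le p\le\mathfrak q$, and functionals $I^{(p)}:\mathcal P(\Xi)\to[0,+\infty]$, $0\le p\le\mathfrak q$, give a full $\Gamma$-expansion of $I_n$ if: (a) $\theta^{(1)}_n\to\infty$ and $\theta^{(p)}_n/\theta^{(p+1)}_n\to0$ for $1\le p<\mathfrak q$; (b) $I_n$ $\Gamma$-converges to $I^{(0)}$ and $\theta^{(p)}_nI_n$ $\Gamma$-converges to $I^{(p)}$ for $1\le p\le\mathfrak q$; (c) for $0\le p<\mathfrak q$, $I^{(p+1)}(\mu)<\infty$ if and only if $I^{(p)}(\mu)=0$; (d) the $0$-level set of $I^{(\mathfrak q)}$ is a singleton. Mean jump rates. For a partition $\mathfrak W=\{\mathcal W^{(1)}_n,\dots,\mathcal W^{(\mathfrak m)}_n,\Delta_n\}$ of $\Xi_n$ let $\mathcal W_n=\bigcup_j\mathcal W^{(j)}_n$ and, for $x\ne y\in\mathcal W_n$, $R^{\mathfrak W}_n(x,y)=\lambda_n(x)\mathbf P^{(n)}_x[H_y=H^+_{\mathcal W_n}]$ (the jump rates of the trace of $X^{(n)}_t$ on $\mathcal W_n$), where $H_{\mathcal A}$ is the hitting time of $\mathcal A$ and $H^+_{\mathcal A}=\inf\{t>\tau_1:X^{(n)}_t\in\mathcal A\}$, $\tau_1$ being the first jump time. Set $r^{\mathfrak W}_n(i,j)=\frac1{\pi_n(\mathcal W^{(i)}_n)}\sum_{x\in\mathcal W^{(i)}_n}\pi_n(x)\sum_{y\in\mathcal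 W^{(j)}_n}R^{\mathfrak W}_n(x,y)$. Dirichlet form. For $\mathcal A\subset\Xi_n$, $h:\mathcal A\to\mathbb R$: $D_n(\mathcal A,h)=\frac12\frac1{\pi_n(\mathcal A)}\sum_{x\in\mathcal A}\sum_{y\in\mathcal A\setminus\{x\}}\pi_n(x)R_n(x,y)[h(y)-h(x)]^2$. Unions of wells: $\mathcal V^{(p)}_n=\bigcup_{j\in S_p}\mathcal V^{p,j}_n$. Reduced chains. $\mathbb X^{(p)}_t$ is the $S_p$-valued Markov chain with jump rates $r^{(p)}(i,j)$ and generator $\mathbb L^{(p)}$; $\mathfrak R^{(p)}_1,\dots,\mathfrak R^{(p)}_{\mathfrak u_p}$ are its closed irreducible classes and $M^{(p)}_m$ is the stationary state of $\mathbb X^{(p)}_t$ restricted to $\mathfrak R^{(p)}_m$. Define $\pi^{(1)}_j=\delta_{x_j}$, $j\in S_1$, and recursively, for $1\le p<\mathfrak q$, $j\in S_{p+1}$, $\pi^{(p+1)}_j=\sum_{k\in\mathfrak R^{(p)}_j}M^{(p)}_j(k)\,\pi^{(p)}_k$. Limiting functionals. For $1\le p\le\mathfrak q$, $\omega\in\mathcal P(S_p)$: $\mathbb I^{(p)}(\omega)=\sup_{\mathbf h}-\sum_{j\in S_p}\omega_j\frac{(\mathbb L^{(p)}\mathbf h)(j)}{\mathbf h(j)}$, supremum over $\mathbf h:S_p\to(0,\infty)$; and $I^{(p)}(\mu)=\mathbb I^{(p)}(\omega)$ if $\mu=\sum_{j\in S_p}\omega_j\pi^{(p)}_j$ for some $\omega\in\mathcal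 P(S_p)$, $I^{(p)}(\mu)=+\infty$ otherwise. *)

(* Defs.v *)
From HB Require Import structures.
From mathcomp Require Import all_boot all_order all_algebra finmap.
From mathcomp Require Import all_classical all_reals all_analysis.

Set Implicit Arguments.
Unset Strict Implicit.
Unset Printing Implicit Defensive.

Import Order.TTheory GRing.Theory Num.Theory.
Import numFieldNormedType.Exports.

Local Open Scope classical_set_scope.
Local Open Scope ring_scope.

(** * Probability measures *)

(* [w : simplex R I] is an element of P(I), I finite. *)
Definition is_prob_vec (R : realType) (I : finType) : {pred {ffun I -> R}} :=
  fun w => [forall i, 0 <= w i] && (\sum_i w i == 1).

Definition simplex (R : realType) (I : finType) : Type :=
  {w : {ffun I -> R} | is_prob_vec w}.

Definition wt (R : realType) (I : finType) (w : simplex R I) (i : I) : R :=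
  val w i.

Coercion wt : simplex >-> Funclass.

Definition mass (R : realType) (I : finType) (w : simplex R I) (A : {set I}) :
  R := \sum_(i in A) w i.

(* w( . | A); the default value [w] is only taken when w(A) = 0. *)
Definition cond (R : realType) (I : finType) (w : simplex R I) (A : {set I}) :
    simplex R I :=
  insubd w [ffun i => if i \in A then w i / mass w A else 0].

Lemma wt_ge0 (R : realType) (I : finType) (w : simplex R I) i : 0 <= w i.
Proof. by case: w => w wP; have /andP[/forallP w0 _] := wP; exact: w0. Qed.

Lemma wt_sum (R : realType) (I : finType) (w : simplex R I) : \sum_i w i = 1.
Proof. by case: w => w wP; have /andP[_ /eqP] := wP. Qed.

Section mixture.
Context d (T : measurableType d) (R : realType) (I : finType).
Variables (w : simplex R I) (m : I -> probability T R).

Definition mix (A : set T) : \bar R := (\sum_i (w i)%:E * m i A)%E.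

Let term_ge0 i A : (0 <= (w i)%:E * m i A)%E.
Proof. by rewrite mule_ge0// lee_fin wt_ge0. Qed.

Let mix0 : mix set0 = 0%E.
Proof. by rewrite /mix big1// => i _; rewrite measure0 mule0. Qed.

Let mix_ge0 A : (0 <= mix A)%E.
Proof. exact: sume_ge0. Qed.

Let mix_sigma_additive : semi_sigma_additive mix.
Proof.
move=> F mF tF mUF.
have -> : mix (\bigcup_n F n) = (\sum_(0 <= k <oo) mix (F k))%E.
  rewrite /mix nneseries_sum; last by move=> i j _; exact: term_ge0.
  apply: eq_bigr => i _.
  rewrite nneseriesZl//; congr (_ * _)%E.
  by rewrite (measure_bigcup (m i))// ; apply: eq_eseriesl => k; rewrite in_setT.
by apply: is_cvg_nneseries => k _ _; exact: mix_ge0.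
Qed.

HB.instance Definition _ :=
  isMeasure.Build d T R mix mix0 mix_ge0 mix_sigma_additive.

Let mix_setT : mix setT = 1%E.
Proof.
rewrite /mix (eq_bigr (fun i => (w i)%:E)); last first.
  by move=> i _; rewrite probability_setT mule1.
by rewrite sumEFin wt_sum.
Qed.

HB.instance Definition _ := Measure_isProbability.Build d T R mix mix_setT.

(* sum_i w_i m_i *)
Definition mixture : probability T R := mix.

End mixture.

(* Library measures are functions on all subsets, with no constraint on
   nonmeasurable ones, so two equal measures need not be Leibniz equal. *)
Definition same_measure d (T : measurableType d) (R : realType)
    (mu nu : probability T R) : Prop :=
  forall A, measurable A -> mu A = nu A.

Notation borel T := (g_sigma_algebraType (@open T)).

Notation borel_prob T R := (probability (borel T) R).

Definition point_mass (R : realType) (T : ptopologicalType) (x : T) :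
    borel_prob T R :=
  @dirac _ (borel T) x R.

Section weak_topology.
Context (R : realType) (T : ptopologicalType).

Definition test_integrals (mu : borel_prob T R) :
    {ptws continuousType T R -> R} :=
  fun f => \int[mu]_x (f x).

(* All test functions are bounded, as only compact [T] are considered. *)
HB.instance Definition _ :=
  Topological.copy (borel_prob T R) (initial_topology test_integrals).

Lemma weak_cvgP (mu_ : nat -> borel_prob T R) (mu : borel_prob T R) :
  mu_ @ \oo --> mu <->
  forall f : T -> R, continuous f ->
    (\int[mu_ n]_x (f x)) @[n --> \oo] --> \int[mu]_x (f x).
Proof.
split=> [mu_mu f cf|H].
  have c1 : (test_integrals \o mu_) @ \oo --> test_integrals mu.
    apply: (cvg_comp _ _ mu_mu).
    exact: (@initial_continuous _ _ test_integrals mu).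
  exact: (cvg_comp _ _ c1 (@proj_continuous _ (fun _ => R : topologicalType)
    (mkcts cf : continuousType T R) (test_integrals mu))).
have tH : test_integrals \o mu_ @ \oo --> test_integrals mu.
  apply/cvg_sup => f; rewrite cvg_image; last first.
    by rewrite eqEsubset; split=> v // _; exists (cst v).
  move=> W /= fW; exists ((fun g => g f) @^-1` W).
    exact: (H f (@cts_fun _ _ f) W).
  by rewrite eqEsubset; split => [v [g Wg <-]//|v Wv]; exists (fun=> v).
move=> A [_ [[B oB <-] Bmu] BA].
apply: (filterS BA).
by apply: tH; exact: open_nbhs_nbhs.
Qed.

End weak_topology.

(** * Gamma-convergence *)

Section gamma.
Local Open Scope ereal_scope.
Context (R : realType).

Definition gamma_cvg (X : topologicalType) (U_ : nat -> X -> \bar R)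
    (U : X -> \bar R) : Prop :=
  (forall (x_ : nat -> X) (x : X), x_ @ \oo --> x ->
     U x <= limn_einf (fun n => U_ n (x_ n))) /\
  (forall x : X, exists x_ : nat -> X, x_ @ \oo --> x /\
     limn_esup (fun n => U_ n (x_ n)) <= U x).

(* alpha_n << beta_n, for positive sequences *)
Definition prec (alpha beta : nat -> R) : Prop :=
  (alpha n / beta n)%R @[n --> \oo] --> (0 : R)%R.

Definition full_gamma_expansion (T : ptopologicalType)
    (I_ : nat -> borel_prob T R -> \bar R)
    (q : nat) (theta : nat -> nat -> R)
    (I : nat -> borel_prob T R -> \bar R) : Prop :=
  [/\ (forall p, (p <= q)%N -> forall mu, 0 <= I p mu),
      (theta 1%N n @[n --> \oo] --> +oo%R) /\
        (forall p, (1 <= p < q)%N -> prec (theta p) (theta p.+1)),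
      gamma_cvg I_ (I 0%N) /\
        (forall p, (1 <= p <= q)%N ->
           gamma_cvg (fun n mu => (theta p n)%:E * I_ n mu) (I p)),
      (forall p, (p < q)%N -> forall mu, I p.+1 mu < +oo <-> I p mu = 0) &
      exists mu0, forall mu, I q mu = 0 <-> same_measure mu mu0].

End gamma.

(** * Finite-state Markov chains *)

(* In all that follows [r x y] is the jump rate from [x] to [y]. The reduced
   chains have no specified diagonal rates; every notion applied to them is
   insensitive to the diagonal. *)
Section chain.
Context (R : realType) (E : finType) (r : E -> E -> R).

Definition gen (f : E -> R) (x : E) : R := \sum_y r x y * (f y - f x).

Definition hold_rate (x : E) : R := \sum_y r x y.

Definition edge : rel E := fun x y => (x != y) && (0 < r x y).

Definition irreducible_chain : Prop := forall x y, connect edge x y.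

Definition stationary (w : simplex R E) : Prop :=
  forall f : E -> R, \sum_x w x * gen f x = 0.

Definition detailed_balance (w : simplex R E) : Prop :=
  forall x y, w x * r x y = w y * r y x.

(* sup_u - sum_x mu(x) (L u)(x) / u(x) *)
Definition level2_rate (mu : E -> R) : \bar R :=
  ereal_sup [set (- \sum_x gen u x / u x * mu x)%:E |
              u in [set u : E -> R | forall x, 0 < u x]].

Definition closed_irreducible_class (C : {set E}) : Prop :=
  [/\ (exists x, x \in C),
      (forall x y, x \in C -> edge x y -> y \in C) &
      (forall x y, x \in C -> y \in C -> connect edge x y)].

(* Transition probabilities of the jump chain; absorbing states stay put. *)
Definition jump_prob (x y : E) : R :=
  if hold_rate x == 0 then (x == y)%:R else r x y / hold_rate x.

Definition dirichlet (w : simplex R E) (A : {set E}) (h : E -> R) : R :=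
  2^-1 * (mass w A)^-1 *
  \sum_(x in A) \sum_(y in A :\ x) w x * r x y * (h y - h x) ^+ 2.

End chain.

(** * Paths of a continuous-time chain *)

Section path.
Context (R : realType) (E : finType).
Implicit Types (w : R -> E) (A : {set E}).

Definition cadlag w : Prop :=
  (forall t, 0 <= t -> \forall s \near t^'+, w s = w t) /\
  (forall t, 0 < t -> exists x, \forall s \near t^'-, w s = x).

(* The [k]-th jump time and the state entered at that time; after the last
   jump, the time is +oo and the state is the last one visited. *)
Fixpoint jump w (k : nat) : \bar R * E :=
  if k is k'.+1 then
    let: (s, x) := jump w k' in
    let s' := ereal_inf [set t%:E | t in [set t : R | (s <= t%:E)%E /\ w t <> x]]
    in (s', if s' is t%:E then w t else x)
  else (0%E, w 0).

Definition jump_time w k : \bar R := (jump w k).1.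

Definition jump_chain w k : E := (jump w k).2.

Definition holding_time w k : \bar R :=
  if jump_time w k is s%:E then (jump_time w k.+1 - s%:E)%E else +oo%E.

Definition hitting_time w A : \bar R :=
  ereal_inf [set t%:E | t in [set t : R | 0 <= t /\ w t \in A]].

Definition return_time w A : \bar R :=
  ereal_inf [set t%:E | t in
               [set t : R | (jump_time w 1%N < t%:E)%E /\ w t \in A]].

End path.

(* The wells [V j] of a partition {V 0, ..., V (m-1), Delta}; the remainder
   Delta is the complement of their union and may be empty. *)
Definition wells (E : finType) (m : nat) (V : 'I_m -> {set E}) : Prop :=
  (forall j, exists x, x \in V j) /\
  (forall i j x, x \in V i -> x \in V j -> i = j).

Definition wells_union (E : finType) (m : nat) (V : 'I_m -> {set E}) : {set E} :=
  (\bigcup_j V j)%SET.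

Section ctmc.
Context (R : realType) (E : finType) (r : E -> E -> R).
Context d (Omega : measurableType d) (P : E -> probability Omega R).
Variable X : R -> Omega -> E.

(* Under [P x], X_t is the continuous-time Markov chain with jump rates [r]
   started at [x], in the jump chain / holding times description: the jump
   chain is Markov with transition probabilities [jump_prob r] and, given the
   jump chain (Y_k), the holding times are independent, exponential of
   parameter [hold_rate r Y_k]. *)
Definition is_ctmc : Prop :=
  [/\ (forall t y, 0 <= t -> measurable [set o | X t o = y]),
      (forall o, cadlag (X ^~ o)) &
      (forall x m (y : nat -> E) (t : nat -> R), (forall k, 0 <= t k) ->
         P x [set o | forall k, (k <= m)%N ->
                jump_chain (X ^~ o) k = y k /\
                ((t k)%:E < holding_time (X ^~ o) k)%E]
         = ((x == y 0%N)%:R * (\prod_(k < m) jump_prob r (y k) (y k.+1))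
            * \prod_(k < m.+1) expR (- (hold_rate r (y k) * t k)))%:E)].

(* lambda(x) P_x[H_y = H^+_W] *)
Definition trace_rate (W : {set E}) (x y : E) : R :=
  hold_rate r x *
  fine (P x [set o | hitting_time (X ^~ o) [set y]%SET
                     = return_time (X ^~ o) W]).

Definition mean_rate (w : simplex R E) (m : nat) (V : 'I_m -> {set E})
    (i j : 'I_m) : R :=
  (mass w (V i))^-1 *
  \sum_(x in V i) w x *
    \sum_(y in V j) trace_rate (wells_union V) x y.

End ctmc.

(** * The state space and its discretization *)

Section torus.
Context (R : realType) (d : nat).

Definition torus_rel : rel 'rV[R]_d := fun x y => x - y \is a mxOver Num.int.

Lemma torus_rel_refl : reflexive torus_rel.
Proof. by move=> x; apply/mxOverP => i j; rewrite subrr mxE rpred0. Qed.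

Lemma torus_rel_sym : symmetric torus_rel.
Proof.
by move=> x y; apply/mxOverP/mxOverP => xy i j;
  rewrite -opprB mxE rpredN; exact: xy.
Qed.

Lemma torus_rel_trans : transitive torus_rel.
Proof.
move=> y x z /mxOverP xy /mxOverP yz; apply/mxOverP => i j.
by rewrite -(subrKA y) mxE rpredD ?xy ?yz.
Qed.

Canonical torus_equiv :=
  EquivRel torus_rel torus_rel_refl torus_rel_sym torus_rel_trans.

(* R^d / Z^d with the quotient topology *)
Definition torus : Type := quotient_topology {eq_quot torus_rel}%qT.

HB.instance Definition _ := PointedTopological.on torus.

Definition torus_pi (x : 'rV[R]_d) : torus := (\pi x)%qT.

End torus.

(* The closure of U with its subspace topology; the library's measurable types
   are pointed, hence the need for nonemptiness. *)
Definition domain (R : realType) (d : nat) (U : set 'rV[R]_d) (U0 : U !=set0) :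
  Type := set_type (closure U).

Section domain.
Context (R : realType) (d : nat) (U : set 'rV[R]_d) (U0 : U !=set0).

HB.instance Definition _ := Topological.on (domain U0).

Lemma domain_pointed : closure U (projT1 (cid U0)).
Proof. by apply: subset_closure; exact: projT2. Qed.

HB.instance Definition _ := isPointed.Build (domain U0)
  (exist _ (projT1 (cid U0)) (mem_set domain_pointed)).

End domain.

Inductive state_space (R : realType) (d : nat) : Type :=
| Domain (U : set 'rV[R]_d) (U0 : U !=set0) of open U & bounded_set U
| Torus.

Definition carrier (R : realType) (d : nat) (Xi : state_space R d) :
    ptopologicalType :=
  match Xi with
  | Domain _ U0 _ _ => domain U0
  | Torus => torus R d
  end.

(* n^-1 Z^d *)
Definition lattice (R : realType) (d n : nat) : set 'rV[R]_d :=
  [set x | n%:R *: x \is a mxOver Num.int].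

(* Xi_n; for the torus, the projection of n^-1 Z^d *)
Definition grid (R : realType) (d : nat) (Xi : state_space R d) (n : nat) :
    set (carrier Xi) :=
  match Xi return set (carrier Xi) with
  | Domain _ _ _ _ => [set x | lattice n (set_val x)]
  | Torus => @torus_pi R d @` lattice n
  end.

Arguments grid {R d} Xi n.

Section discretization.
Context (R : realType) (d : nat) (Xi : state_space R d).

Lemma finite_bounded_lattice n (M : R) : (0 < n)%N ->
  finite_set [set x : 'rV[R]_d | n%:R *: x \is a mxOver Num.int /\ `|x| <= M].
Proof.
move=> n0; have nR0 : n%:R != 0 :> R by rewrite pnatr_eq0 -lt0n.
pose K := Num.bound (n%:R * `|M|).
pose f (g : {ffun 'I_d -> 'I_(K + K).+1}) : 'rV[R]_d :=
  \row_j (n%:R^-1 * ((g j)%:R - K%:R)).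
apply: (@sub_finite_set _ _ (f @` setT)); last exact/finite_image/finite_finset.
move=> x [/mxOverP nx xM].
have H j : exists k : 'I_(K + K).+1, n%:R * x 0 j = k%:R - K%:R.
  have /intrP[m] := nx 0 j; rewrite mxE => xm.
  have : `|m%:~R : R| < K%:R.
    rewrite -xm normrM normr_nat (le_lt_trans _ (archi_boundP _))//.
    rewrite ler_wpM2l// (le_trans _ (ler_norm M))// (le_trans _ xM)//.
    have /mapP[k _ ->] : `|x 0 j| \in [seq `|x i.1 i.2| | i : 'I_1 * 'I_d].
      by apply/mapP; exists (0, j) => //=; rewrite mem_enum.
    rewrite [leRHS]/Num.Def.normr /= mx_normrE; apply/bigmax_geP; right => /=.
    by exists k.
  rewrite -intr_norm [K%:R]pmulrn ltr_int ltr_norml => /andP[m1 m2].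
  have k0 : 0 <= m + K%:Z by rewrite -lerBlDr sub0r ltW.
  have kK : (absz (m + K%:Z)%R < (K + K).+1)%N.
    by rewrite -ltz_nat gez0_abs// -addn1 !PoszD ltzD1 lerD2r ltW.
  exists (Ordinal kK) => /=.
  by rewrite xm [X in _ = X - _]pmulrn gez0_abs// intrD -pmulrn addrK.
have [g gP] := choice H.
exists [ffun j => g j] => //; apply/rowP => j.
by rewrite mxE ffunE -gP mulrA mulVf// mul1r.
Qed.

Lemma finite_grid n : (0 < n)%N -> finite_set (grid Xi n).
Proof.
move=> n0; case: Xi => [U U0 oU bU|] /=.
  have [u Uu] := U0; have PF := globally_properfilter Uu.
  have /ex_bound[M UM] := bU.
  have clM : closure U `<=` [set x | `|x| <= M].
    rewrite (_ : [set x | `|x| <= M] = closure [set x | `|x| <= M]).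
      exact: closureS.
    apply/closure_id.
    apply: (@preimage_closed _ _ (@Num.norm R 'rV[R]_d) [set r | r <= M]).
      by move=> x _; exact: norm_continuous.
    exact: closed_le.
  pose v (z : domain U0) : 'rV[R]_d := val z.
  have vI : injective v by move=> x y; exact: val_inj.
  apply: sub_finite_set
    (finite_preimage (f := v) _ (finite_bounded_lattice M n0)).
    by move=> x nx; split => //; exact: (clM (v x) (set_valP x)).
  by move=> x y _ _; exact: vI.
apply: sub_finite_set
  (finite_image (@torus_pi R d) (finite_bounded_lattice 1 n0)).
move=> _ [x /mxOverP nx <-].
pose y : 'rV[R]_d := \row_j (x 0 j - (Num.floor (x 0 j))%:~R).
exists y.
  split.
    apply/mxOverP => i j; have := nx 0 j.
    rewrite ord1 !mxE mulrBr => /intrP[m ->].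
    by rewrite pmulrn -intrM -rmorphB/= intr_int.
  rewrite [leLHS]/Num.Def.normr /= mx_normrE; apply: bigmax_le => //= i _.
  rewrite mxE ger0_norm ?subr_ge0 ?floor_le// lerBlDl.
  by have /andP[_ /ltW] := floor_itv (x 0 i.2); rewrite intrD.
apply/esym/eqquotP/mxOverP => i j.
by rewrite !mxE ord1 opprB addrC subrK.
Qed.

Definition site (n : nat) : finType := fset_set (grid Xi n).

Definition site_pt n (x : site n) : carrier Xi := val x.

Lemma range_site_pt n : (0 < n)%N -> range (@site_pt n) = grid Xi n.
Proof.
move=> n0; apply/seteqP; split => [_ [x _ <-]|x nx].
  have := valP x; rewrite in_fset_set ?inE//; exact: finite_grid.
have xn : x \in fset_set (grid Xi n).
  by rewrite in_fset_set ?inE//; exact: finite_grid.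
by exists [` xn ]%fset.
Qed.

(* P(Xi_n) as a subset of P(Xi) *)
Definition embed n (w : simplex R (site n)) : borel_prob (carrier Xi) R :=
  mixture w (fun x => point_mass R (site_pt x)).

(* I_n *)
Definition rate_functional n (r : site n -> site n -> R)
    (mu : borel_prob (carrier Xi) R) : \bar R :=
  if mu (grid Xi n) == 1%E
  then level2_rate r (fun x => fine (mu [set site_pt x]))
  else +oo%E.

End discretization.

(** * The limiting functionals *)

Section limits.
Context (R : realType) (T : ptopologicalType).
Variables (nn : nat -> nat).
Variable x : 'I_(nn 1%N) -> T.
Variable M : forall p, 'I_(nn p.+1) -> simplex R 'I_(nn p).
Variable r : forall p, 'I_(nn p) -> 'I_(nn p) -> R.

(* [limit_state p] is the family (pi^(p+1)_j)_j. *)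
Fixpoint limit_state (p : nat) : 'I_(nn p.+1) -> borel_prob T R :=
  if p is p'.+1 then fun j => mixture (M j) (@limit_state p')
  else fun j => point_mass R (x j).

(* [omega] is unique, the measures pi^(p+1)_j having disjoint supports. *)
Definition limit_rate (p : nat) (mu : borel_prob T R) : \bar R :=
  match pselect (exists w : simplex R 'I_(nn p.+1),
                   same_measure mu (mixture w (@limit_state p))) with
  | left h => level2_rate (@r p.+1) (projT1 (cid h))
  | right _ => +oo%E
  end.

Definition limit_functional (I0 : borel_prob T R -> \bar R) (p : nat) :
    borel_prob T R -> \bar R :=
  if p is p'.+1 then limit_rate p' else I0.

End limits.

(* Main.v *)
Require Import Defs.
From HB Require Import structures.
From mathcomp Require Import all_boot all_order all_algebra finmap.
From mathcomp Require Import all_classical all_reals all_analysis.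
From mathcomp Require Import measurable_realfun.
From mathcomp Require Import ring lra.

Set Implicit Arguments.
Unset Strict Implicit.
Unset Printing Implicit Defensive.

Import Order.TTheory GRing.Theory Num.Theory.
Import numFieldNormedType.Exports.

Local Open Scope classical_set_scope.
Local Open Scope ring_scope.

(** Two identities for a reversible chain carry the proof. First, the level-two
    rate of a measure [mu = f pi] is the Dirichlet form of the square root of [f]
    ([level2_rate_sqrt]). Second, among the functions with prescribed values on a
    set [W] the Dirichlet form is minimal at the one which is harmonic off [W],
    where it equals the Dirichlet form of the chain traced on [W]
    ([dform_harmonic], [trace_form_le]). The trace rates are given as
    probabilities of events on paths; [trace_rate_harmonic] computes them from
    harmonic measures.

    Fix a time-scale p and weights [w_i] of the wells. A density whose square
    root equals [a_i = sqrt (w_i / pi_n (V_i))] on the well [V_i] and is harmonic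
    elsewhere has, after multiplication by theta_n, a rate equal to half the sum
    of [pi_n (V_i) theta_n r_n(i, j) (a_j - a_i)^2]. By detailed balance this is a
    continuous function of the scaled mean rates [theta_n r_n(i, j)] and of [w]
    alone ([flow_identity]), so it converges, although [pi_n (V_i)] may not; the
    limit is the level-two rate of [w] for the reduced chain ([coarse_form_cvg]).
    Truncating and normalising this density gives the recovery sequence
    ([level_recovery]). Conversely, if [theta_n I_n (mu_n)] stays bounded, the
    local Poincare inequality, which controls the maximum over the base point,
    forces the square root of the density of [mu_n] to be uniformly close to
    [a_i] on [V_i] ([density_flat]), so that the trace form of this square root
    is at least the form above up to a vanishing error ([level_liminf]).

    It remains to see why the limit of such [mu_n] is a mixture of the states
    pi^(p)_j. This is an induction on p ([gamma_lower]): boundedness at one scale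
    makes the rate vanish at the preceding one, hence places the limit in the
    zero set of the preceding functional, which is the domain of the next one
    ([limit_functional_zeroS]). That last fact is about the reduced chains.
    Detailed balance and the lower bound on the relative masses of the wells make
    the relation [0 < r(i, j)] symmetric: there are no transient states, the
    wells of all scales have the same union, and the ratios of the masses of
    wells in a common class converge, to the ratios of a positive reversing
    measure [nu] ([level_measure]). The stationary states of the classes are
    therefore the conditionings of [nu] ([class_stationaryE]), the conditional
    laws of [pi_n] on the wells converge to the states pi^(p)_j
    ([limit_state_cvg]), and a weight [w] has zero rate exactly when [w / nu] is
    constant on each class, that is when [w] is a mixture of these stationary
    states ([level2_rate_eq0]). *)

(** * Dirichlet forms and the level-two rate *)

(** Unlike [dirichlet], this form is neither restricted to a subset nor divided
    by a mass, and it takes any measure in place of a probability. *)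
Definition dform (R : realType) (E : finType) (r : E -> E -> R) (nu g : E -> R)
    : R :=
  2^-1 * \sum_x \sum_y nu x * r x y * (g y - g x) ^+ 2.

Section reversible.
Variables (R : realType) (E : finType) (r : E -> E -> R) (nu : E -> R).
Hypothesis r_ge0 : forall x y, x != y -> 0 <= r x y.
Hypothesis nu_gt0 : forall x, 0 < nu x.
Hypothesis nu_rev : forall x y, nu x * r x y = nu y * r y x.

(** Detailed balance makes the flow [nu x * r x y] symmetric, so the double sum
    may be symmetrised in x and y. *)
Lemma gen_by_parts (u v : E -> R) :
  \sum_x nu x * (u x * gen r v x) =
  - (2^-1 * \sum_x \sum_y nu x * r x y * ((u y - u x) * (v y - v x))).
Proof.
pose F x y := nu x * r x y * (u x * (v y - v x)).
have -> : \sum_x nu x * (u x * gen r v x) = \sum_x \sum_y F x y.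
  apply: eq_bigr => x _; rewrite /gen 2!mulr_sumr; apply: eq_bigr => y _.
  by rewrite /F; ring.
have sw : \sum_x \sum_y F x y = \sum_x \sum_y F y x by rewrite exchange_big.
suff -> : \sum_x \sum_y nu x * r x y * ((u y - u x) * (v y - v x)) =
    - (\sum_x \sum_y F x y + \sum_x \sum_y F y x).
  by rewrite -sw; field.
rewrite -big_split -sumrN /=; apply: eq_bigr => x _.
rewrite -big_split -sumrN /=; apply: eq_bigr => y _.
by rewrite /F -(nu_rev x y); ring.
Qed.

Lemma flow_ge0 x y : x != y -> 0 <= nu x * r x y.
Proof. by move=> xy; rewrite mulr_ge0 ?r_ge0// ltW. Qed.

Lemma dform_term_ge0 (g : E -> R) x y : 0 <= nu x * r x y * (g y - g x) ^+ 2.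
Proof.
have [->|xy] := eqVneq x y; first by rewrite subrr expr0n mulr0.
by rewrite mulr_ge0 ?flow_ge0 ?sqr_ge0.
Qed.

Lemma dform_ge0 (g : E -> R) : 0 <= dform r nu g.
Proof.
rewrite mulr_ge0 ?invr_ge0//; apply: sumr_ge0 => x _; apply: sumr_ge0 => y _.
exact: dform_term_ge0.
Qed.

Lemma dform_le (g h : E -> R) :
  (forall x y, `|g y - g x| <= `|h y - h x|) -> dform r nu g <= dform r nu h.
Proof.
move=> gh; rewrite ler_wpM2l ?invr_ge0//.
apply: ler_sum => x _; apply: ler_sum => y _.
have [->|xy] := eqVneq x y; first by rewrite !subrr.
rewrite ler_wpM2l ?flow_ge0//.
by rewrite -(real_normK (num_real (g y - g x))) -(real_normK (num_real (h y - h x)))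
  lerXn2r ?nnegrE.
Qed.

(** Every term of the form is nonnegative, so each edge forces equality. *)
Lemma dform_eq0_connect (g : E -> R) : dform r nu g = 0 ->
  forall x y, connect (edge r) x y -> g x = g y.
Proof.
move=> /eqP; rewrite mulf_eq0 invr_eq0 (negbTE (lt0r_neq0 _))//= => /eqP g0.
have e x y : edge r x y -> g x = g y.
  move=> /andP[xy rxy].
  have := psumr_eq0P _ g0 (i := x) isT.
  move=> /(_ (fun x _ => sumr_ge0 _ (fun y _ => dform_term_ge0 g x y))) gx0.
  have := psumr_eq0P (fun y _ => dform_term_ge0 g x y) gx0 (i := y) isT.
  move=> /eqP; rewrite mulf_eq0 expf_eq0/= subr_eq0 gt_eqF ?mulr_gt0//=.
  by move=> /eqP.
move=> x y /connectP[s]; elim: s x => [|z s IH] x /=; first by move=> _ ->.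
by move=> /andP[xz zs] ys; rewrite (e _ _ xz); exact: IH.
Qed.

(** Picone's inequality: after summation by parts against the test function [h],
    each edge contributes [(g y^2 / h y - g x^2 / h x) (h y - h x)], which falls
    short of [(g y - g x)^2] by the square
    [(g y * h x - g x * h y)^2 / (h x * h y)]. *)
Lemma level2_rate_le_dform (mu g : E -> R) :
  (forall x, mu x = nu x * g x ^+ 2) ->
  (level2_rate r mu <= (dform r nu g)%:E)%E.
Proof.
move=> mug; apply: ge_ereal_sup => _ [h /= h0 <-]; rewrite lee_fin.
pose u x := g x ^+ 2 / h x.
have -> : - \sum_x gen r h x / h x * mu x = - \sum_x nu x * (u x * gen r h x).
  congr (- _); apply: eq_bigr => x _; rewrite mug /u.
  by have hx := lt0r_neq0 (h0 x); field.
rewrite gen_by_parts opprK ler_wpM2l ?invr_ge0//.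
apply: ler_sum => x _; apply: ler_sum => y _.
have [->|xy] := eqVneq x y; first by rewrite !subrr mulr0 expr0n.
rewrite ler_wpM2l ?flow_ge0// /u -subr_ge0.
have hx := lt0r_neq0 (h0 x); have hy := lt0r_neq0 (h0 y).
have -> : (g y - g x) ^+ 2 - (g y ^+ 2 / h y - g x ^+ 2 / h x) * (h y - h x) =
    (g y * h x - g x * h y) ^+ 2 / (h x * h y) by field; rewrite hx hy.
by rewrite divr_ge0 ?sqr_ge0// mulr_ge0// ltW.
Qed.

(** The optimal test function is [g] itself; as it may vanish, it is replaced by
    [g + e], at a cost which is linear in [e]. *)
Lemma dform_le_level2_rate (mu g : E -> R) : (forall x, 0 <= g x) ->
  (forall x, mu x = nu x * g x ^+ 2) ->
  ((dform r nu g)%:E <= level2_rate r mu)%E.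
Proof.
move=> g0 mug.
pose K := 2^-1 * \sum_x \sum_y nu x * r x y * `|g y - g x|.
apply/lee_addgt0Pr => e e0.
have K0 : 0 <= K.
  rewrite mulr_ge0 ?invr_ge0//; apply: sumr_ge0 => x _; apply: sumr_ge0 => y _.
  have [->|xy] := eqVneq x y; first by rewrite subrr normr0 mulr0.
  by rewrite mulr_ge0 ?flow_ge0.
have K1 : 0 < K + 1 by rewrite ltr_wpDl.
(* [d] is the shift of the test function, [d * K] bounds its cost. *)
have [d d0 dK] : exists2 d, 0 < d & d * K <= e.
  exists (e / (K + 1)); first by rewrite divr_gt0.
  by rewrite mulrAC ler_pdivrMr// ler_pM2l// lerDl.
pose h x := g x + d; have h0 x : 0 < h x by rewrite ltr_wpDl.
rewrite -leeBlDr//; apply: le_ereal_sup_tmp.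
exists (- \sum_x gen r h x / h x * mu x)%:E; first by exists h.
rewrite -EFinB lee_fin.
pose u x := g x ^+ 2 / h x.
have -> : - \sum_x gen r h x / h x * mu x = - \sum_x nu x * (u x * gen r h x).
  congr (- _); apply: eq_bigr => x _; rewrite mug /u.
  by have hx := lt0r_neq0 (h0 x); field.
rewrite gen_by_parts opprK lerBlDr.
apply: (@le_trans _ _ (2^-1 *
    \sum_x \sum_y nu x * r x y * ((u y - u x) * (h y - h x)) + d * K)); last first.
  by rewrite lerD2l.
rewrite /K [d * _]mulrCA -mulrDr ler_wpM2l ?invr_ge0//.
rewrite mulr_sumr -big_split; apply: ler_sum => x _ /=.
rewrite mulr_sumr -big_split; apply: ler_sum => y _ /=.
rewrite (mulrCA d) -mulrDr.
have [->|xy] := eqVneq x y; first by rewrite !subrr !(mulr0,expr0n,normr0,addr0).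
rewrite ler_wpM2l ?flow_ge0//.
have hx := lt0r_neq0 (h0 x); have hy := lt0r_neq0 (h0 y).
have -> : (u y - u x) * (h y - h x) =
    (g y - g x) ^+ 2 - d ^+ 2 * `|g y - g x| ^+ 2 / (h x * h y).
  rewrite real_normK ?num_real// /u /h; field.
  by rewrite hx hy.
rewrite -addrA lerDl addrC subr_ge0 ler_pdivrMr ?mulr_gt0//.
rewrite 2!expr2 -!mulrA ler_pM2l// mulrCA ler_wpM2l//.
have := g0 x; have := g0 y; rewrite /h => gy gx.
have [ge|le] := leP (g x) (g y).
  by rewrite ger0_norm ?subr_ge0//; apply: ler_pM; lra.
by rewrite ltr0_norm ?subr_lt0// mulrC; apply: ler_pM; lra.
Qed.

Lemma level2_rate_dform (mu g : E -> R) : (forall x, 0 <= g x) ->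
  (forall x, mu x = nu x * g x ^+ 2) -> level2_rate r mu = (dform r nu g)%:E.
Proof.
by move=> g0 mug; apply/le_anti; rewrite level2_rate_le_dform//=
  dform_le_level2_rate.
Qed.

(** The Donsker-Varadhan identity for reversible chains. *)
Lemma level2_rate_sqrt (mu : E -> R) : (forall x, 0 <= mu x) ->
  level2_rate r mu = (dform r nu (fun x => Num.sqrt (mu x / nu x)))%:E.
Proof.
move=> mu0; apply: level2_rate_dform => [x|x]; first exact: sqrtr_ge0.
by rewrite sqr_sqrtr ?divr_ge0// ?ltW// mulrCA divff ?mulr1// lt0r_neq0.
Qed.

End reversible.

Lemma level2_rate_ge0 (R : realType) (E : finType) (r : E -> E -> R) mu :
  (0 <= level2_rate r mu)%E.
Proof.
apply: le_ereal_sup_tmp; exists 0%E => //; exists (cst 1) => //=.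
congr (_%:E); rewrite big1 ?oppr0// => x _.
by rewrite /gen big1 ?mul0r// => y _; rewrite subrr mulr0.
Qed.

(** * Harmonic functions and harmonic measures *)

Lemma cvg_sumr (R : realType) (I : finType) (P : pred I) (f : I -> nat -> R)
    (l : I -> R) : (forall i, P i -> f i n @[n --> \oo] --> l i) ->
  (\sum_(i | P i) f i n) @[n --> \oo] --> \sum_(i | P i) l i.
Proof. by move=> fl; apply: cvg_big => //; exact: add_continuous. Qed.

(** The transition operator of the jump chain stopped on [W]: its k-th iterate
    applied to [v] at [x] is the expectation of [v] at the position, started at
    [x], after k steps or on reaching [W]. *)
Definition stopped_step (R : realType) (E : finType) (r : E -> E -> R)
    (W : {set E}) (v : E -> R) (x : E) : R :=
  if x \in W then v x else \sum_y jump_prob r x y * v y.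

Definition indicator (R : realType) (E : finType) (S : {set E}) (x : E) : R :=
  (x \in S)%:R.

Lemma hold_rate_gt0 (R : realType) (E : finType) (r : E -> E -> R) (a b : E) :
  (forall x y, 0 <= r x y) -> irreducible_chain r -> a != b ->
  forall x, 0 < hold_rate r x.
Proof.
move=> r0 irr ab x.
have [y xy] : exists y, x != y.
  by have [->|] := eqVneq x a; [exists b | exists a].
have /connectP[[|z s] /=] := irr x y; first by move=> _ yx; rewrite yx eqxx in xy.
move=> /andP[/andP[_ xz] _] _; rewrite /hold_rate (bigD1 z)//=.
by rewrite ltr_pwDl// sumr_ge0.
Qed.

Section stopped.
Variables (R : realType) (E : finType) (r : E -> E -> R).
Hypothesis r_ge0 : forall x y, 0 <= r x y.
Hypothesis hr : forall x, 0 < hold_rate r x.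

Let p := jump_prob r.

Lemma jump_probE x y : p x y = r x y / hold_rate r x.
Proof. by rewrite /p /jump_prob gt_eqF. Qed.

Lemma jump_prob_ge0 x y : 0 <= p x y.
Proof. by rewrite jump_probE divr_ge0// ltW. Qed.

Lemma jump_prob_sum x : \sum_y p x y = 1.
Proof.
rewrite (eq_bigr (fun y => r x y / hold_rate r x)) => [|y _].
  by rewrite -mulr_suml -/(hold_rate r x) divff ?gt_eqF.
exact: jump_probE.
Qed.

Lemma gen_jump_prob (g : E -> R) x :
  gen r g x = hold_rate r x * (\sum_y p x y * g y - g x).
Proof.
rewrite mulrBr mulr_sumr.
have -> : hold_rate r x * g x = \sum_y r x y * g x by rewrite -mulr_suml.
rewrite -sumrB; apply: eq_bigr => y _.
by rewrite jump_probE mulrBr; have h := lt0r_neq0 (hr x); field.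
Qed.

Variable W : {set E}.
Let T := stopped_step r W.

Lemma stopped_step_fixE (g : E -> R) :
  (forall x, x \notin W -> gen r g x = 0) <-> (forall x, T g x = g x).
Proof.
split => H x; rewrite /T /stopped_step.
  case: ifPn => // /H; rewrite gen_jump_prob => /eqP.
  by rewrite mulf_eq0 gt_eqF//= subr_eq0 => /eqP.
move=> xW; rewrite gen_jump_prob; have := H x.
by rewrite /T /stopped_step (negbTE xW) => ->; rewrite subrr mulr0.
Qed.

Lemma stopped_step_le (u v : E -> R) :
  (forall x, u x <= v x) -> forall x, T u x <= T v x.
Proof.
move=> uv x; rewrite /T /stopped_step; case: ifP => // _.
by apply: ler_sum => y _; rewrite ler_wpM2l ?jump_prob_ge0.
Qed.

Lemma iter_stoppedD (u v : E -> R) k x :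
  iter k T (fun y => u y + v y) x = iter k T u x + iter k T v x.
Proof.
elim: k x => //= k IH x; rewrite /T /stopped_step; case: ifP => _.
  by rewrite -IH.
by rewrite -big_split; apply: eq_bigr => y _; rewrite -/(T) IH mulrDr.
Qed.

Lemma iter_stopped_in v k x : x \in W -> iter k T v x = v x.
Proof. by move=> xW; elim: k => //= k IH; rewrite {1}/T /stopped_step xW. Qed.

(** For an excessive function the iterates decrease, and a limit of iterates is
    a fixed point, that is a function harmonic off [W]. *)
Lemma stopped_step_cvg (v : E -> R) :
  (forall x, 0 <= v x) -> (forall x, T v x <= v x) ->
  exists l : E -> R,
    [/\ forall x, iter k T v x @[k --> \oo] --> l x,
        forall x, 0 <= l x,
        forall x, T l x = l x & forall x, x \in W -> l x = v x].
Proof.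
move=> v0 Tv.
have ge0 k x : 0 <= iter k T v x.
  elim: k x => //= k IH x; rewrite /T /stopped_step; case: ifP => // _.
  by apply: sumr_ge0 => y _; rewrite mulr_ge0 ?jump_prob_ge0.
have dec k x : iter k.+1 T v x <= iter k T v x.
  elim: k x => [x|k IH x]; first exact: Tv.
  by rewrite 2!iterS; apply: stopped_step_le.
have cv x : cvgn (fun k => iter k T v x).
  apply: nonincreasing_is_cvgn; last by exists 0 => _ [k _ <-].
  by apply/nonincreasing_seqP => k; exact: dec.
exists (fun x => limn (fun k => iter k T v x)); split => [//|x|x|x xW].
- by apply: limr_ge => //; apply: nearW => k.
- rewrite {1}/T /stopped_step; case: ifPn => // xW.
  apply/esym/cvg_lim => //.
  rewrite -cvg_shiftS /=.
  under eq_fun do rewrite {1}/T /stopped_step (negbTE xW).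
  by apply: cvg_sumr => y _; apply: cvgMl_tmp; exact: cv.
- apply: cvg_lim => //; rewrite (_ : (fun k => _) = cst (v x)); first exact: cvg_cst.
  by apply/funext => k; exact: iter_stopped_in.
Qed.

End stopped.

Section harmonic.
Variables (R : realType) (E : finType) (r : E -> E -> R) (nu : E -> R).
Hypothesis r_ge0 : forall x y, 0 <= r x y.
Hypothesis nu_gt0 : forall x, 0 < nu x.
Hypothesis nu_rev : forall x y, nu x * r x y = nu y * r y x.
Hypothesis irr : irreducible_chain r.
Variable W : {set E}.
Variables (w0 : E) (w0W : w0 \in W).

(** The cross term vanishes by summation by parts: [u] is zero on [W] and the
    generator of [h] is zero off [W]. *)
Lemma dform_harmonicD (h u : E -> R) :
  (forall x, x \notin W -> gen r h x = 0) -> (forall x, x \in W -> u x = 0) ->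
  dform r nu (fun x => h x + u x) = dform r nu h + dform r nu u.
Proof.
move=> h0 u0.
have := gen_by_parts nu_rev u h.
rewrite big1 => [|x _]; last first.
  by case: (boolP (x \in W)) => xW; [rewrite u0// mul0r|rewrite h0// mulr0]; rewrite mulr0.
move=> /esym/eqP; rewrite oppr_eq0 => /eqP S0.
rewrite -[RHS]addr0 -[X in _ = _ + X](mulr0 2) -S0 /dform -mulrDr mulrCA -mulrDr; congr (_ * _).
rewrite mulr_sumr -!big_split /=; apply: eq_bigr => x _.
rewrite mulr_sumr -!big_split /=; apply: eq_bigr => y _; ring.
Qed.

Lemma dform_harmonic_le (h g : E -> R) :
  (forall x, x \notin W -> gen r h x = 0) -> (forall x, x \in W -> g x = h x) ->
  dform r nu h <= dform r nu g.
Proof.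
move=> h0 gh.
have -> : g = (fun x => h x + (g x - h x)) by apply/funext => x; rewrite subrKC.
by rewrite dform_harmonicD// ?lerDl ?dform_ge0// => x xW; rewrite gh// subrr.
Qed.

(** The Dirichlet form of such a [g] is zero, so irreducibility makes [g]
    constant. *)
Lemma harmonic_eq0 (g : E -> R) : (forall x, x \notin W -> gen r g x = 0) ->
  (forall x, x \in W -> g x = 0) -> forall x, g x = 0.
Proof.
move=> h0 g0 x; rewrite -(g0 _ w0W).
apply: (@dform_eq0_connect _ _ r nu) => //.
have := gen_by_parts nu_rev g g.
rewrite big1 => [|z _]; last first.
  by case: (boolP (z \in W)) => zW; [rewrite g0// mul0r|rewrite h0// mulr0]; rewrite mulr0.
move=> /esym/eqP; rewrite oppr_eq0 => /eqP <-; rewrite /dform; congr (_ * _).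
Qed.

Hypothesis hr : forall x, 0 < hold_rate r x.

Let T := stopped_step r W.

(** The function [e x] is the probability that the chain started at [x] enters
    [W] through [S]. The indicator of [S] is not excessive, but the indicators of
    the complement of [W] and of its union with [S] are. The iterates of the
    former tend to zero by [harmonic_eq0], and subtracting them from those of the
    latter leaves the iterates of the indicator of [S]. *)
Lemma harmonic_measure (S : {set E}) : S \subset W ->
  exists e : E -> R,
    [/\ forall x, iter k T (indicator R S) x @[k --> \oo] --> e x,
        forall x, x \notin W -> gen r e x = 0 &
        forall x, x \in W -> e x = indicator R S x].
Proof.
move=> SW.
have p1 (A : {set E}) x : \sum_y jump_prob r x y * indicator R A y <= 1.
  rewrite -(jump_prob_sum hr x); apply: ler_sum => y _.
  by rewrite ler_piMr ?jump_prob_ge0// /indicator lern1 leq_b1.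
have sup (A : {set E}) x : ~: W \subset A -> T (indicator R A) x <= indicator R A x.
  move=> WA; rewrite /T /stopped_step; case: ifPn => // xW.
  have xA : x \in A by apply: (fintype.subsetP WA); rewrite inE.
  by rewrite {2}/indicator xA p1.
have i0 (A : {set E}) x : 0 <= indicator R A x by rewrite /indicator ler0n.
have [l [lc l0 lT lW]] := stopped_step_cvg r_ge0 hr (i0 (~: W))
  (fun x => sup _ x (fintype.subxx _)).
have [e [ec e0 eT eW]] := stopped_step_cvg r_ge0 hr (i0 (S :|: ~: W))
  (fun x => sup _ x (finset.subsetUr _ _)).
have {}l0 : forall x, l x = 0.
  apply: harmonic_eq0; first exact/(stopped_step_fixE hr).
  by move=> x xW; rewrite lW// /indicator inE xW.
exists e; split => [x||x xW].
- have SUW : indicator R (S :|: ~: W) = (fun y => indicator R S y + indicator R (~: W) y).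
    apply/funext => y; rewrite /indicator !inE.
    case: (boolP (y \in S)) => [/(fintype.subsetP SW) ->|_] /=; first by rewrite addr0.
    by rewrite add0r.
  have -> : (fun k => iter k T (indicator R S) x) = (fun k =>
      iter k T (indicator R (S :|: ~: W)) x - iter k T (indicator R (~: W)) x).
    by apply/funext => k; rewrite SUW iter_stoppedD addrK.
  by rewrite -[e x]subr0 -(l0 x); exact: cvgB.
- exact/(stopped_step_fixE hr).
- by rewrite eW// /indicator !inE xW orbF.
Qed.

Lemma harmonic_extension (g : E -> R) :
  exists u : E -> R, (forall x, x \notin W -> gen r u x = 0) /\
    (forall x, x \in W -> u x = g x).
Proof.
have H z : exists e : E -> R, z \in W ->
    (forall x, x \notin W -> gen r e x = 0) /\
    (forall x, x \in W -> e x = (x == z)%:R).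
  case: (boolP (z \in W)) => zW; last by exists (cst 0).
  have [|e [_ e1 e2]] := @harmonic_measure [set z]; first by rewrite finset.sub1set.
  by exists e => _; split => // x /e2 ->; rewrite /indicator inE.
have [e eP] := choice H.
exists (fun x => \sum_(z in W) g z * e z x); split => x xW.
  rewrite /gen.
  under eq_bigr do rewrite -sumrB mulr_sumr.
  rewrite exchange_big big1// => z zW.
  have [/(_ x xW) ez _] := eP z zW.
  transitivity (g z * gen r (e z) x); last by rewrite ez mulr0.
  by rewrite /gen mulr_sumr; apply: eq_bigr => y _; ring.
rewrite (bigD1 x)//= (eP x xW).2// eqxx mulr1 big1 ?addr0// => z /andP[zW zx].
by rewrite (eP z zW).2// eq_sym (negbTE zx) mulr0.
Qed.

End harmonic.

(** * Jump times, first returns and hitting times along a path *)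

Section cadlag_path.
Variables (R : realType) (E : finType) (w : R -> E).
Hypothesis wc : cadlag w.

Let T k := jump_time w k.
Let Y k := jump_chain w k.

Lemma right_const (t : R) : 0 <= t ->
  exists2 e, 0 < e & forall s, t <= s -> s < t + e -> w s = w t.
Proof.
move=> t0; have [/(_ t t0) [e /= e0 He] _] := wc.
exists e => // s; rewrite le_eqVlt => /predU1P[->//|ts] st.
by apply: He => //=; rewrite ltr0_norm ?subr_lt0// opprB ltrBlDl.
Qed.

Lemma jump_time0 : T 0 = 0%E. Proof. by []. Qed.

Lemma jump_timeS k : T k.+1 = ereal_inf
  [set t%:E | t in [set t : R | (T k <= t%:E)%E /\ w t <> Y k]].
Proof. by rewrite /T /Y /jump_time /jump_chain /=; case: (jump w k). Qed.

Lemma jump_chainS k : Y k.+1 = if T k.+1 is t%:E then w t else Y k.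
Proof. by rewrite /T /Y /jump_time /jump_chain /=; case: (jump w k). Qed.

Lemma jump_time_le k : (T k <= T k.+1)%E.
Proof.
by rewrite jump_timeS; apply: le_ereal_inf_tmp => _ [t [h _] <-].
Qed.

Lemma jump_time_homo k l : (k <= l)%N -> (T k <= T l)%E.
Proof.
move=> /subnK <-; elim: (l - k)%N => // m IH; rewrite addSn.
by apply: le_trans IH _; exact: jump_time_le.
Qed.

Lemma jump_time_ge0 k : (0 <= T k)%E.
Proof. by rewrite -jump_time0 jump_time_homo. Qed.

Lemma jump_chain_fin k t : T k = t%:E -> Y k = w t.
Proof.
case: k => [|k] Tk; first by case: Tk => <-.
by rewrite jump_chainS Tk.
Qed.

Lemma jump_time_ltS k t : T k = t%:E -> (t%:E < T k.+1)%E.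
Proof.
move=> Tk; have t0 : 0 <= t by rewrite -lee_fin -Tk jump_time_ge0.
have [e e0 He] := right_const t0.
apply: (@lt_le_trans _ _ (t + e)%:E); first by rewrite lte_fin ltrDl.
rewrite jump_timeS; apply: le_ereal_inf_tmp => _ [s [h ws] <-].
move: h; rewrite Tk lee_fin => ts; rewrite lee_fin leNgt; apply/negP => h.
by apply: ws; rewrite (He s ts h) (jump_chain_fin Tk).
Qed.

Lemma path_const k s : (T k <= s%:E)%E -> (s%:E < T k.+1)%E -> w s = Y k.
Proof.
move=> h1; rewrite ltNge; have [//|n] := pselect (w s = Y k); case/negP.
by rewrite jump_timeS; apply: ge_ereal_inf; exists s%:E => //; exists s.
Qed.

Lemma jump_time_fin k : Y k.+1 <> Y k -> exists t, T k.+1 = t%:E.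
Proof.
rewrite jump_chainS; have := jump_time_ge0 k.+1.
by case: (T k.+1) => // t _ _; exists t.
Qed.

Lemma path_segment m s : 0 <= s -> (s%:E < T m)%E ->
  exists k, [/\ (k < m)%N, (T k <= s%:E)%E & (s%:E < T k.+1)%E].
Proof.
move=> s0; elim: m => [|m IH]; first by rewrite jump_time0 lte_fin ltNge s0.
move=> sT; have [/IH[k [km h1 h2]]|] := ltP s%:E (T m).
  by exists k; split=> //; apply: leq_trans km _.
by move=> Ts; exists m.
Qed.

(** The sequence [y 0, ..., y m] of visited states describes an excursion from
    [y 0] that ends at its first return to [W]. *)
Definition first_return (W : {set E}) (y : nat -> E) (m : nat) : Prop :=
  [/\ (0 < m)%N, (forall k, (k < m)%N -> y k != y k.+1) &
      (forall k, (0 < k < m)%N -> y k \notin W)].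

Section first_return.
Variables (W : {set E}) (y : nat -> E) (m : nat).
Hypothesis yW : first_return W y m.
Hypothesis ymW : y m \in W.
Hypothesis Yy : forall k, (k <= m)%N -> Y k = y k.

(** A path that never jumps again keeps its jump chain constant, so the last
    two distinct states witness a finite jump time. *)
Lemma first_return_fin : exists t, T m = t%:E.
Proof.
have [m0 yy _] := yW; case: m m0 yy Yy => // n _ yy Yyn.
by apply: jump_time_fin; rewrite !Yyn//; apply/eqP; rewrite eq_sym yy.
Qed.

(** The infimum defining the return time runs over times after the first jump;
    it is attained or approached from the right at the m-th jump, because the
    path stays at [y m] for a while and was off [W] since its first jump. *)
Lemma return_timeE : return_time w W = T m.
Proof.
have [m0 yy yn] := yW; have [t Tm] := first_return_fin.
have tS := jump_time_ltS Tm.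
apply/le_anti/andP; split.
  apply/lee_addgt0Pr => e e0; rewrite Tm.
  have [s [ts sS se]] : exists s, [/\ t < s, (s%:E < T m.+1)%E & s <= t + e].
    case: (T m.+1) tS => [u||//] /=.
    - rewrite lte_fin => tu; exists (Num.min ((t + u) / 2) (t + e)).
      rewrite lt_min lte_fin gt_min ge_min lexx orbT ltrDl e0 midf_lt//.
      by rewrite midf_lt.
    - by exists (t + e); rewrite ltrDl e0 ltry lexx.
  rewrite -EFinD; apply: ge_ereal_inf; exists s%:E; last by rewrite lee_fin.
  exists s => //=; split.
    by rewrite (le_lt_trans (jump_time_homo m0))// Tm lte_fin.
  by rewrite (@path_const m) ?Yy// Tm lee_fin ltW.
apply: le_ereal_inf_tmp => _ [s [h sW] <-]; rewrite leNgt; apply/negP => sm.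
have s0 : 0 <= s by rewrite -lee_fin ltW// (le_lt_trans (jump_time_ge0 1) h).
have [k [km h1 h2]] := path_segment s0 sm.
have k0 : (0 < k)%N.
  by rewrite lt0n; apply/negP => /eqP k0; move: h2; rewrite k0 ltNge (ltW h).
have := yn k; rewrite k0 km => /(_ isT).
by rewrite -Yy ?(ltnW km)// -(path_const h1 h2) sW.
Qed.

Variable z : E.
Hypothesis zW : z \in W.
Hypothesis zy : z != y 0%N.

Lemma before_return s : 0 <= s -> (s%:E < T m)%E -> w s != z.
Proof.
move=> s0 sm; have [k [km h1 h2]] := path_segment s0 sm.
rewrite (path_const h1 h2) Yy ?(ltnW km)//.
have [k0|k0] := posnP k; first by rewrite k0 eq_sym.
have [_ _ /(_ k)] := yW; rewrite k0 km => /(_ isT) yk.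
by apply: contraNneq yk => ->.
Qed.

Lemma hitting_timeE : y m = z -> hitting_time w [set z]%SET = T m.
Proof.
move=> ymz; have [t Tm] := first_return_fin.
have t0 : 0 <= t by rewrite -lee_fin -Tm jump_time_ge0.
apply/le_anti/andP; split.
  rewrite Tm; apply: ge_ereal_inf; exists t%:E => //; exists t => //=.
  by split => //; rewrite -(jump_chain_fin Tm) Yy// ymz inE.
apply: le_ereal_inf_tmp => _ [s [s0 sz] <-]; rewrite leNgt; apply/negP => sm.
by have := before_return s0 sm; rewrite inE in sz; rewrite sz.
Qed.

Lemma hitting_time_neq : y m != z -> hitting_time w [set z]%SET <> T m.
Proof.
move=> ymz; have [t Tm] := first_return_fin.
have tS := jump_time_ltS Tm; rewrite Tm => h.
move: tS; rewrite -h ltNge => /negP; apply.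
apply: le_ereal_inf_tmp => _ [s [s0 sz] <-]; rewrite leNgt; apply/negP => sm.
rewrite inE in sz; have [st|ts] := ltP s%:E (T m).
  by have := before_return s0 st; rewrite sz.
by move: ymz; rewrite -Yy// -(path_const ts sm) sz.
Qed.

End first_return.
End cadlag_path.

(** * Measurability of jump times and hitting times *)

Section countable_sets.
Context d (Om : measurableType d) (I : countType).

Lemma measurable_exists (F : I -> Om -> Prop) :
  (forall i, measurable [set o | F i o]) -> measurable [set o | exists i, F i o].
Proof.
move=> mF; rewrite (_ : [set o | _] = \bigcup_i [set o | F i o]).
  by apply: countable_bigcupT_measurable.
by apply/seteqP; split => [ o [i Fi]| o [i _ Fi]]; exists i.
Qed.

Lemma measurable_forall (F : I -> Om -> Prop) :
  (forall i, measurable [set o | F i o]) -> measurable [set o | forall i, F i o].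
Proof.
move=> mF; rewrite (_ : [set o | _] = ~` [set o | exists i, ~ F i o]).
  apply: measurableC; apply: measurable_exists => i; exact: measurableC (mF i).
apply/seteqP; split => [ o Fo /= [i nF]| o /= /forallNP Fo i].
  by apply: nF; exact: Fo.
exact: contrapT (Fo i).
Qed.

End countable_sets.

Section restricted_sets.
Context d (Om : measurableType d).

Lemma measurable_andP (P : Prop) (A : set Om) :
  (P -> measurable A) -> measurable [set o | P /\ A o].
Proof.
have [p mA|np _] := pselect P.
  by rewrite (_ : [set o | _] = A)//; [exact: mA|apply/seteqP; split => // o []].
by rewrite (_ : [set o | _] = set0)//; apply/seteqP; split => // o [].
Qed.

Lemma measurable_implyP (P : Prop) (A : set Om) :
  (P -> measurable A) -> measurable [set o | P -> A o].
Proof.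
have [p mA|np _] := pselect P.
  rewrite (_ : [set o | _] = A); first exact: mA.
  by apply/seteqP; split => o /=; [apply|move=> Ao _].
by rewrite (_ : [set o | _] = setT)//; apply/seteqP; split => // o _ /= /np.
Qed.

Lemma measurable_imply (A B : set Om) : measurable A -> measurable B ->
  measurable [set o | A o -> B o].
Proof.
move=> mA mB; rewrite (_ : [set o | _] = ~` A `|` B).
  by apply: measurableU => //; exact: measurableC.
apply/seteqP; split => [ o H| o [nA /nA//|Bo _]//].
by have [/H|] := pselect (A o); [right|left].
Qed.

Lemma measurable_fun_lt (R : realType) (f : Om -> \bar R) :
  (forall c : R, measurable [set o | (f o < c%:E)%E]) -> measurable_fun setT f.
Proof.
move=> H; apply: (measurability _ (ErealGenInftyO.measurableE R)) => _ /= -[_ [c ->] <-].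
rewrite setTI; have := H c; congr (measurable _).
Qed.

End restricted_sets.

Section measurable_path.
Variables (R : realType) (E : finType).
Context d (Om : measurableType d).
Variable X : R -> Om -> E.
Hypothesis mX : forall t y, 0 <= t -> measurable [set o | X t o = y].
Hypothesis cX : forall o, cadlag (X ^~ o).

Lemma ratr_between (a b : R) : a < b -> exists q : rat, a < ratr q < b.
Proof. by move=> /rat_in_itvoo[q]; rewrite in_itv; exists q. Qed.

(** Right continuity lets rational times witness strict inequalities between
    times, which is what makes these times measurable. *)
Lemma jump_time_lt_rat o k (c : R) :
  (jump_time (X ^~ o) k.+1 < c%:E)%E <->
  exists q : rat, 0 <= ratr q :> R /\
    [/\ ratr q < c, (jump_time (X ^~ o) k <= (ratr q)%:E)%E &
        X (ratr q) o <> jump_chain (X ^~ o) k].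
Proof.
rewrite jump_timeS; split.
  move=> /ereal_inf_lt[_ [t [h wt] <-]]; rewrite lte_fin => tc.
  have t0 : 0 <= t by rewrite -lee_fin (le_trans (jump_time_ge0 _ k) h).
  have [e e0 He] := right_const (cX o) t0.
  have [|q /andP[tq]] := @ratr_between t (Num.min (t + e) c).
    by rewrite lt_min tc ltrDl e0.
  rewrite lt_min => /andP[qe qc]; exists q; split.
    by rewrite (le_trans t0)// ltW.
  split => //; first by rewrite (le_trans h)// lee_fin ltW.
  by rewrite He// ltW.
move=> [q [q0 [qc h1 h2]]].
apply: (@le_lt_trans _ _ (ratr q)%:E); last by rewrite lte_fin.
by apply: ge_ereal_inf; exists (ratr q)%:E => //; exists (ratr q).
Qed.

(** The value of a right-continuous path at a random time is its value at all
    rational times shortly after. *)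
Lemma jump_chain_rat o k y :
  jump_chain (X ^~ o) k.+1 = y <->
  (jump_time (X ^~ o) k.+1 = +oo%E /\ jump_chain (X ^~ o) k = y) \/
  exists q : rat, (jump_time (X ^~ o) k.+1 < (ratr q)%:E)%E /\
    forall s : rat, (0 <= ratr s :> R) -> ratr s < ratr q :> R ->
      (jump_time (X ^~ o) k.+1 < (ratr s)%:E)%E -> X (ratr s) o = y.
Proof.
have T0 := jump_time_ge0 (X ^~ o) k.+1; split.
  rewrite jump_chainS; case: (jump_time _ k.+1) T0 => [t|_ ->|//].
    rewrite lee_fin => t0 Xt; right.
    have [e e0 He] := right_const (cX o) t0.
    have [|q /andP[tq qe]] := @ratr_between t (t + e); first by rewrite ltrDl.
    exists q; split => [|s s0 sq]; first by rewrite lte_fin.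
    by rewrite lte_fin => ts; rewrite He// ?ltW// (lt_trans sq).
  by left.
move=> [[Tk <-]|[q [Tq Hq]]]; first by rewrite jump_chainS Tk.
rewrite jump_chainS; case: (jump_time _ k.+1) T0 Tq Hq => [t|//|//].
rewrite lee_fin lte_fin => t0 tq Hq.
have [e e0 He] := right_const (cX o) t0.
have [|s /andP[ts]] := @ratr_between t (Num.min (t + e) (ratr q)).
  by rewrite lt_min tq ltrDl e0.
rewrite lt_min => /andP[se sq].
by rewrite -(Hq s)// ?lte_fin// ?(le_trans t0) ?ltW// He// ltW.
Qed.

Lemma measurable_jump k :
  measurable_fun setT (fun o => jump_time (X ^~ o) k) /\
  forall y, measurable [set o | jump_chain (X ^~ o) k = y].
Proof.
elim: k => [|k [mT mY]].
  split; last by move=> y; exact: mX.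
  by rewrite (_ : (fun o => _) = cst 0%E)//; exact: measurable_cst.
have mT' : measurable_fun setT (fun o => jump_time (X ^~ o) k.+1).
  apply: measurable_fun_lt => c.
  rewrite (_ : [set o | _] = [set o | exists q : rat, (0 <= ratr q :> R /\ ratr q < c) /\
      exists y, (X (ratr q) o <> y /\ jump_chain (X ^~ o) k = y) /\
        (jump_time (X ^~ o) k <= (ratr q)%:E)%E]).
    apply: measurable_exists => q; apply: measurable_andP => -[q0 qc].
    have mle : measurable [set o | (jump_time (X ^~ o) k <= (ratr q)%:E)%E].
      by rewrite -[X in measurable X]setTI; exact: emeasurable_fun_infty_c.
    apply: measurable_exists => y.
    exact: measurableI (measurableI _ _ (measurableC (mX y q0)) (mY y)) mle.
  apply/seteqP; split => o /=.
    move=> /jump_time_lt_rat[q [q0 [qc b e]]]; exists q; split => //.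
    by exists (jump_chain (X ^~ o) k).
  move=> [q [[q0 qc] [y [[b e] f]]]]; apply/jump_time_lt_rat; exists q.
  by rewrite e.
split => // y.
rewrite (_ : [set o | _] = [set o | (jump_time (X ^~ o) k.+1 = +oo%E /\
    jump_chain (X ^~ o) k = y) \/
  exists q : rat, (jump_time (X ^~ o) k.+1 < (ratr q)%:E)%E /\
    forall s : rat, (0 <= ratr s :> R) -> ratr s < ratr q :> R ->
      (jump_time (X ^~ o) k.+1 < (ratr s)%:E)%E -> X (ratr s) o = y]); last first.
  by apply/seteqP; split => o /jump_chain_rat.
have mi : measurable [set o | jump_time (X ^~ o) k.+1 = +oo%E].
  rewrite (_ : [set o | _] = setT `&` [set o | (+oo <= jump_time (X ^~ o) k.+1)%E]).
    exact: emeasurable_fun_c_infty.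
  rewrite setTI; apply/seteqP; split => o /=; first by move=> ->.
  by rewrite leye_eq => /eqP.
have mlt c : measurable [set o | (jump_time (X ^~ o) k.+1 < c)%E].
  by rewrite -[X in measurable X]setTI; exact: emeasurable_fun_infty_o.
apply: (measurableU _ _ (measurableI _ _ mi (mY y))).
apply: measurable_exists => q; apply: (measurableI _ _ (mlt (ratr q)%:E)).
apply: measurable_forall => s; apply: measurable_implyP => s0.
apply: measurable_implyP => sq; apply: measurable_imply; last exact: mX.
exact: mlt.
Qed.

Lemma measurable_hitting_time (A : {set E}) :
  measurable_fun setT (fun o => hitting_time (X ^~ o) A).
Proof.
apply: measurable_fun_lt => c.
rewrite (_ : [set o | _] = [set o | exists q : rat, (0 <= ratr q :> R /\ ratr q < c) /\
    exists y : E, y \in A /\ X (ratr q) o = y]).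
  apply: measurable_exists => q; apply: measurable_andP => -[q0 qc].
  apply: measurable_exists => y; apply: measurable_andP => yA; exact: mX.
apply/seteqP; split => o /=.
  move=> /ereal_inf_lt[_ [t [t0 wt] <-]]; rewrite lte_fin => tc.
  have [e e0 He] := right_const (cX o) t0.
  have [|q /andP[tq]] := @ratr_between t (Num.min (t + e) c).
    by rewrite lt_min tc ltrDl e0.
  rewrite lt_min => /andP[qe qc]; exists q; split.
    by rewrite (le_trans t0)// ltW.
  by exists (X t o); split => //; rewrite He// ltW.
move=> [q [[q0 qc] [y [yA Xy]]]].
apply: (@le_lt_trans _ _ (ratr q)%:E); last by rewrite lte_fin.
by apply: ge_ereal_inf; exists (ratr q)%:E => //; exists (ratr q) => //=; rewrite Xy.
Qed.

Lemma measurable_return_time (A : {set E}) :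
  measurable_fun setT (fun o => return_time (X ^~ o) A).
Proof.
apply: measurable_fun_lt => c.
rewrite (_ : [set o | _] = [set o | exists q : rat, (0 <= ratr q :> R /\ ratr q < c) /\
    ((jump_time (X ^~ o) 1 < (ratr q)%:E)%E /\
    exists y : E, y \in A /\ X (ratr q) o = y)]).
  apply: measurable_exists => q; apply: measurable_andP => -[q0 qc].
  apply: (measurableI [set o | (jump_time (X ^~ o) 1 < (ratr q)%:E)%E]).
    by rewrite -[X in measurable X]setTI; apply: emeasurable_fun_infty_o => //;
      exact: (measurable_jump 1).1.
  apply: measurable_exists => y; apply: measurable_andP => yA; exact: mX.
apply/seteqP; split => o /=.
  move=> /ereal_inf_lt[_ [t [h wt] <-]]; rewrite lte_fin => tc.
  have t0 : 0 <= t by rewrite -lee_fin ltW// (le_lt_trans (jump_time_ge0 (X ^~ o) 1) h).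
  have [e e0 He] := right_const (cX o) t0.
  have [|q /andP[tq]] := @ratr_between t (Num.min (t + e) c).
    by rewrite lt_min tc ltrDl e0.
  rewrite lt_min => /andP[qe qc]; exists q; split.
    by rewrite (le_trans t0)// ltW.
  split; first by rewrite (lt_trans h)// lte_fin.
  by exists (X t o); split => //; rewrite He// ltW.
move=> [q [[q0 qc] [h [y [yA Xy]]]]].
apply: (@le_lt_trans _ _ (ratr q)%:E); last by rewrite lte_fin.
by apply: ge_ereal_inf; exists (ratr q)%:E => //; exists (ratr q) => //=; rewrite Xy.
Qed.

(** The trace rates evaluate the probability on this very event, and measures
    are unconstrained off the measurable sets. *)
Lemma measurable_trace_event (W : {set E}) z :
  measurable [set o | hitting_time (X ^~ o) [set z]%SET = return_time (X ^~ o) W].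
Proof.
rewrite -[X in measurable X]setTI; apply: measurable_eqe => //.
  exact: measurable_hitting_time.
exact: measurable_return_time.
Qed.

End measurable_path.

(** * The law of the first return to a set *)

Lemma measure_bigcup_fin d (Om : measurableType d) (R : realType)
    (mu : {measure set Om -> \bar R}) (I : finType) (F : I -> set Om) :
  (forall i, measurable (F i)) -> trivIset setT F ->
  mu (\bigcup_i F i) = (\sum_i mu (F i))%E.
Proof.
move=> mF tF; rewrite measure_fin_bigcup//; last exact: finite_finset.
rewrite (fsbigE (index_enum I)) ?index_enum_uniq// => [|i _].
  by apply: eq_bigl => i; rewrite in_setT.
by rewrite mem_index_enum.
Qed.

Section trace.
Variables (R : realType) (E : finType) (r : E -> E -> R).
Context d (Om : measurableType d).
Variables (P : E -> probability Om R) (X : R -> Om -> E).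
Hypothesis r_diag : forall x, r x x = 0.
Hypothesis hr : forall x, 0 < hold_rate r x.
Hypothesis XP : is_ctmc r P X.

Let mX t y : 0 <= t -> measurable [set o | X t o = y].
Proof. by case: XP => + _ _; apply. Qed.

Let cX o : cadlag (X ^~ o).
Proof. by case: XP. Qed.

Let p := jump_prob r.

Definition path_event (y : nat -> E) (m : nat) : set Om :=
  [set o | forall k, (k <= m)%N -> jump_chain (X ^~ o) k = y k].

Lemma measurable_path_event y m : measurable (path_event y m).
Proof.
apply: measurable_forall => k; apply: measurable_implyP => _.
exact: (measurable_jump mX cX k).2.
Qed.

(** The clauses on holding times disappear for thresholds equal to zero, holding
    times being positive along right-continuous paths. *)
Lemma path_eventE y m :
  P (y 0%N) (path_event y m) = (\prod_(k < m) p (y k) (y k.+1))%:E.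
Proof.
have [_ _ /(_ (y 0%N) m y (cst 0) (fun=> lexx _))] := XP.
rewrite eqxx mul1r [X in _ * X]big1 => [|k _]; last by rewrite mulr0 oppr0 expR0.
rewrite mulr1 => <-; congr (P _ _); apply/seteqP; split => o /= H k km.
  split; first exact: H.
  rewrite /holding_time; case Tk : (jump_time _ k) => [s||]; rewrite ?ltry//.
  by rewrite sube_gt0; exact: jump_time_ltS.
by have [] := H k km.
Qed.

Definition extend_path (y : nat -> E) (m : nat) (z : E) (k : nat) : E :=
  if (k <= m)%N then y k else z.

Lemma path_event_extend (A : set Om) x y m : measurable A ->
  (\sum_z P x (A `&` path_event (extend_path y m z) m.+1) <=
   P x (A `&` path_event y m))%E.
Proof.
move=> mA; have mI z : measurable (A `&` path_event (extend_path y m z) m.+1).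
  by apply: measurableI => //; exact: measurable_path_event.
rewrite -measure_bigcup_fin//.
  apply: le_measure; rewrite ?inE.
  - by apply: fin_bigcup_measurable => //; exact: finite_finset.
  - by apply: measurableI => //; exact: measurable_path_event.
  move=> o [z _ [Ao H]]; split => // k km; rewrite (H k (leqW km)).
  by rewrite /extend_path km.
apply/trivIsetP => z z' _ _ zz; apply/seteqP; split => // o [[_ H] [_ H']].
move: zz; have := H m.+1 (leqnn _); rewrite (H' m.+1 (leqnn _)).
by rewrite /extend_path ltnn => ->; rewrite eqxx.
Qed.

Variables (W S : {set E}).
Variables (x : E) (A : set Om).
Hypothesis mA : measurable A.
Hypothesis HA : forall y m, y 0%N = x -> first_return W y m -> y m \in S ->
  path_event y m `<=` A.

Let T := stopped_step r W.

Let p_diag a : p a a = 0.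
Proof. by rewrite /p jump_probE// r_diag mul0r. Qed.

(** Induction on the number K of further steps: while the path is off [W], the
    events that extend it by one state are disjoint, and extending by the current
    state has probability zero. Repeated states are excluded because distinct
    consecutive states are what makes the jump times finite. *)
Lemma first_return_prob_ge K y m : y 0%N = x -> first_return W y m ->
  ((\prod_(k < m) p (y k) (y k.+1) * iter K T (indicator R S) (y m))%:E <=
   P x (A `&` path_event y m))%E.
Proof.
elim: K y m => [|K IH] y m y0 yW.
  rewrite /= /indicator; case: (boolP (y m \in S)) => ymS; last by rewrite mulr0.
  rewrite mulr1 -path_eventE y0 (_ : A `&` _ = path_event y m)//.
  by apply/setIidr; exact: HA.
rewrite iterS {1}/T /stopped_step; case: ifPn => ymW.
  rewrite iter_stopped_in//.
  rewrite /= /indicator; case: (boolP (y m \in S)) => ymS; last by rewrite mulr0.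
  rewrite mulr1 -path_eventE y0 (_ : A `&` _ = path_event y m)//.
  by apply/setIidr; exact: HA.
apply: le_trans (path_event_extend x y m mA).
rewrite mulr_sumr -sumEFin; apply: lee_sum => z _.
have [->|zy] := eqVneq z (y m); first by rewrite -/p p_diag mul0r mulr0.
apply: le_trans (IH (extend_path y m z) m.+1 _ _).
- rewrite big_ord_recr /=.
  have -> : extend_path y m z m.+1 = z by rewrite /extend_path ltnn.
  have -> : extend_path y m z m = y m by rewrite /extend_path leqnn.
  rewrite lee_fin -[leRHS]mulrA le_eqVlt; apply/orP; left; apply/eqP.
  congr (_ * _); apply: eq_bigr => k _.
  by rewrite /extend_path (ltnW (ltn_ord k)) ltn_ord.
- by rewrite /extend_path.
have [m0 yy yn] := yW; split => // k; rewrite /extend_path.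
  move=> /ltnSE; case: ltngtP => // [km _|-> _]; last by rewrite eq_sym.
  by rewrite yy.
move=> /andP[k0 /ltnSE]; case: ltngtP => // [km _|-> _//].
by rewrite yn// k0.
Qed.

Lemma return_prob_ge K :
  ((\sum_z p x z * iter K T (indicator R S) z)%:E <= P x A)%E.
Proof.
apply: (@le_trans _ _ (P x (A `&` path_event (cst x) 0))); last first.
  apply: le_measure; rewrite ?inE//.
  by apply: measurableI => //; exact: measurable_path_event.
apply: le_trans (path_event_extend x (cst x) 0 mA).
rewrite -sumEFin; apply: lee_sum => z _.
have [->|zy] := eqVneq z x; first by rewrite p_diag mul0r.
apply: le_trans (@first_return_prob_ge K (extend_path (cst x) 0 z) 1 _ _) => //.
  by rewrite big_ord_recr big_ord0 /= mul1r.
split => // [[|k]//|[|[|k]]//] _; first by rewrite /extend_path/= eq_sym.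
Qed.

End trace.

Section trace_rate.
Variables (R : realType) (E : finType) (r : E -> E -> R) (nu : E -> R).
Context d (Om : measurableType d).
Variables (P : E -> probability Om R) (X : R -> Om -> E).
Hypothesis r_ge0 : forall x y, 0 <= r x y.
Hypothesis r_diag : forall x, r x x = 0.
Hypothesis irr : irreducible_chain r.
Hypothesis XP : is_ctmc r P X.
Hypothesis nu_gt0 : forall x, 0 < nu x.
Hypothesis nu_rev : forall x y, nu x * r x y = nu y * r y x.
Variable W : {set E}.

(** The lower bounds of [return_prob_ge], applied to the event and to its
    complement, add up to one because the chain returns to [W] almost surely
    ([e + f = 1] below); they are therefore equalities. *)
Lemma trace_rate_harmonic x z : x \in W -> z \in W -> x != z ->
  exists e : E -> R, [/\ forall a, a \notin W -> gen r e a = 0,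
    forall a, a \in W -> e a = (a == z)%:R &
    trace_rate r P X W x z = gen r e x].
Proof.
move=> xW zW xz; have hr := hold_rate_gt0 r_ge0 irr xz.
have [_ cX _] := XP.
have [mX _ _] := XP.
pose A := [set o | hitting_time (X ^~ o) [set z]%SET = return_time (X ^~ o) W].
have mA : measurable A by exact: measurable_trace_event.
have zS : [set z]%SET \subset W by rewrite finset.sub1set.
have DS : W :\ z \subset W by exact: finset.subD1set.
have [e [ec eh eW]] := harmonic_measure r_ge0 nu_gt0 nu_rev irr xW hr zS.
have [f [fc fh fW]] := harmonic_measure r_ge0 nu_gt0 nu_rev irr xW hr DS.
have ef a : e a + f a = 1.
  apply/eqP; rewrite -subr_eq0; apply/eqP.
  apply: (harmonic_eq0 r_ge0 nu_gt0 nu_rev irr xW (W := W)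
    (g := fun a => e a + f a - 1)) => {}a aW.
    transitivity (gen r e a + gen r f a); last by rewrite eh// fh// addr0.
    by rewrite /gen -big_split; apply: eq_bigr => b _ /=; ring.
  rewrite eW// fW// /indicator !inE aW andbT.
  by case: (a == z); rewrite /= ?addr0 ?add0r subrr.
exists e; split => //; first by move=> a aW; rewrite eW// /indicator inE.
have eE : gen r e x = hold_rate r x * \sum_y jump_prob r x y * e y.
  by rewrite gen_jump_prob// eW// /indicator inE (negbTE xz) subr0.
rewrite eE /trace_rate -/A; congr (_ * _).
have lo (S : {set E}) g B : measurable B ->
    (forall y m, y 0%N = x -> first_return W y m -> y m \in S ->
      path_event X y m `<=` B) ->
    (forall a, iter k (stopped_step r W) (indicator R S) a @[k --> \oo] --> g a) ->
    \sum_y jump_prob r x y * g y <= fine (P x B).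
  move=> mB HB gc.
  apply: (@ler_cvg_to _ \oo _ _ (fun k =>
    \sum_y jump_prob r x y * iter k (stopped_step r W) (indicator R S) y)
    (cst (fine (P x B)))); last 1 first.
  - apply: nearW => k /=; rewrite -lee_fin fineK ?fin_num_measure//.
    exact: (return_prob_ge r_diag hr XP mB HB).
  - by apply: cvg_sumr => y _; apply: cvgMl_tmp; exact: gc.
  - exact: cvg_cst.
have leA : \sum_y jump_prob r x y * e y <= fine (P x A).
  apply: (lo _ _ _ mA _ ec) => y m y0 yW /finset.set1P ymz o Yy.
  have ymW : y m \in W by rewrite ymz.
  rewrite /A /= (return_timeE (cX o) yW ymW Yy).
  by apply: (hitting_timeE yW Yy zW) => //; rewrite y0 eq_sym.
have leC : \sum_y jump_prob r x y * f y <= fine (P x (~` A)).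
  apply: (lo _ _ _ (measurableC mA) _ fc) => y m y0 yW /setD1P[ymz ymW] o Yy.
  rewrite /A /= (return_timeE (cX o) yW ymW Yy).
  by apply: (hitting_time_neq (cX o) yW Yy zW) => //; rewrite y0 eq_sym.
apply/le_anti; rewrite leA andbT.
move: leC; rewrite probability_setC// fineB ?fin_num_measure//= -[X in X - _](jump_prob_sum hr x).
rewrite lerBrDr -lerBrDl -sumrB.
rewrite (eq_bigr (fun y => jump_prob r x y * e y))// => y _.
have -> : e y = 1 - f y by rewrite -(ef y) addrK.
by rewrite mulrBr mulr1.
Qed.

End trace_rate.

(** * The Dirichlet form of the trace chain *)

Section trace_form.
Variables (R : realType) (E : finType) (r : E -> E -> R) (nu : E -> R).
Context d (Om : measurableType d).
Variables (P : E -> probability Om R) (X : R -> Om -> E).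
Hypothesis r_ge0 : forall x y, 0 <= r x y.
Hypothesis r_diag : forall x, r x x = 0.
Hypothesis irr : irreducible_chain r.
Hypothesis XP : is_ctmc r P X.
Hypothesis nu_gt0 : forall x, 0 < nu x.
Hypothesis nu_rev : forall x y, nu x * r x y = nu y * r y x.
Variable W : {set E}.
Variables (a0 b0 : E).
Hypotheses (a0W : a0 \in W) (ab0 : a0 != b0).

Let hr := hold_rate_gt0 r_ge0 irr ab0.
Let Q := trace_rate r P X W.

Lemma trace_rate_ge0 x y : 0 <= Q x y.
Proof. by rewrite mulr_ge0 ?fine_ge0// sumr_ge0. Qed.

(** Harmonic measures being unique, any function with these two properties
    computes the trace rate. *)
Lemma trace_rate_gen (e : E -> R) x z : x \in W -> z \in W -> x != z ->
  (forall a, a \notin W -> gen r e a = 0) ->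
  (forall a, a \in W -> e a = (a == z)%:R) -> Q x z = gen r e x.
Proof.
move=> xW zW xz eh eW; rewrite /Q.
have [f [fh fW ->]] := trace_rate_harmonic r_ge0 r_diag irr XP nu_gt0 nu_rev xW zW xz.
suff -> : f = e by [].
apply/funext => a; apply/eqP; rewrite -subr_eq0; apply/eqP.
apply: (harmonic_eq0 r_ge0 nu_gt0 nu_rev irr xW (g := fun a => f a - e a)) => {}a aW.
  transitivity (gen r f a - gen r e a); last by rewrite eh// fh// subr0.
  by rewrite /gen -sumrB; apply: eq_bigr => b _ /=; ring.
by rewrite fW// eW// subrr.
Qed.

Lemma gen_selfadjoint (u v : E -> R) :
  \sum_x nu x * (u x * gen r v x) = \sum_x nu x * (v x * gen r u x).
Proof.
rewrite !(gen_by_parts nu_rev); congr (- (_ * _)); apply: eq_bigr => x _.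
by apply: eq_bigr => y _; rewrite [_ * (v y - _)]mulrC.
Qed.

Lemma sum_harmonic_delta (e g : E -> R) x : x \in W ->
  (forall a, a \in W -> e a = (a == x)%:R) ->
  (forall a, a \notin W -> gen r g a = 0) ->
  \sum_a nu a * (e a * gen r g a) = nu x * gen r g x.
Proof.
move=> xW eW gh; rewrite (bigD1 x)//= eW// eqxx mul1r big1 ?addr0// => a ax.
have [aW|aW] := boolP (a \in W); first by rewrite eW// (negbTE ax) mul0r mulr0.
by rewrite gh// !mulr0.
Qed.

Lemma harmonic_delta x : x \in W -> exists e : E -> R,
  (forall a, a \notin W -> gen r e a = 0) /\
  (forall a, a \in W -> e a = (a == x)%:R).
Proof.
move=> xW; exact: (harmonic_extension r_ge0 nu_gt0 nu_rev irr xW hr (fun a => (a == x)%:R)).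
Qed.

Lemma trace_rate_rev x z : x \in W -> z \in W -> nu x * Q x z = nu z * Q z x.
Proof.
move=> xW zW; have [->//|xz] := eqVneq x z.
have [e [eh eW]] := harmonic_delta zW.
have [f [fh fW]] := harmonic_delta xW.
rewrite (trace_rate_gen xW zW xz eh eW).
have zx : z != x by rewrite eq_sym.
rewrite (trace_rate_gen zW xW zx fh fW).
by rewrite -(sum_harmonic_delta xW fW eh) -(sum_harmonic_delta zW eW fh) gen_selfadjoint.
Qed.

(** Self-adjointness against the harmonic measure of [x] expresses
    [gen r g x] through the boundary values of [g]; the diagonal coefficient is
    then found by taking [g] constant. *)
Lemma gen_harmonic (g : E -> R) x : (forall a, a \notin W -> gen r g a = 0) ->
  x \in W -> gen r g x = \sum_(z in W) Q x z * (g z - g x).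
Proof.
move=> gh xW; have [e [eh eW]] := harmonic_delta xW.
have H h : (forall a, a \notin W -> gen r h a = 0) ->
    nu x * gen r h x = nu x * (h x * gen r e x + \sum_(z in W | z != x) Q x z * h z).
  move=> hh; rewrite -(sum_harmonic_delta xW eW hh) gen_selfadjoint.
  rewrite (bigD1 x)//= mulrDr; congr (_ + _).
  rewrite (bigID (mem W))/= [X in _ + X]big1 ?addr0; last first.
    by move=> a /andP[_ aW]; rewrite eh// !mulr0.
  rewrite mulr_sumr; apply: eq_big => z; first by rewrite andbC.
  move=> /andP[zx zW]; rewrite -(trace_rate_gen zW xW zx eh eW).
  by rewrite mulrCA -trace_rate_rev//; ring.
have nx := lt0r_neq0 (nu_gt0 x).
have h1 : gen r e x = - \sum_(z in W | z != x) Q x z.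
  have c0 a : gen r (cst 1) a = 0.
    by rewrite /gen big1// => y _; rewrite /= subrr mulr0.
  have /(mulfI nx)/eqP := H (cst 1) (fun a _ => c0 a); rewrite c0.
  rewrite /= mul1r eq_sym addr_eq0 => /eqP ->; congr (- _).
  by apply: eq_bigr => z _; rewrite mulr1.
have /(mulfI nx) -> := H g gh.
rewrite h1 [RHS](bigD1 x)//= subrr mulr0 add0r mulrN addrC mulr_sumr -sumrB.
by apply: eq_bigr => z _; ring.
Qed.

Definition trace_form (g : E -> R) : R :=
  2^-1 * \sum_(x in W) \sum_(y in W) nu x * Q x y * (g y - g x) ^+ 2.

Lemma dform_harmonic (g : E -> R) : (forall a, a \notin W -> gen r g a = 0) ->
  dform r nu g = trace_form g.
Proof.
move=> gh.
have -> : dform r nu g = - \sum_a nu a * (g a * gen r g a).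
  rewrite (gen_by_parts nu_rev) opprK /dform; congr (_ * _).
rewrite (bigID (mem W))/= [X in _ + X]big1 ?addr0; last first.
  by move=> a aW; rewrite gh// !mulr0.
pose F x y := nu x * Q x y * (g x * (g y - g x)).
have -> : \sum_(a in W) nu a * (g a * gen r g a) = \sum_(x in W) \sum_(y in W) F x y.
  apply: eq_bigr => x xW; rewrite gen_harmonic// 2!mulr_sumr; apply: eq_bigr => y _.
  by rewrite /F; ring.
have sw : \sum_(x in W) \sum_(y in W) F x y = \sum_(x in W) \sum_(y in W) F y x.
  by rewrite exchange_big.
suff : \sum_(x in W) \sum_(y in W) nu x * Q x y * (g y - g x) ^+ 2 =
    - (\sum_(x in W) \sum_(y in W) F x y + \sum_(x in W) \sum_(y in W) F y x).
  by rewrite /trace_form => ->; rewrite -sw; field.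
rewrite -big_split -sumrN /=; apply: eq_bigr => x xW.
rewrite -big_split -sumrN /=; apply: eq_bigr => y yW.
by rewrite /F -(trace_rate_rev xW yW); ring.
Qed.

Lemma eq_trace_form (g h : E -> R) : (forall x, x \in W -> g x = h x) ->
  trace_form g = trace_form h.
Proof.
move=> gh; congr (_ * _); apply: eq_bigr => x xW; apply: eq_bigr => y yW.
by rewrite !gh.
Qed.

Lemma trace_form_le (g : E -> R) : trace_form g <= dform r nu g.
Proof.
have [u [uh uW]] := harmonic_extension r_ge0 nu_gt0 nu_rev irr a0W hr g.
rewrite (eq_trace_form (h := u)) => [|x xW]; last by rewrite uW.
rewrite -dform_harmonic//; apply: (dform_harmonic_le r_ge0 nu_gt0 nu_rev uh).
by move=> x xW; rewrite uW.
Qed.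

(** The harmonic extension, clipped to [0, b]: clipping keeps the values on [W]
    and does not increase the Dirichlet form. *)
Lemma bounded_extension (g : E -> R) b : (forall x, x \in W -> 0 <= g x <= b) ->
  exists u : E -> R, [/\ forall x, x \in W -> u x = g x,
    forall x, 0 <= u x <= b & dform r nu u <= trace_form g].
Proof.
move=> gb.
have [u [uh uW]] := harmonic_extension r_ge0 nu_gt0 nu_rev irr a0W hr g.
have b0' : 0 <= b by have /andP[] := gb _ a0W; exact: le_trans.
exists (fun x => Num.max 0 (Num.min (u x) b)); split => [x xW|x|].
- have /andP[g0 gb'] := gb x xW.
  by rewrite uW// min_l// max_r.
- by rewrite le_max lexx/= ge_max b0' ge_min lexx orbT.
rewrite (eq_trace_form (h := u)) => [|x xW]; last by rewrite uW.
rewrite -dform_harmonic//; apply: dform_le => // x y.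
have [h1|h1] := leP (u x) b; have [h2|h2] := leP (u y) b;
  rewrite ?(min_l h1) ?(min_r (ltW h1)) ?(min_l h2) ?(min_r (ltW h2));
  have [h3|h3] := leP 0 (u x); have [h4|h4] := leP 0 (u y);
  rewrite ?(max_r h3) ?(max_l (ltW h3)) ?(max_r h4) ?(max_l (ltW h4)) ?(max_r b0');
  rewrite ler_norml; apply/andP; split;
  (have [h5|h5] := leP 0 (u y - u x); [rewrite (ger0_norm h5)|rewrite (ltr0_norm h5)]);
  lra.
Qed.

End trace_form.

(** * Topology of the state space *)

Section state_space.
Variables (R : realType) (d : nat) (Xi : state_space R d).

Lemma closed_int : closed [set r : R | r \is a Num.int].
Proof.
rewrite -openC (_ : ~` _ = \bigcup_(m : int) [set` `]m%:~R, (m + 1)%:~R[]).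
  by apply: bigcup_open => m _; exact: interval_open.
apply/seteqP; split => r /=.
  move=> rN; exists (Num.floor r) => //=; rewrite in_itv/=.
  have /andP[h1 ->] := floor_itv r; rewrite andbT lt_neqAle h1 andbT.
  by apply/negP => /eqP h; apply: rN; rewrite -h intr_int.
move=> [m _ /=]; rewrite in_itv/= => /andP[h1 h2] /intrP[k rk].
by move: h1 h2; rewrite rk !ltr_int ltzD1 ltNge => /negbTE ->.
Qed.

(** For the torus, the preimage of a point is a translate of the integer
    lattice, which is closed. *)
Lemma closed_site (x : carrier Xi) : closed [set x].
Proof.
case: Xi x => [U U0 oU bU|] x /=.
  rewrite (_ : [set x] = (fun z : domain U0 => set_val z : 'rV[R]_d) @^-1` [set set_val x]).
    apply: preimage_closed.
      by move=> z _; exact: (@initial_continuous _ _ set_val).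
    by apply: accessible_closed_set1; apply: hausdorff_accessible; exact: norm_hausdorff.
  by apply/seteqP; split => [z ->//|z /= /val_inj].
rewrite -openC; rewrite -[x]reprK.
set a : 'rV[R]_d := repr x.
have : closed [set y : 'rV[R]_d | y - a \is a mxOver Num.int].
  rewrite (_ : [set y | _] = \bigcap_(j in [set: 'I_d])
      ((fun y : 'rV[R]_d => y 0 j - a 0 j) @^-1` [set r : R | r \is a Num.int])).
    apply: closed_bigI => j _.
    have cc : continuous (fun y : 'rV[R]_d => y 0 j - a 0 j).
      move=> y; apply: (@continuousB _ _ _ (fun y : 'rV[R]_d => y 0 j) (cst (a 0 j))).
        exact: coord_continuous.
      exact: cst_continuous.
    by apply: preimage_closed; [move=> y _; exact: cc|exact: closed_int].
  apply/seteqP; split => y /=.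
    by move=> /mxOverP H j _; have := H 0 j; rewrite !mxE.
  by move=> H; apply/mxOverP => i j; rewrite ord1 !mxE; exact: H.
rewrite -openC; congr (open _); apply/seteqP; split => y /= H; apply: contra_not H.
  by move=> /(@eqquotP _ (torus_equiv R d)).
by move=> h; apply/(@eqquotP _ (torus_equiv R d)).
Qed.

Lemma compact_norm_le (M : R) : compact [set x : 'rV[R]_d | `|x| <= M].
Proof.
apply: bounded_closed_compact.
  exists M; split; first exact: num_real.
  by move=> N MN x /= xM; rewrite (le_trans xM)// ltW.
apply: (@preimage_closed _ _ (@Num.norm R 'rV[R]_d) [set r | r <= M]).
  by move=> x _; exact: norm_continuous.
exact: closed_le.
Qed.

(** The state space is compact: a closed bounded set, or the image of the unit
    ball under the quotient map. *)
Lemma continuous_bounded (f : carrier Xi -> R) : continuous f ->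
  exists B, forall x, `|f x| <= B.
Proof.
case: Xi f => [U U0 oU bU|] f cf.
  pose A : set 'rV[R]_d := closure U.
  have cA : compact A.
    have [u Uu] := U0; have PF := globally_properfilter Uu.
    have /ex_bound[M UM] := bU.
    apply: (@subclosed_compact _ _ [set x : 'rV[R]_d | `|x| <= M]);
      [exact: closed_closure|exact: compact_norm_le|].
    rewrite (iffLR (closure_id [set x : 'rV[R]_d | `|x| <= M])).
      exact: closureS.
    by apply: compact_closed; [exact: norm_hausdorff|exact: compact_norm_le].
  pose g (y : 'rV[R]_d) : R :=
    if pselect (A y) is left h then f (exist _ y (mem_set h)) else 0.
  have cg : {within A, continuous g}.
    apply/subspace_sigL_continuousP.
    rewrite (_ : sigL A g = f)//; apply/funext => -[y yA].
    rewrite /sigL /= /g; case: pselect => [h|]; last by have := set_mem yA.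
    congr f; exact: val_inj.
  have [u Uu] := U0.
  have PF : ProperFilter (globally (g @` A)).
    by apply: (@globally_properfilter _ _ (g u)); exists u => //; exact: subset_closure.
  have /compact_bounded/ex_bound[B HB] := continuous_compact cg cA.
  exists B => x; apply: HB; exists (set_val x); first exact: set_valP.
  rewrite /g; case: pselect => [h|]; last by have := set_valP x.
  by congr f; exact: val_inj.
have cg : continuous (f \o @torus_pi R d).
  move=> y; apply: continuous_comp; last exact: cf.
  exact: pi_continuous.
have PF : ProperFilter (globally ((f \o @torus_pi R d) @` [set x : 'rV[R]_d | `|x| <= 1])).
  apply: (@globally_properfilter _ _ ((f \o @torus_pi R d) 0)).
  by exists 0 => //=; rewrite normr0.
have /compact_bounded/ex_bound[B HB] :=
  continuous_compact (continuous_subspaceT cg) (@compact_norm_le 1).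
exists B => x; rewrite -[x]reprK; set a : 'rV[R]_d := repr x.
pose y : 'rV[R]_d := \row_j (a 0 j - (Num.floor (a 0 j))%:~R).
apply: HB; exists y.
  rewrite /= [leLHS]/Num.Def.normr /= mx_normrE; apply: bigmax_le => //= i _.
  rewrite mxE ger0_norm ?subr_ge0 ?floor_le// lerBlDl.
  by have /andP[_ /ltW] := floor_itv (a 0 i.2); rewrite intrD.
rewrite /=; congr f; apply/esym/eqquotP/mxOverP => i j.
by rewrite !mxE ord1 opprB addrC subrK.
Qed.

End state_space.

(** * Integrals against mixtures *)

Lemma continuous_borel (R : realType) (T : ptopologicalType) (f : T -> R) :
  continuous f -> measurable_fun setT (f : borel T -> R).
Proof.
move=> /continuousP cf.
apply: (measurability _ (RGenOpens.measurableE R)) => _ [_ [a [b ->]] <-].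
rewrite setTI; apply: sub_sigma_algebra; apply: cf; exact: interval_open.
Qed.

Section integrals.
Context d (T : measurableType d) (R : realType).
Implicit Types (f : T -> R) (mu : probability T R).

Lemma bounded_integrable mu f B : measurable_fun setT f ->
  (forall x, `|f x| <= B) -> mu.-integrable setT (EFin \o f).
Proof.
move=> mf fB; apply: measurable_bounded_integrable => //.
  by rewrite -ge0_fin_numE// fin_num_measure.
exists B; split; first exact: num_real.
by move=> M BM x _ /=; rewrite (le_trans (fB x))// ltW.
Qed.

Lemma Rintegral_shift mu f B c : measurable_fun setT f ->
  (forall x, `|f x| <= B) ->
  \int[mu]_x (f x + c) = \int[mu]_x f x + c.
Proof.
move=> mf fB; rewrite RintegralD//; last 2 first.
- exact: bounded_integrable fB.
- by apply: (@bounded_integrable _ _ `|c|) => //; exact: measurable_cst.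
rewrite Rintegral_cst//; congr (_ + _).
by rewrite [X in fine X]probability_setT mulr1.
Qed.

Variable I : finType.

Lemma ge0_integral_mixture (w : simplex R I) (m : I -> probability T R) f :
  measurable_fun setT f -> (forall x, 0 <= f x) ->
  (\int[mixture w m]_x (f x)%:E = \sum_i (w i)%:E * \int[m i]_x (f x)%:E)%E.
Proof.
move=> mf f0.
have [i0 _] : exists i0 : I, i0 \in I.
  have : \sum_i w i != 0 by rewrite wt_sum oner_eq0.
  by apply: contraNP => /forallNP NI; rewrite big1// => i; case: (NI i).
have w0 i : 0 <= w i by exact: wt_ge0.
pose e k := nth i0 (index_enum I) k.
pose mk k : measure T R := mscale (NngNum (w0 (e k))) (m (e k)).
rewrite (eq_measure_integral (msum mk (size (index_enum I)))) => [|A mA _]; last first.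
  by rewrite /mixture /= /mix /msum (big_nth i0) big_mkord.
have mf' : measurable_fun setT (EFin \o f) by exact/measurable_EFinP.
rewrite (ge0_integral_measure_sum mk) //; last by move=> x _; rewrite lee_fin.
rewrite [RHS](big_nth i0) big_mkord; apply: eq_bigr => k _.
by rewrite ge0_integral_mscale// => x _; rewrite lee_fin.
Qed.

(** A bounded function is shifted by a constant to become nonnegative. *)
Lemma Rintegral_mixture (w : simplex R I) (m : I -> probability T R) f B :
  measurable_fun setT f -> (forall x, `|f x| <= B) ->
  \int[mixture w m]_x f x = \sum_i w i * \int[m i]_x f x.
Proof.
move=> mf fB.
have mg : measurable_fun setT (fun x => f x + B).
  by apply: measurable_funD => //; exact: measurable_cst.
have g0 x : 0 <= f x + B by have := fB x; rewrite ler_norml => /andP[h _]; rewrite -lerBlDr sub0r.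
have gB x : `|f x + B| <= B + B.
  by rewrite (le_trans (ler_normD _ _))// lerD// ger0_norm// (le_trans _ (fB x)).
have sh mu : \int[mu]_x f x = \int[mu]_x (f x + B) - B.
  by rewrite (Rintegral_shift _ _ mf fB) addrK.
rewrite sh [in LHS]/Rintegral ge0_integral_mixture//.
rewrite -sum_fine => [|i _]; last first.
  by rewrite fin_numM//; apply: integrable_fin_num => //; exact: bounded_integrable gB.
rewrite [RHS](eq_bigr (fun i => w i * \int[m i]_x (f x + B) - w i * B)); last first.
  by move=> i _; rewrite (sh (m i)) mulrBr.
rewrite sumrB -mulr_suml wt_sum mul1r; congr (_ - _); apply: eq_bigr => i _.
by rewrite [in RHS]/Rintegral fineM//; apply: integrable_fin_num => //;
  exact: bounded_integrable gB.
Qed.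

End integrals.

Lemma same_measure_integral d (T : measurableType d) (R : realType)
    (mu nu : probability T R) (f : T -> R) :
  same_measure mu nu -> \int[mu]_x f x = \int[nu]_x f x.
Proof.
move=> H; rewrite /Rintegral; congr fine.
by apply: eq_measure_integral => A mA _; exact: H.
Qed.

Lemma Rintegral_point_mass (R : realType) (T : ptopologicalType) (a : T)
    (f : T -> R) : continuous f -> \int[point_mass R a]_x (f x) = f a.
Proof.
move=> cf; rewrite /Rintegral.
rewrite (integral_dirac (a : borel T) measurableT); last first.
  by apply/measurable_EFinP; exact: continuous_borel.
by rewrite diracT mul1e.
Qed.

(** * Measures carried by the grid *)

Definition mk_simplex (R : realType) (I : finType) (f : I -> R)
    (f0 : forall i, 0 <= f i) (f1 : \sum_i f i = 1) : simplex R I.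
Proof.
exists [ffun i => f i]; apply/andP; split.
  by apply/forallP => i; rewrite ffunE.
by apply/eqP; rewrite -f1; apply: eq_bigr => i _; rewrite ffunE.
Defined.

Lemma mk_simplexE (R : realType) (I : finType) (f : I -> R)
    (f0 : forall i, 0 <= f i) (f1 : \sum_i f i = 1) i :
  mk_simplex f0 f1 i = f i.
Proof. by rewrite /mk_simplex /wt /= ffunE. Qed.

Lemma mixture_point_mass (R : realType) (T : ptopologicalType) (I : finType)
    (w : simplex R I) (x : I -> T) A :
  mixture w (fun i => point_mass R (x i)) A = (\sum_i w i * (x i \in A)%:R)%:E.
Proof.
rewrite /mixture /= /mix -sumEFin; apply: eq_bigr => i _.
by rewrite /point_mass /= diracE EFinM.
Qed.

Section measures.
Variables (R : realType) (d : nat) (Xi : state_space R d).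

Lemma measurable_site (x : carrier Xi) : measurable ([set x] : set (borel (carrier Xi))).
Proof.
rewrite -[X in measurable X]setCK; apply: measurableC.
by apply: sub_sigma_algebra; rewrite /= openC; exact: closed_site.
Qed.

Lemma point_mixture_inj (I : finType) (x : I -> carrier Xi) (w w' : simplex R I) :
  injective x ->
  same_measure (mixture w (fun i => point_mass R (x i)))
    (mixture w' (fun i => point_mass R (x i))) -> w =1 w'.
Proof.
move=> xI H k; have := H _ (measurable_site (x k)).
rewrite !mixture_point_mass => -[].
have E (v : simplex R I) : \sum_i v i * (x i \in [set x k])%:R = v k.
  rewrite (bigD1 k)//= [x k \in _]mem_set// mulr1 big1 ?addr0// => i ik.
  rewrite [x i \in _]memNset ?mulr0// => /xI h.
  by rewrite h eqxx in ik.
by rewrite !E.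
Qed.

Lemma weak_cvg_same (mu_ nu_ : nat -> borel_prob (carrier Xi) R) mu nu :
  (forall n, same_measure (mu_ n) (nu_ n)) -> same_measure mu nu ->
  mu_ @ \oo --> mu -> nu_ @ \oo --> nu.
Proof.
move=> E e /weak_cvgP H; apply/weak_cvgP => f cf.
rewrite -(same_measure_integral _ e).
have -> : (fun n => \int[nu_ n]_x f x) = (fun n => \int[mu_ n]_x f x).
  by apply/funext => n; rewrite (same_measure_integral _ (E n)).
exact: H.
Qed.

Lemma Rintegral_mixture_continuous (I : finType) (w : simplex R I)
    (m : I -> borel_prob (carrier Xi) R) (f : carrier Xi -> R) : continuous f ->
  \int[mixture w m]_x f x = \sum_i w i * \int[m i]_x f x.
Proof.
move=> cf; have [B fB] := continuous_bounded cf.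
exact: (Rintegral_mixture w m (continuous_borel cf) fB).
Qed.

Variable n : nat.

Lemma Rintegral_embed (w : simplex R (site Xi n)) (f : carrier Xi -> R) :
  continuous f -> \int[embed w]_x f x = \sum_x w x * f (site_pt x).
Proof.
move=> cf; rewrite Rintegral_mixture_continuous//.
by apply: eq_bigr => x _; rewrite Rintegral_point_mass.
Qed.

Lemma site_pt_inj : injective (@site_pt _ _ Xi n).
Proof. exact: val_inj. Qed.

Hypothesis n_gt0 : (0 < n)%N.

Lemma site_pt_grid (x : site Xi n) : grid Xi n (site_pt x).
Proof. by rewrite -range_site_pt//; exists x. Qed.

Lemma rate_functional_embed (r : site Xi n -> site Xi n -> R)
    (w : simplex R (site Xi n)) :
  rate_functional r (embed w) = level2_rate r w.
Proof.
rewrite /rate_functional /embed mixture_point_mass.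
rewrite (eq_bigr (fun x => w x)) => [|x _]; last first.
  by rewrite mem_set ?mulr1//; exact: site_pt_grid.
rewrite wt_sum eqxx; congr level2_rate; apply/funext => x.
rewrite mixture_point_mass /= (bigD1 x)//= mem_set// mulr1 big1 ?addr0// => y yx.
by rewrite memNset ?mulr0// => /site_pt_inj h; rewrite h eqxx in yx.
Qed.

(** A finite rate says that [mu] charges only the grid; [mu] then agrees with its
    atomic part on measurable sets. *)
Lemma rate_functional_lty (r : site Xi n -> site Xi n -> R)
    (mu : borel_prob (carrier Xi) R) : (rate_functional r mu < +oo)%E ->
  exists w : simplex R (site Xi n), same_measure mu (embed w) /\
    rate_functional r mu = level2_rate r w.
Proof.
rewrite /rate_functional; case: ifPn => [/eqP mu1 _|_]; last by rewrite ltxx.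
pose pt (x : site Xi n) : set (borel (carrier Xi)) := [set site_pt x].
have mpt x : measurable (pt x) by exact: measurable_site.
have gE : (grid Xi n : set (borel (carrier Xi))) = \bigcup_x pt x.
  rewrite -range_site_pt//; apply/seteqP; split => [_ [x _ <-]|_ [x _ ->]]; by exists x.
have mg : measurable (grid Xi n : set (borel (carrier Xi))).
  by rewrite gE; apply: fin_bigcup_measurable => //; exact: finite_finset.
have tI A : trivIset setT (fun x => pt x `&` A).
  apply/trivIsetP => x y _ _ xy; apply/seteqP; split => // z [[-> _] [/site_pt_inj h _]].
  by rewrite h eqxx in xy.
have fin A : measurable A -> mu A \is a fin_num by move=> mA; exact: fin_num_measure.
have muE A : measurable A -> mu A = (\sum_x fine (mu (pt x)) * (site_pt x \in A)%:R)%:E.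
  move=> mA; transitivity (mu (grid Xi n `&` A)).
    apply/le_anti/andP; split; last by apply: le_measure; rewrite ?inE//; exact: measurableI.
    have g0 : mu (~` grid Xi n) = 0%E by rewrite probability_setC// mu1 subee.
    have mI : measurable (grid Xi n `&` A : set (borel (carrier Xi))).
      exact: measurableI.
    have mC : measurable (~` grid Xi n : set (borel (carrier Xi))).
      exact: measurableC.
    apply: (@le_trans _ _ (mu ((grid Xi n `&` A) `|` ~` grid Xi n))).
      apply: le_measure; rewrite ?inE//; first exact: measurableU.
      by move=> z Az; have [gz|gz] := pselect (grid Xi n z); [left|right].
    by rewrite (le_trans (measureU2 _ _ _))//= g0 adde0.
  rewrite gE setI_bigcupl -sumEFin.
  rewrite (measure_bigcup_fin mu (F := fun x => pt x `&` A)) => [|x|]; last 2 first.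
    exact: measurableI.
    exact: tI.
  apply: eq_bigr => x _; have [xA|xA] := pselect (A (site_pt x)).
    rewrite mem_set// mulr1 fineK ?fin//; congr (mu _).
    by apply/seteqP; split => [z []//|z ->].
  rewrite memNset// mulr0 (_ : _ `&` _ = set0) ?measure0//.
  by apply/seteqP; split => // z [->].
have s1 : \sum_x fine (mu (pt x)) = 1.
  have := muE _ mg; rewrite mu1 => -[->]; apply: eq_bigr => x _.
  by rewrite mem_set ?mulr1//; exact: site_pt_grid.
exists (mk_simplex (fun x => fine_ge0 (measure_ge0 mu (pt x))) s1); split.
  move=> A mA; rewrite muE// /embed mixture_point_mass; congr (_%:E).
  by apply: eq_bigr => x _; rewrite mk_simplexE.
by congr level2_rate; apply/funext => x; rewrite mk_simplexE.
Qed.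

End measures.

(** * One time-scale *)

(** With [p * s = q * t] the flow between two wells, the left side is the
    contribution of this pair of wells to the coarse form. On the right only the
    weights [w], [v] and the rates [s], [t] remain: the masses of the wells, which
    need not converge, have disappeared. *)
Lemma flow_identity (R : realType) (p q s t w v : R) :
  0 < p -> 0 < q -> 0 <= s -> 0 <= t -> p * s = q * t -> 0 <= w -> 0 <= v ->
  p * s * (Num.sqrt (v / q) - Num.sqrt (w / p)) ^+ 2 =
  w * s + v * t - 2 * Num.sqrt (w * v * (s * t)).
Proof.
move=> p0 q0 s0 t0 pq w0 v0.
have p1 := lt0r_neq0 p0; have q1 := lt0r_neq0 q0.
rewrite sqrrB !sqr_sqrtr ?divr_ge0 ?(ltW p0) ?(ltW q0)//.
rewrite -sqrtrM ?divr_ge0 ?(ltW q0)//.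
have -> : p * s * (v / q - Num.sqrt (v / q * (w / p)) *+ 2 + w / p) =
    p * s * v / q + s * w - 2 * (p * s * Num.sqrt (v / q * (w / p))).
  by rewrite mulr2n; field; rewrite p1 q1.
have -> : p * s * v / q = v * t by rewrite pq; field.
have -> : p * s * Num.sqrt (v / q * (w / p)) = Num.sqrt (w * v * (s * t)).
  rewrite -{1}[p * s]ger0_norm ?mulr_ge0 ?(ltW p0)// -sqrtr_sqr -sqrtrM ?sqr_ge0//.
  congr Num.sqrt; rewrite expr2 {2}pq; field.
  by rewrite p1 q1.
by ring.
Qed.

Lemma cvg_sqrt (R : realType) (f : nat -> R) (l : R) :
  f n @[n --> \oo] --> l -> Num.sqrt (f n) @[n --> \oo] --> Num.sqrt l.
Proof. move=> fl; apply: (cvg_comp f Num.sqrt fl); exact: sqrt_continuous. Qed.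

Lemma stationary_gt0 (R : realType) (E : finType) (r : E -> E -> R) (w : simplex R E) :
  (forall x y, 0 <= r x y) -> irreducible_chain r -> detailed_balance r w ->
  forall x, 0 < w x.
Proof.
move=> r0 irr rev x.
have [a a0] : exists a, 0 < w a.
  have : \sum_i w i != 0 by rewrite wt_sum oner_eq0.
  apply: contraNP => /forallNP NI; rewrite big1// => i _.
  by have := NI i; have := wt_ge0 w i; rewrite le_eqVlt => /predU1P[//|].
have /connectP[s] := irr a x.
elim: s a a0 => [|b s IH] a a0 /=; first by move=> _ ->.
move=> /andP[/andP[_ ab] bs] xs; apply: (IH b) => //.
have : 0 < w b * r b a by rewrite -rev mulr_gt0.
by rewrite lt0r mulf_eq0 negb_or => /andP[/andP[wb _] _]; rewrite lt0r wb wt_ge0.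
Qed.

Lemma mass_gt0 (R : realType) (E : finType) (w : simplex R E) (A : {set E}) x :
  (forall x, 0 < w x) -> x \in A -> 0 < mass w A.
Proof.
move=> w0 xA; rewrite /mass (bigD1 x)//= ltr_pwDl// sumr_ge0// => y _.
exact: ltW.
Qed.

Lemma mass_le1 (R : realType) (E : finType) (w : simplex R E) (A : {set E}) :
  mass w A <= 1.
Proof.
rewrite -(wt_sum w) /mass [leRHS](bigID (mem A))/= lerDl sumr_ge0// => x _.
exact: wt_ge0.
Qed.

Lemma wells_sum (R : realType) (E : finType) m (V : 'I_m -> {set E}) (F : E -> R) :
  wells V -> \sum_(x in wells_union V) F x = \sum_i \sum_(x in V i) F x.
Proof.
move=> [_ Vd].
rewrite (exchange_big_dep (fun x => x \in wells_union V)) /=; last first.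
  by move=> i x _ xV; apply/finset.bigcupP; exists i.
apply: eq_bigr => x /finset.bigcupP[i _ xi].
by rewrite (big_pred1 i)// => j; apply/idP/eqP => [/(Vd _ _ _ xi)->//|->].
Qed.

Lemma condE (R : realType) (E : finType) (w : simplex R E) (A : {set E}) x :
  mass w A != 0 -> cond w A x = if x \in A then w x / mass w A else 0.
Proof.
move=> A0; rewrite /cond /wt insubdK ?ffunE//.
have m0 : 0 <= mass w A by apply: sumr_ge0 => y _; exact: wt_ge0.
apply/andP; split.
  apply/forallP => y; rewrite ffunE; case: ifP => // _.
  by rewrite divr_ge0// wt_ge0.
apply/eqP; transitivity (\sum_(y in A) w y / mass w A).
  by rewrite [RHS]big_mkcond; apply: eq_bigr => y _; rewrite ffunE.
by rewrite -mulr_suml divff.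
Qed.

Section level.
Variables (R : realType) (E : nat -> finType) (rate : forall n, E n -> E n -> R).
Hypothesis rate_ge0 : forall n x y, 0 <= @rate n x y.
Hypothesis rate_diag : forall n x, @rate n x x = 0.
Hypothesis rate_irr : forall n, irreducible_chain (@rate n).
Variables (dO : nat -> measure_display) (Omega : forall n, measurableType (dO n)).
Variable P : forall n, E n -> probability (Omega n) R.
Variable X : forall n, R -> Omega n -> E n.
Hypothesis X_ctmc : forall n, is_ctmc (@rate n) (@P n) (@X n).
Variable pi : forall n, simplex R (E n).
Hypothesis pi_rev : forall n, detailed_balance (@rate n) (pi n).
Variable m : nat.
Variable V : forall n, 'I_m -> {set E n}.
Hypothesis V_wells : forall n, wells (@V n).
Variable theta : nat -> R.
Hypothesis theta_gt0 : forall n, 0 < theta n.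
Variable r : 'I_m -> 'I_m -> R.
Hypothesis r_lim : forall i j, i != j ->
  theta n * mean_rate (@rate n) (@P n) (@X n) (pi n) (@V n) i j @[n --> \oo] --> r i j.
Variables i0 j0 : 'I_m.
Hypothesis ij0 : i0 != j0.
Variable c0 : R.
Hypothesis c0_gt0 : 0 < c0.
Hypothesis V_mass : forall n j,
  c0 <= mass (pi n) (V n j) / mass (pi n) (wells_union (V n)).

Let pi0 n : forall x, 0 < pi n x := stationary_gt0 (@rate_ge0 n) (@rate_irr n) (@pi_rev n).

Definition well_mass n i := mass (pi n) (V n i).
Definition scaled_rate n i j :=
  theta n * mean_rate (@rate n) (@P n) (@X n) (pi n) (@V n) i j.

Lemma well_mass_gt0 n i : 0 < well_mass n i.
Proof.
have [/(_ i)[x xV] _] := V_wells n; exact: (mass_gt0 (pi0 (n := n)) xV).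
Qed.

Lemma well_mass_le1 n i : well_mass n i <= 1.
Proof. exact: mass_le1. Qed.

Lemma scaled_rate_ge0 n i j : 0 <= scaled_rate n i j.
Proof.
rewrite mulr_ge0 ?(ltW (theta_gt0 n))// mulr_ge0//.
  by rewrite invr_ge0 ltW// well_mass_gt0.
apply: sumr_ge0 => x _; rewrite mulr_ge0 ?wt_ge0//.
by apply: sumr_ge0 => y _; exact: trace_rate_ge0.
Qed.

Let Q n := trace_rate (@rate n) (@P n) (@X n) (wells_union (V n)).

Lemma scaled_flowE n i j : well_mass n i * scaled_rate n i j =
  theta n * \sum_(x in V n i) \sum_(y in V n j) pi n x * Q x y.
Proof.
rewrite /scaled_rate /mean_rate mulrCA mulVKf ?(lt0r_neq0 (well_mass_gt0 n i))//.
by congr (_ * _); apply: eq_bigr => x _; rewrite mulr_sumr.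
Qed.

Lemma mem_wells_union n i x : x \in V n i -> x \in wells_union (V n).
Proof. by move=> xi; apply/finset.bigcupP; exists i. Qed.

Lemma two_points n : exists a b, a \in wells_union (V n) /\ a != b.
Proof.
have [Vn Vd] := V_wells n; have [a aV] := Vn i0; have [b bV] := Vn j0.
exists a, b; split; first exact: mem_wells_union aV.
by apply: contraNneq ij0 => ab; apply/eqP/(Vd _ _ a); rewrite // ab.
Qed.

(** The mean rates inherit detailed balance from the trace chain. *)
Lemma scaled_rate_rev n i j :
  well_mass n i * scaled_rate n i j = well_mass n j * scaled_rate n j i.
Proof.
rewrite !scaled_flowE exchange_big; congr (_ * _).
have [a [b [aW ab]]] := two_points n.
apply: eq_bigr => y yj; apply: eq_bigr => x xi.
apply: (trace_rate_rev (@rate_ge0 n) (@rate_diag n) (@rate_irr n) (X_ctmc n)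
  (@pi0 n) (@pi_rev n) ab); [exact: mem_wells_union xi|exact: mem_wells_union yj].
Qed.

Lemma well_mass_ratio n i j : c0 <= well_mass n i / well_mass n j.
Proof.
apply: le_trans (V_mass n i) _; rewrite ler_pM2l ?well_mass_gt0//.
rewrite lef_pV2 ?posrE ?well_mass_gt0//; last first.
  have [/(_ i)[x xV] _] := V_wells n.
  by apply: (mass_gt0 (pi0 (n := n))); exact: mem_wells_union xV.
rewrite [leRHS]/mass wells_sum// (bigD1 j)//= -/(mass _ _).
rewrite -/(well_mass n j) lerDl sumr_ge0// => k _.
by apply: sumr_ge0 => x _; exact: wt_ge0.
Qed.

Lemma r_ge0 i j : i != j -> 0 <= r i j.
Proof.
move=> ij; rewrite -(cvg_lim _ (r_lim ij))//; apply: limr_ge.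
  exact: cvgP (r_lim ij).
by apply: nearW => n; exact: scaled_rate_ge0.
Qed.

(** By detailed balance [scaled_rate n j i] is [scaled_rate n i j] times a ratio
    of masses, which is at least [c0]. *)
Lemma r_edge_sym i j : edge r i j -> edge r j i.
Proof.
move=> /andP[ij rij]; have ji : j != i by rewrite eq_sym.
rewrite /edge ji /=; apply: (@lt_le_trans _ _ (c0 * r i j)); first by rewrite mulr_gt0.
have e1 : c0 * scaled_rate n i j @[n --> \oo] --> c0 * r i j.
  by apply: cvgMl_tmp; exact: r_lim ij.
apply: (ler_cvg_to e1 (r_lim ji)); apply: nearW => n; rewrite -/(scaled_rate n j i).
have -> : scaled_rate n j i = well_mass n i / well_mass n j * scaled_rate n i j.
  by have h := lt0r_neq0 (well_mass_gt0 n j); rewrite mulrAC scaled_rate_rev; field.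
by rewrite ler_wpM2r ?scaled_rate_ge0// well_mass_ratio.
Qed.

Lemma connect_edge_sym i j : connect (edge r) i j = connect (edge r) j i.
Proof.
by apply: sym_connect_sym => a b; apply/idP/idP; exact: r_edge_sym.
Qed.

(** Along an edge, detailed balance turns the ratio of masses into the ratio of
    scaled rates, whose limits are positive in both directions. *)
Lemma well_mass_ratio_cvg i j : connect (edge r) i j ->
  exists2 l : R, 0 < l & well_mass n j / well_mass n i @[n --> \oo] --> l.
Proof.
move=> /connectP[s]; elim: s i => [|k s IH] i /=.
  move=> _ ->; exists 1 => //.
  rewrite (_ : (fun n => _) = cst 1); first exact: cvg_cst.
  by apply/funext => n; rewrite divff// lt0r_neq0// well_mass_gt0.
move=> /andP[ik ks] jE; have [l l0 ll] := IH k ks jE.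
have /andP[ik' rik] := ik; have /andP[ki' rki] := r_edge_sym ik.
exists (l * (r i k / r k i)); first by rewrite mulr_gt0// divr_gt0.
apply: (cvg_trans _ (cvgM ll (cvgM (r_lim ik') (cvgV (lt0r_neq0 rki) (r_lim ki'))))).
apply: near_eq_cvg; near=> n => /=.
have s0 : 0 < scaled_rate n k i.
  by near: n; apply: (cvgr_gt (r k i)) => //; exact: r_lim.
rewrite -/(scaled_rate n i k) -/(scaled_rate n k i).
have h := lt0r_neq0 (well_mass_gt0 n k); have h' := lt0r_neq0 (well_mass_gt0 n i).
have -> : scaled_rate n i k = well_mass n k * scaled_rate n k i / well_mass n i.
  by rewrite -scaled_rate_rev; field.
have h'' := lt0r_neq0 s0.
by field; rewrite h h' h''.
Unshelve. all: by end_near.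
Qed.

(** Each class is normalised by its root, so [nu] compares masses only within a
    class. *)
Lemma level_measure : exists nu : 'I_m -> R,
  [/\ forall i, 0 < nu i, forall i j, nu i * r i j = nu j * r j i &
      forall i j, connect (edge r) i j ->
        well_mass n j / well_mass n i @[n --> \oo] --> nu j / nu i].
Proof.
have H i : exists l : R, 0 < l /\
    well_mass n i / well_mass n (fingraph.root (edge r) i) @[n --> \oo] --> l.
  have [|l l0 ll] := @well_mass_ratio_cvg (fingraph.root (edge r) i) i.
    by rewrite connect_edge_sym connect_root.
  by exists l.
have [nu nuP] := choice H.
have nu0 i : 0 < nu i by have [] := nuP i.
have csym : fingraph.connect_sym (edge r) by exact: connect_edge_sym.
have R0 i j : connect (edge r) i j -> fingraph.root (edge r) i = fingraph.root (edge r) j.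
  by move=> ij; apply/eqP; rewrite root_connect.
have wm0 n i : well_mass n i != 0 by rewrite lt0r_neq0// well_mass_gt0.
exists nu; split => // [i j|i j cij].
  have [->//|ij] := eqVneq i j.
  have ji : j != i by rewrite eq_sym.
  have [eij|neij] := boolP (edge r i j); last first.
    have neji : ~~ edge r j i by apply: contra neij => /r_edge_sym.
    move: neij neji; rewrite /edge ij ji /= => n1 n2.
    have := r_ge0 ij; rewrite le_eqVlt (negbTE n1) orbF => /eqP <-.
    have := r_ge0 ji; rewrite le_eqVlt (negbTE n2) orbF => /eqP <-.
    by rewrite !mulr0.
  have [_ ci] := nuP i; have [_ cj] := nuP j.
  have e1 := cvgM ci (r_lim ij); have e2 := cvgM cj (r_lim ji).
  move: e1; set f := (X in X @ _); have -> : f = (fun n =>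
      well_mass n j / well_mass n (fingraph.root (edge r) j)) \* (fun n => scaled_rate n j i).
    apply/funext => n; rewrite /f /= -/(scaled_rate n i j).
    by rewrite (R0 i j (connect1 eij)) mulrAC scaled_rate_rev mulrAC.
  move=> e1; rewrite -(cvg_lim (@Rhausdorff R) (e1 _)); exact: (cvg_lim (@Rhausdorff R) (e2 _)).
have [_ ci] := nuP i; have [_ cj] := nuP j.
apply: cvg_trans (cvgM cj (cvgV (lt0r_neq0 (nu0 i)) ci)).
apply: near_eq_cvg; apply: nearW => n /=; rewrite -(R0 i j cij).
have h1 := wm0 n i; have h2 := wm0 n j; have h3 := wm0 n (fingraph.root (edge r) i).
by field; rewrite ?h1 ?h2 ?h3.
Qed.

(** The Dirichlet form of the chain of wells with its scaled rates: it is theta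
    times that of the trace chain at a function equal to [a i] on the i-th
    well. *)
Definition coarse_form n (a : 'I_m -> R) : R :=
  2^-1 * \sum_i \sum_j well_mass n i * scaled_rate n i j * (a j - a i) ^+ 2.

(** The first-order effect on the coarse form of a uniform perturbation of the
    values on the wells. *)
Definition coarse_var n (a : 'I_m -> R) : R :=
  \sum_i \sum_j well_mass n i * scaled_rate n i j * `|a j - a i|.

(** The square root of the density that spreads the mass [w i] over the i-th
    well proportionally to [pi n]. *)
Definition amplitude n (w : 'I_m -> R) (i : 'I_m) : R :=
  Num.sqrt (w i / well_mass n i).

Lemma scaled_trace_form n (g : E n -> R) :
  theta n * trace_form (@rate n) (pi n) (@P n) (@X n) (wells_union (V n)) g =
  2^-1 * \sum_i \sum_j theta n *
    \sum_(x in V n i) \sum_(y in V n j) pi n x * Q x y * (g y - g x) ^+ 2.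
Proof.
rewrite mulrCA; congr (_ * _); rewrite mulr_sumr wells_sum//; apply: eq_bigr => i _.
rewrite -mulr_sumr exchange_big mulr_sumr; apply: eq_bigr => x _.
by rewrite wells_sum.
Qed.

(** Two values of [g] differ from the corresponding values of [a] by at most
    [2 * e] together, and [(D + t)^2 >= D^2 - 4 e |D|] for [|t| <= 2 e]; pairs of
    points in a common well are dropped. *)
Lemma coarse_form_le n (g : E n -> R) (a : 'I_m -> R) e :
  (forall i x, x \in V n i -> `|g x - a i| <= e) ->
  coarse_form n a - 2 * e * coarse_var n a <=
  theta n * dform (@rate n) (pi n) g.
Proof.
move=> ga.
have [b [c [bW bc]]] := two_points n.
apply: (@le_trans _ _ (theta n *
    trace_form (@rate n) (pi n) (@P n) (@X n) (wells_union (V n)) g)); last first.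
  rewrite ler_pM2l//; exact: (trace_form_le (@rate_ge0 n) (@rate_diag n) (@rate_irr n)
    (X_ctmc n) (@pi0 n) (@pi_rev n) bW bc).
rewrite scaled_trace_form.
have -> : coarse_form n a - 2 * e * coarse_var n a = 2^-1 * \sum_i \sum_j
    well_mass n i * scaled_rate n i j * ((a j - a i) ^+ 2 - 4 * e * `|a j - a i|).
  rewrite /coarse_form /coarse_var.
  have -> : 2 * e * (\sum_i \sum_j well_mass n i * scaled_rate n i j * `|a j - a i|) =
    2^-1 * \sum_i \sum_j well_mass n i * scaled_rate n i j * (4 * e * `|a j - a i|).
    have -> : 2 * e = 2^-1 * (4 * e) by field.
    rewrite -mulrA; congr (_ * _); rewrite mulr_sumr; apply: eq_bigr => i _.
    by rewrite mulr_sumr; apply: eq_bigr => j _; ring.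
  rewrite -mulrBr -sumrB; congr (_ * _); apply: eq_bigr => i _.
  by rewrite -sumrB; apply: eq_bigr => j _; rewrite -mulrBr.
rewrite ler_pM2l ?invr_gt0//; apply: ler_sum => i _; apply: ler_sum => j _.
have tQ x y : 0 <= pi n x * Q x y by rewrite mulr_ge0 ?wt_ge0// trace_rate_ge0.
have [->|ij] := eqVneq i j.
  rewrite subrr normr0 expr0n /= !mulr0 subrr mulr0 mulr_ge0 ?(ltW (theta_gt0 n))//.
  by apply: sumr_ge0 => x _; apply: sumr_ge0 => y _; rewrite mulr_ge0 ?sqr_ge0.
rewrite scaled_flowE -mulrA ler_pM2l// mulr_suml; apply: ler_sum => x xi.
rewrite mulr_suml; apply: ler_sum => y yj; rewrite ler_wpM2l//.
have hx := ga _ _ xi; have hy := ga _ _ yj.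
have : `|(g y - g x) - (a j - a i)| <= 2 * e.
  have -> : (g y - g x) - (a j - a i) = (g y - a j) - (g x - a i) by ring.
  by rewrite (le_trans (ler_normB _ _))//; lra.
set D := g y - g x; set d := a j - a i; rewrite ler_norml => /andP[h1 h2].
have := sqr_ge0 (D - d).
have -> : D ^+ 2 = (D - d) ^+ 2 + 2 * (d * (D - d)) + d ^+ 2 by ring.
have [d0|d0] := leP 0 d; rewrite ?(ger0_norm d0) ?(ltr0_norm d0) => sq.
  have : d * - (2 * e) <= d * (D - d) by rewrite ler_wpM2l.
  by lra.
have : d * (2 * e) <= d * (D - d) by rewrite ler_wnM2l// ltW.
by lra.
Qed.

Lemma coarse_extension n (a : 'I_m -> R) b : (forall i, 0 <= a i <= b) ->
  exists u : E n -> R, [/\ forall i x, x \in V n i -> u x = a i,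
    forall x, 0 <= u x <= b & theta n * dform (@rate n) (pi n) u <= coarse_form n a].
Proof.
move=> ab; have [b0 [c [bW bc]]] := two_points n.
pose g (x : E n) : R := \sum_(i | x \in V n i) a i.
have [_ Vd] := V_wells n.
have gE i x : x \in V n i -> g x = a i.
  by move=> xi; rewrite /g (big_pred1 i)// => j; apply/idP/eqP => [/(Vd _ _ _ xi)->//|->].
have [|u [uW ub ud]] := bounded_extension (@rate_ge0 n) (@rate_diag n) (@rate_irr n)
    (X_ctmc n) (@pi0 n) (@pi_rev n) bW bc (g := g) (b := b).
  by move=> x /finset.bigcupP[i _ xi]; rewrite (gE _ _ xi).
exists u; split => // [i x xi|].
  by rewrite uW ?(gE _ _ xi)//; exact: mem_wells_union xi.
apply: (@le_trans _ _ (theta n *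
    trace_form (@rate n) (pi n) (@P n) (@X n) (wells_union (V n)) g)).
  by rewrite ler_pM2l.
rewrite scaled_trace_form /coarse_form le_eqVlt; apply/orP; left; apply/eqP.
congr (_ * _); apply: eq_bigr => i _; apply: eq_bigr => j _.
rewrite scaled_flowE -mulrA; congr (_ * _); rewrite mulr_suml; apply: eq_bigr => x xi.
by rewrite mulr_suml; apply: eq_bigr => y yj; rewrite (gE _ _ xi) (gE _ _ yj).
Qed.

Section amplitude.
Variables (nu : 'I_m -> R).
Hypothesis nu_gt0 : forall i, 0 < nu i.
Hypothesis nu_rev : forall i j, nu i * r i j = nu j * r j i.
Variable w : 'I_m -> R.
Hypothesis w_ge0 : forall i, 0 <= w i.

(** The level-two rate of [w] for the limit chain, by [level2_rate_sqrt]. *)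
Definition limit_form : R := dform r nu (fun i => Num.sqrt (w i / nu i)).

Lemma coarse_form_cvg : coarse_form n (amplitude n w) @[n --> \oo] --> limit_form.
Proof.
apply: cvgMl_tmp; apply: cvg_sumr => i _; apply: cvg_sumr => j _.
have [->|ij] := eqVneq i j.
  rewrite subrr expr0n mulr0 (_ : (fun n => _) = cst 0); first exact: cvg_cst.
  by apply/funext => n; rewrite subrr expr0n mulr0.
have ji : j != i by rewrite eq_sym.
rewrite (flow_identity (nu_gt0 i) (nu_gt0 j) (r_ge0 ij) (r_ge0 ji) (nu_rev i j))//.
rewrite (_ : (fun n => _) = (fun n => w i * scaled_rate n i j + w j * scaled_rate n j i
    - 2 * Num.sqrt (w i * w j * (scaled_rate n i j * scaled_rate n j i)))); last first.
  apply/funext => n; apply: flow_identity; rewrite ?well_mass_gt0 ?scaled_rate_ge0//.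
  exact: scaled_rate_rev.
have ci := r_lim ij; have cj := r_lim ji.
apply: cvgB; first by apply: cvgD; apply: cvgMl_tmp.
apply: cvgMl_tmp; apply: cvg_sqrt.
by apply: cvgMl_tmp; exact: (cvgM ci cj).
Qed.

(** From [|D| <= 1 + D^2], this is controlled by the coarse form and the scaled
    rates, which both converge. *)
Lemma coarse_var_bounded : exists2 B : R, 0 < B &
  \forall n \near \oo, coarse_var n (amplitude n w) <= B.
Proof.
pose S n := \sum_i \sum_(j | j != i) scaled_rate n i j.
pose s := \sum_i \sum_(j | j != i) r i j.
have Sc : S n @[n --> \oo] --> s.
  by apply: cvg_sumr => i _; apply: cvg_sumr => j ji; apply: r_lim; rewrite eq_sym.
have s0 : 0 <= s.
  by apply: sumr_ge0 => i _; apply: sumr_ge0 => j ji; rewrite r_ge0// eq_sym.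
have L0 : 0 <= limit_form.
  by apply: dform_ge0 => //; exact: r_ge0.
exists ((s + 1) + 2 * (limit_form + 1)); first by lra.
near=> n.
have h1 : S n <= s + 1 by near: n; apply: (cvgr_le s) => //; lra.
have h2 : coarse_form n (amplitude n w) <= limit_form + 1.
  by near: n; apply: (cvgr_le limit_form); [exact: coarse_form_cvg|lra].
apply: (@le_trans _ _ (S n + 2 * coarse_form n (amplitude n w))); last by lra.
rewrite /coarse_form mulVKf// /S -big_split; apply: ler_sum => i _ /=.
rewrite [leLHS](bigD1 i)//= subrr normr0 mulr0 add0r.
rewrite [X in _ + X](bigD1 i)//= subrr expr0n mulr0 add0r -big_split.
apply: ler_sum => j _ /=.
have := well_mass_le1 n i; have := well_mass_gt0 n i; have := scaled_rate_ge0 n i j.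
set p := well_mass n i; set q := scaled_rate n i j.
set D := amplitude n w j - amplitude n w i => q0 p0 p1.
have pq : 0 <= p * q by rewrite mulr_ge0// ltW.
apply: (@le_trans _ _ (p * q * (1 + D ^+ 2))).
  rewrite ler_wpM2l//; have [d0|d0] := leP 0 D; rewrite ?(ger0_norm d0) ?(ltr0_norm d0); nra.
by rewrite mulrDr mulr1 lerD2r ler_piMl.
Unshelve. all: by end_near.
Qed.

Lemma level_liminf (g : forall n, E n -> R) C :
  (forall e, 0 < e -> \forall n \near \oo,
     theta n * dform (@rate n) (pi n) (g n) <= C ->
     forall i x, x \in V n i -> `|g n x - amplitude n w i| <= e) ->
  (forall N, exists2 n, (N <= n)%N & theta n * dform (@rate n) (pi n) (g n) <= C) ->
  limit_form <= C.
Proof.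
move=> gw fr; have [B B0 BP] := coarse_var_bounded.
apply/ler_addgt0Pr => e e0.
pose e1 := e / (4 * B); have e10 : 0 < e1 by rewrite divr_gt0// mulr_gt0.
have e2 : 2 * e1 * B = e / 2 by rewrite /e1; field; exact: lt0r_neq0.
have Lc : \forall n \near \oo, limit_form - e / 2 <= coarse_form n (amplitude n w).
  by apply: (cvgr_ge limit_form); [exact: coarse_form_cvg|rewrite ltrBlDr ltrDl divr_gt0].
have [N _ HN] : \forall n \near \oo, [/\ coarse_var n (amplitude n w) <= B,
    limit_form - e / 2 <= coarse_form n (amplitude n w) &
    theta n * dform (@rate n) (pi n) (g n) <= C ->
     forall i x, x \in V n i -> `|g n x - amplitude n w i| <= e1].
  by near=> n; split; near: n => //; exact: gw.
have [n Nn nC] := fr N; have [h1 h2 /(_ nC) h3] := HN n Nn.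
have := coarse_form_le h3.
have : 2 * e1 * coarse_var n (amplitude n w) <= e / 2.
  by rewrite -e2 ler_wpM2l// mulr_ge0// ltW.
lra.
Unshelve. all: by end_near.
Qed.

Lemma well_sum_amplitude n (f : E n -> R) i :
  \sum_(x in V n i) pi n x * amplitude n w i ^+ 2 * f x =
  w i * \sum_x cond (pi n) (V n i) x * f x.
Proof.
have W0 := well_mass_gt0 n i; have W1 := lt0r_neq0 W0.
rewrite /amplitude sqr_sqrtr ?divr_ge0// ?(ltW W0)//.
rewrite mulr_sumr big_mkcond; apply: eq_bigr => x _.
rewrite condE//; case: ifP => _; last by rewrite mul0r mulr0.
by rewrite -/(well_mass n i); field.
Qed.

(** Outside the wells the extension is at most [b n], whose square is of order
    one, while the complement of the wells has vanishing mass. The total mass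
    [Z n] is therefore at least one and tends to one, and testing against a
    bounded function only sees the conditional laws on the wells. *)
Lemma level_recovery : \sum_i w i = 1 ->
  mass (pi n) (wells_union (V n)) @[n --> \oo] --> (1 : R) ->
  exists mu : forall n, simplex R (E n),
    (forall n, (level2_rate (@rate n) (mu n) <=
       ((theta n)^-1 * coarse_form n (amplitude n w))%:E)%E) /\
    (forall (f : forall n, E n -> R) B, (forall n x, `|f n x| <= B) ->
       \sum_x mu n x * f n x -
       \sum_i w i * \sum_x cond (pi n) (V n i) x * f n x @[n --> \oo] --> (0 : R)).
Proof.
move=> w1 Uc.
pose U n := mass (pi n) (wells_union (V n)).
have U0 n : 0 < U n.
  have [/(_ i0)[x xV] _] := V_wells n.
  by apply: (mass_gt0 (pi0 (n := n))); exact: mem_wells_union xV.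
have WU n i : c0 * U n <= well_mass n i by rewrite -ler_pdivlMr// V_mass.
have cU n : 0 < c0 * U n by rewrite mulr_gt0.
pose b n := Num.sqrt ((c0 * U n)^-1).
have amp n i : 0 <= amplitude n w i <= b n.
  rewrite sqrtr_ge0 /= ler_wsqrtr//.
  have wi : w i <= 1 by rewrite -w1 (bigD1 i)//= lerDl sumr_ge0.
  rewrite -[leRHS]mul1r; apply: ler_pM => //.
    by rewrite invr_ge0 ltW// well_mass_gt0.
  by rewrite lef_pV2 ?posrE ?well_mass_gt0.
pose u n := projT1 (cid (coarse_extension n (amp n))).
have uP n : [/\ forall i x, x \in V n i -> u n x = amplitude n w i,
    forall x, 0 <= u n x <= b n &
    theta n * dform (@rate n) (pi n) (u n) <= coarse_form n (amplitude n w)].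
  exact: projT2 (cid (coarse_extension n (amp n))).
pose Z n := \sum_x pi n x * u n x ^+ 2.
have split_sum n (f : E n -> R) : \sum_x pi n x * u n x ^+ 2 * f x =
    \sum_i w i * (\sum_x cond (pi n) (V n i) x * f x) +
    \sum_(x | x \notin wells_union (V n)) pi n x * u n x ^+ 2 * f x.
  rewrite (bigID (mem (wells_union (V n))))/=; congr (_ + _).
  rewrite wells_sum//; apply: eq_bigr => i _; rewrite -well_sum_amplitude.
  by apply: eq_bigr => x xi; have [/(_ i x xi) ->] := uP n.
have cond1 n i : \sum_x cond (pi n) (V n i) x * 1 = 1.
  by rewrite -[RHS](wt_sum (cond (pi n) (V n i))); apply: eq_bigr => x _; rewrite mulr1.
have ZE n : Z n = 1 + \sum_(x | x \notin wells_union (V n)) pi n x * u n x ^+ 2.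
  have := split_sum n (fun=> 1); rewrite (eq_bigr (fun i => w i)) ?w1; last first.
    by move=> i _; rewrite cond1 mulr1.
  rewrite /Z => H; transitivity (\sum_x pi n x * u n x ^+ 2 * 1).
    by apply: eq_bigr => x _; rewrite mulr1.
  by rewrite H; congr (_ + _); apply: eq_bigr => x _; rewrite mulr1.
have t0 n x : 0 <= pi n x * u n x ^+ 2 by rewrite mulr_ge0 ?wt_ge0 ?sqr_ge0.
have Z1 n : 1 <= Z n by rewrite ZE lerDl sumr_ge0.
have Z0 n : 0 < Z n by exact: lt_le_trans (Z1 n).
pose dl n := (1 - U n) / (c0 * U n).
have out n : \sum_(x | x \notin wells_union (V n)) pi n x * u n x ^+ 2 <= dl n.
  rewrite /dl.
  have -> : 1 - U n = \sum_(x | x \notin wells_union (V n)) pi n x.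
    by rewrite -(wt_sum (pi n)) (bigID (mem (wells_union (V n))))/= /U /mass addrAC subrr add0r.
  rewrite mulr_suml; apply: ler_sum => x _; rewrite ler_wpM2l ?wt_ge0//.
  have [_ /(_ x)/andP[u0 ub] _] := uP n.
  rewrite -[leRHS]sqr_sqrtr ?invr_ge0 ?(ltW (cU n))//.
  by rewrite lerXn2r ?nnegrE ?sqrtr_ge0.
have mu1 n : \sum_x pi n x * u n x ^+ 2 / Z n = 1.
  by rewrite -mulr_suml -/(Z n) divff// lt0r_neq0.
have mu0 n x : 0 <= pi n x * u n x ^+ 2 / Z n by rewrite divr_ge0// ltW.
exists (fun n => mk_simplex (mu0 n) (mu1 n)); split => [n|f B fB].
  apply: (@le_trans _ _ (dform (@rate n) (pi n) (fun x => u n x / Num.sqrt (Z n)))%:E).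
    apply: (level2_rate_le_dform _ (@pi0 n) (@pi_rev n)) => // x.
    by rewrite mk_simplexE expr_div_n sqr_sqrtr ?(ltW (Z0 n))// [RHS]mulrA.
  rewrite lee_fin mulrC ler_pdivlMr// mulrC.
  have [_ _] := uP n; apply: le_trans; rewrite ler_pM2l//.
  apply: dform_le => // x y; rewrite -mulrBl normrM ler_piMr//.
  rewrite ger0_norm ?invr_ge0 ?sqrtr_ge0// invf_le1 ?sqrtr_gt0//.
  by rewrite -[leLHS]sqrtr1 ler_wsqrtr.
have dlc : 2 * B * dl n @[n --> \oo] --> (0 : R).
  rewrite -(mulr0 (2 * B)); apply: cvgMl_tmp.
  have -> : (0 : R) = (1 - 1) / (c0 * 1) by rewrite subrr mul0r.
  apply: cvgM; first by apply: cvgB => //; exact: cvg_cst.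
  by apply: cvgV; [rewrite mulr1 lt0r_neq0|apply: cvgMl_tmp].
have ndlc : - (2 * B * dl n) @[n --> \oo] --> (0 : R).
  by rewrite -oppr0; apply: cvgN.
apply: (squeeze_cvgr _ ndlc dlc); apply: nearW => n; rewrite -ler_norml.
rewrite (eq_bigr (fun x => pi n x * u n x ^+ 2 / Z n * f n x)) => [|x _]; last first.
  by rewrite mk_simplexE.
set S := \sum_x _; set A := \sum_i _.
have SE : S * Z n - A = \sum_(x | x \notin wells_union (V n)) pi n x * u n x ^+ 2 * f n x.
  have -> : S * Z n = \sum_x pi n x * u n x ^+ 2 * f n x.
    rewrite /S mulr_suml; apply: eq_bigr => x _; have := lt0r_neq0 (Z0 n) => h.
    by field.
  by rewrite split_sum -/A addrAC subrr add0r.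
have Sb : `|S| <= B.
  apply: (le_trans (ler_norm_sum _ _ _)).
  rewrite -[leRHS]mul1r -(mu1 n) mulr_suml; apply: ler_sum => x _.
  by rewrite normrM ger0_norm// ler_wpM2l.
have B0 : 0 <= B by exact: le_trans Sb.
have -> : S - A = - (S * (Z n - 1)) + (S * Z n - A) by ring.
apply: (le_trans (ler_normD _ _)).
have -> : 2 * B * dl n = B * dl n + B * dl n by ring.
apply: lerD.
  rewrite normrN normrM; apply: ler_pM => //.
  by rewrite ger0_norm ?subr_ge0// lerBlDl ZE lerD2l.
rewrite SE; apply: (le_trans (ler_norm_sum _ _ _)).
apply: (@le_trans _ _ (B * \sum_(x | x \notin wells_union (V n)) pi n x * u n x ^+ 2)).
  rewrite mulr_sumr; apply: ler_sum => x _.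
  by rewrite normrM ger0_norm// mulrC ler_wpM2r.
by rewrite ler_wpM2l.
Qed.

End amplitude.

End level.

(** * Lower and upper limits, distances and mixtures *)

Section ereal_limits.
Variable R : realType.
Implicit Types (u : nat -> \bar R) (c : \bar R).

Lemma limn_einf_lt u c : (limn_einf u < c)%E ->
  forall N, exists2 n, (N <= n)%N & (u n < c)%E.
Proof.
move=> uc N; have [//|H] := pselect (exists2 n, (N <= n)%N & (u n < c)%E).
suff : (c <= limn_einf u)%E by rewrite leNgt uc.
rewrite limn_einf_lim; apply: lime_ge; first exact: is_cvg_einfs.
exists N => // n /= Nn; apply: le_ereal_inf_tmp => _ [k /= nk <-].
by rewrite leNgt; apply/negP => uk; apply: H; exists k => //; exact: leq_trans nk.
Qed.

Lemma limn_einf_le u c : (forall N, exists2 n, (N <= n)%N & (u n <= c)%E) ->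
  (limn_einf u <= c)%E.
Proof.
move=> H; rewrite limn_einf_lim; apply: lime_le; first exact: is_cvg_einfs.
apply: nearW => n; have [k nk uk] := H n.
by apply: ge_ereal_inf; exists (u k) => //; exists k.
Qed.

Lemma limn_esup_le u c : (\forall n \near \oo, (u n <= c)%E) ->
  (limn_esup u <= c)%E.
Proof.
move=> [N _ H]; rewrite limn_esup_lim; apply: lime_le; first exact: is_cvg_esups.
exists N => // n /= Nn; apply: ge_ereal_sup => _ [k /= nk <-].
by apply: H => /=; exact: leq_trans nk.
Qed.

Lemma limn_esup_le_real u (v : nat -> R) (l : R) :
  (forall n, (u n <= (v n)%:E)%E) -> v n @[n --> \oo] --> l ->
  (limn_esup u <= l%:E)%E.
Proof.
move=> uv vl; apply/lee_addgt0Pr => e e0; apply: limn_esup_le.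
have : \forall n \near \oo, v n <= l + e.
  by apply: (cvgr_le l) => //; rewrite ltrDl.
by apply: filterS => n vn; rewrite (le_trans (uv n))// -EFinD lee_fin.
Qed.

End ereal_limits.

(** In [L^2] of a probability, the norm [N] of [g] is closer to the constant [a]
    than [g] is: expand both squares and use that the mean of [g] is at most
    [N]. *)
Lemma l2_distance_to_norm (R : realType) (I : finType) (c g : I -> R) (a N : R) :
  (forall i, 0 <= c i) -> \sum_i c i = 1 -> 0 <= a -> 0 <= N ->
  N ^+ 2 = \sum_i c i * g i ^+ 2 ->
  (N - a) ^+ 2 <= \sum_i c i * (g i - a) ^+ 2.
Proof.
move=> c0 c1 a0 N0 NE.
have mN : \sum_i c i * g i <= N.
  rewrite -(ger0_norm N0); apply: le_trans (ler_norm _) _.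
  rewrite -ler_sqr ?nnegrE// !real_normK ?num_real// NE.
  have : 0 <= \sum_i c i * (g i - \sum_j c j * g j) ^+ 2.
    by apply: sumr_ge0 => i _; rewrite mulr_ge0 ?sqr_ge0.
  set S := \sum_j c j * g j.
  have -> : \sum_i c i * (g i - S) ^+ 2 = \sum_i c i * g i ^+ 2 - S ^+ 2.
    rewrite (eq_bigr (fun i => c i * g i ^+ 2 - (2 * S) * (c i * g i) + S ^+ 2 * c i)).
      by rewrite big_split sumrB -!mulr_sumr -/S c1 /=; ring.
    by move=> i _; ring.
  by rewrite subr_ge0.
have -> : \sum_i c i * (g i - a) ^+ 2 = N ^+ 2 - 2 * a * (\sum_i c i * g i) + a ^+ 2.
  rewrite NE (eq_bigr (fun i => c i * g i ^+ 2 - (2 * a) * (c i * g i) + a ^+ 2 * c i)).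
    by rewrite big_split sumrB -!mulr_sumr c1 mulr1.
  by move=> i _; ring.
rewrite sqrrB -subr_ge0.
have -> : N ^+ 2 - 2 * a * (\sum_i c i * g i) + a ^+ 2 - (N ^+ 2 - N * a *+ 2 + a ^+ 2) =
   2 * a * (N - \sum_i c i * g i) by rewrite mulr2n; ring.
by rewrite !mulr_ge0// subr_ge0.
Qed.

Lemma sqrt_dist (R : realType) (a b : R) : 0 <= a -> 0 <= b ->
  `|Num.sqrt a - Num.sqrt b| <= Num.sqrt `|a - b|.
Proof.
move=> a0 b0; rewrite -ler_sqr ?nnegrE ?sqrtr_ge0// sqr_sqrtr// real_normK ?num_real//.
have -> : a - b = (Num.sqrt a - Num.sqrt b) * (Num.sqrt a + Num.sqrt b).
  by rewrite -subr_sqr !sqr_sqrtr.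
rewrite normrM -(real_normK (num_real (Num.sqrt a - _))) expr2 ler_wpM2l//.
rewrite (le_trans (ler_normB _ _))// (ger0_norm (sqrtr_ge0 a)) (ger0_norm (sqrtr_ge0 b)).
exact: ler_norm.
Qed.

(** The weights of a mixture of mixtures. *)
Definition wmix (R : realType) (I J : finType) (w : simplex R I)
    (K : I -> simplex R J) : simplex R J.
Proof.
apply: (@mk_simplex R J (fun k => \sum_i w i * K i k)).
  by move=> k; apply: sumr_ge0 => i _; rewrite mulr_ge0 ?wt_ge0.
rewrite exchange_big -(wt_sum w); apply: eq_bigr => i _.
by rewrite -mulr_sumr wt_sum mulr1.
Defined.

Lemma wmixE (R : realType) (I J : finType) (w : simplex R I)
    (K : I -> simplex R J) k : wmix w K k = \sum_i w i * K i k.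
Proof. exact: mk_simplexE. Qed.

Lemma mixture_wmix d (T : measurableType d) (R : realType) (I J : finType)
    (w : simplex R I) (K : I -> simplex R J) (mI : I -> probability T R)
    (mJ : J -> probability T R) :
  (forall i, same_measure (mI i) (mixture (K i) mJ)) ->
  same_measure (mixture w mI) (mixture (wmix w K) mJ).
Proof.
move=> H A mA; rewrite /mixture /= /mix.
rewrite (eq_bigr (fun i => \sum_j (w i)%:E * ((K i j)%:E * mJ j A)))%E => [|i _].
  rewrite exchange_big; apply: eq_bigr => j _.
  rewrite wmixE -sumEFin ge0_sume_distrl => [|i _]; last first.
    by rewrite lee_fin mulr_ge0 ?wt_ge0.
  by apply: eq_bigr => i _; rewrite muleA -EFinM.
rewrite (H i A mA) /mixture /= /mix ge0_sume_distrr// => j _.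
by rewrite mule_ge0// lee_fin wt_ge0.
Qed.

Lemma same_measure_trans d (T : measurableType d) (R : realType)
    (a b c : probability T R) :
  same_measure a b -> same_measure b c -> same_measure a c.
Proof. by move=> ab bc A mA; rewrite ab// bc. Qed.

Lemma same_measure_sym d (T : measurableType d) (R : realType)
    (a b : probability T R) : same_measure a b -> same_measure b a.
Proof. by move=> ab A mA; rewrite ab. Qed.

(** * The hierarchy of time-scales *)

Section expansion.
Variables (R : realType) (d : nat) (Xi : state_space R d).
Variables (n0 : nat) (n0_gt0 : (0 < n0)%N).
Local Notation E := (fun n : nat => site Xi (n0 + n)).
Variable rate : forall n, site Xi (n0 + n) -> site Xi (n0 + n) -> R.
Hypothesis rate_ge0 : forall n x y, 0 <= @rate n x y.
Hypothesis rate_diag : forall n x, @rate n x x = 0.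
Hypothesis rate_irr : forall n, irreducible_chain (@rate n).
Variables (dO : nat -> measure_display) (Omega : forall n, measurableType (dO n)).
Variable P : forall n, site Xi (n0 + n) -> probability (Omega n) R.
Variable X : forall n, R -> Omega n -> site Xi (n0 + n).
Hypothesis X_ctmc : forall n, is_ctmc (@rate n) (@P n) (@X n).
Variable pi : forall n, simplex R (site Xi (n0 + n)).
Hypothesis pi_rev : forall n, detailed_balance (@rate n) (pi n).
Variables (q : nat) (nn : nat -> nat) (theta : nat -> nat -> R).
Variable V : forall p n, 'I_(nn p) -> {set site Xi (n0 + n)}.
Variable x : 'I_(nn 1%N) -> carrier Xi.
Hypothesis x_inj : injective x.
Hypothesis theta_gt0 : forall p n, (1 <= p <= q)%N -> 0 < theta p n.
Hypothesis theta_prec : forall p, (1 <= p < q)%N -> prec (theta p) (theta p.+1).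
Hypothesis V_wells : forall p n, (1 <= p <= q)%N -> wells (@V p n).
Variable r : forall p, 'I_(nn p) -> 'I_(nn p) -> R.
Hypothesis r_lim : forall p (i j : 'I_(nn p)), (1 <= p <= q)%N -> i != j ->
  theta p n * mean_rate (@rate n) (@P n) (@X n) (pi n) (@V p n) i j
    @[n --> \oo] --> r i j.
Hypothesis r_pos : forall p, (1 <= p <= q)%N ->
  exists i j : 'I_(nn p), i != j /\ 0 < r i j.
Variable C : forall p, 'I_(nn p.+1) -> {set 'I_(nn p)}.
Hypothesis C_inj : forall p, (1 <= p < q)%N -> injective (@C p).
Hypothesis C_classes : forall p (A : {set 'I_(nn p)}), (1 <= p < q)%N ->
  closed_irreducible_class (@r p) A <-> exists m, A = @C p m.
Hypothesis V_merge : forall p n m, (1 <= p < q)%N ->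
  @V p.+1 n m = (\bigcup_(j in @C p m) @V p n j)%SET.
Variable M : forall p, 'I_(nn p.+1) -> simplex R 'I_(nn p).
Hypothesis M_supp : forall p m k, (1 <= p < q)%N -> k \notin @C p m -> @M p m k = 0.
Hypothesis M_stat : forall p m, (1 <= p < q)%N -> stationary (@r p) (@M p m).
Variable c0 : R.
Hypothesis c0_gt0 : 0 < c0.
Hypothesis V_mass : forall p n (j : 'I_(nn p)), (1 <= p <= q)%N ->
  c0 <= mass (pi n) (V n j) / mass (pi n) (wells_union (@V p n)).

Hypothesis V1_full :
  mass (pi n) (wells_union (@V 1 n)) @[n --> \oo] --> (1 : R).
Variable beta : nat -> R.
Hypothesis beta_gt0 : forall n, 0 < beta n.
Hypothesis beta_prec : prec beta (theta 1).
Hypothesis poincare : forall n (j : 'I_(nn 1%N)) (h : site Xi (n0 + n) -> R) y,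
  y \in @V 1 n j ->
  \sum_(z in @V 1 n j) cond (pi n) (@V 1 n j) z * (h z - h y) ^+ 2
    <= beta n * dirichlet (@rate n) (pi n) (@V 1 n j) h.

Let pi0 n : forall a, 0 < pi n a := stationary_gt0 (@rate_ge0 n) (@rate_irr n) (@pi_rev n).

(** * Closed classes of the reduced chains *)

Lemma r_ge0_level p (i j : 'I_(nn p)) : (1 <= p <= q)%N -> i != j -> 0 <= r i j.
Proof.
move=> hp ij; have rl (i' j' : 'I_(nn p)) := @r_lim p i' j' hp.
exact (@r_ge0 _ E rate rate_ge0 rate_irr dO Omega P X pi pi_rev _
  (@V p) (fun n => V_wells n hp) (theta p) (fun n => theta_gt0 n hp) (@r p) rl i j ij).
Qed.

Lemma connect_rate_sym p (i j : 'I_(nn p)) : (1 <= p <= q)%N ->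
  connect (edge (@r p)) i j = connect (edge (@r p)) j i.
Proof.
move=> hp; have [i0 [j0 [ij0 _]]] := r_pos hp.
have rl (i' j' : 'I_(nn p)) := @r_lim p i' j' hp.
have Vm n (k : 'I_(nn p)) := V_mass n k hp.
exact (@connect_edge_sym _ E rate rate_ge0 rate_diag rate_irr dO Omega P X X_ctmc pi pi_rev _
  (@V p) (fun n => V_wells n hp) (theta p) (fun n => theta_gt0 n hp) (@r p) rl i0 j0 ij0
  c0 c0_gt0 Vm i j).
Qed.

Lemma reversing_measure p : (1 <= p <= q)%N -> exists nu : 'I_(nn p) -> R,
  [/\ forall i, 0 < nu i, forall i j, nu i * r i j = nu j * r j i &
      forall i j, connect (edge (@r p)) i j ->
        mass (pi n) (V n j) / mass (pi n) (V n i) @[n --> \oo] --> nu j / nu i].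
Proof.
move=> hp; have [i0 [j0 [ij0 _]]] := r_pos hp.
have rl (i' j' : 'I_(nn p)) := @r_lim p i' j' hp.
have Vm n (k : 'I_(nn p)) := V_mass n k hp.
exact (@level_measure _ E rate rate_ge0 rate_diag rate_irr dO Omega P X X_ctmc pi pi_rev _
  (@V p) (fun n => V_wells n hp) (theta p) (fun n => theta_gt0 n hp) (@r p) rl i0 j0 ij0
  c0 c0_gt0 Vm).
Qed.

Lemma mass_well_gt0 p n (j : 'I_(nn p)) : (1 <= p <= q)%N -> 0 < mass (pi n) (V n j).
Proof.
move=> hp; have [/(_ j)[a aV] _] := V_wells n hp; exact: (mass_gt0 (pi0 (n := n)) aV).
Qed.

Lemma component_class p (i : 'I_(nn p)) : (1 <= p <= q)%N ->
  closed_irreducible_class (@r p) [set j | connect (edge (@r p)) i j]%SET.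
Proof.
move=> hp; split.
- by exists i; rewrite inE connect0.
- by move=> a b; rewrite !inE => ia ab; apply: (connect_trans ia); exact: connect1.
move=> a b; rewrite !inE => ia ib; apply: connect_trans ib.
by rewrite connect_rate_sym.
Qed.

Lemma class_component p (A : {set 'I_(nn p)}) (i : 'I_(nn p)) :
  closed_irreducible_class (@r p) A -> i \in A ->
  A = [set j | connect (edge (@r p)) i j]%SET.
Proof.
move=> [_ clA irrA] iA; apply/setP => j; rewrite inE; apply/idP/idP.
  by move=> jA; exact: irrA.
move=> /connectP[s]; elim: s i iA => [|k s IH] i iA /=; first by move=> _ ->.
by move=> /andP[ik ks]; apply: IH => //; exact: clA ik.
Qed.

(** There are no transient states: accessibility is symmetric, so the component
    of [k] is closed. *)
Lemma class_cover p (k : 'I_(nn p)) : (1 <= p < q)%N -> exists m, k \in @C p m.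
Proof.
move=> hp; have hp' : (1 <= p <= q)%N by case/andP: hp => -> /ltnW ->.
have /(C_classes _ hp)[m Cm] := component_class k hp'.
by exists m; rewrite -Cm inE connect0.
Qed.

Lemma class_connect p m (i j : 'I_(nn p)) : (1 <= p < q)%N ->
  i \in @C p m -> (j \in @C p m) = connect (edge (@r p)) i j.
Proof.
move=> hp iC; have cC : closed_irreducible_class (@r p) (@C p m).
  by apply/(C_classes _ hp); exists m.
by rewrite (class_component cC iC) inE.
Qed.

Lemma class_uniq p m m' (k : 'I_(nn p)) : (1 <= p < q)%N ->
  k \in @C p m -> k \in @C p m' -> m = m'.
Proof.
move=> hp km km'; apply: (C_inj hp); apply/setP => j.
by rewrite (class_connect _ hp km) (class_connect _ hp km').
Qed.

Lemma wells_unionS p n : (1 <= p < q)%N ->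
  wells_union (@V p.+1 n) = wells_union (@V p n).
Proof.
move=> hp; apply/setP => a; apply/finset.bigcupP/finset.bigcupP.
  move=> [m _]; rewrite V_merge// => /finset.bigcupP[j _ aj]; by exists j.
move=> [k _ ak]; have [m km] := class_cover k hp.
by exists m => //; rewrite V_merge//; apply/finset.bigcupP; exists k.
Qed.

Lemma wells_union1 p n : (1 <= p <= q)%N ->
  wells_union (@V p n) = wells_union (@V 1 n).
Proof.
case: p => // p; elim: p => [//|p IH] hp.
rewrite wells_unionS; last exact: hp.
by apply: IH; case/andP: hp => _ /ltnW ->.
Qed.

(** Testing stationarity of [M] against its own density [M / nu] shows that the
    Dirichlet form of this density vanishes, so it is constant on the class. *)
Lemma class_stationaryE p m (nu : 'I_(nn p) -> R) : (1 <= p < q)%N ->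
  (forall i, 0 < nu i) -> (forall i j, nu i * r i j = nu j * r j i) ->
  forall i, i \in @C p m -> @M p m i = nu i / \sum_(j in @C p m) nu j.
Proof.
move=> hp nu0 nur i iC; have hp' : (1 <= p <= q)%N by case/andP: hp => -> /ltnW ->.
pose g j := @M p m j / nu j.
have nun j : nu j != 0 by rewrite lt0r_neq0.
have g0 : dform (@r p) nu g = 0.
  have -> : dform (@r p) nu g = - \sum_a nu a * (g a * gen (@r p) g a).
    rewrite (gen_by_parts nur) opprK /dform; congr (_ * _).
  rewrite (eq_bigr (fun a => @M p m a * gen (@r p) g a)) => [|a _].
    by rewrite (M_stat m hp) oppr0.
  by rewrite /g mulrA mulrCA divff// mulr1.
have gi j : j \in @C p m -> @M p m j = g i * nu j.
  move=> jC; rewrite (dform_eq0_connect _ nu0 g0 (y := j)).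
  - by rewrite /g divfK.
  - by move=> a b ab; exact: r_ge0_level.
  - by rewrite -(class_connect _ hp iC).
have S1 : g i * \sum_(j in @C p m) nu j = 1.
  rewrite mulr_sumr -(wt_sum (@M p m)) big_mkcond; apply: eq_bigr => j _.
  by case: ifPn => jC; [rewrite gi|rewrite M_supp].
have S0 : \sum_(j in @C p m) nu j != 0.
  by apply/eqP => S0; move/eqP: S1; rewrite S0 mulr0 eq_sym oner_eq0.
rewrite gi// mulrC; congr (_ * _); apply: (mulIf S0).
by rewrite S1 mulVf.
Qed.

Lemma merged_mass p n m : (1 <= p < q)%N ->
  mass (pi n) (@V p.+1 n m) = \sum_(i in @C p m) mass (pi n) (@V p n i).
Proof.
move=> hp; have hp' : (1 <= p <= q)%N by case/andP: hp => -> /ltnW ->.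
have [_ Vd] := V_wells n hp'.
rewrite /mass V_merge// (exchange_big_dep (fun a => a \in (\bigcup_(j in @C p m) @V p n j)%SET)) /=.
  apply: eq_bigr => a /finset.bigcupP[i iC ai].
  rewrite (big_pred1 i)// => j; apply/andP/eqP => [[_ /(Vd _ _ _ ai)->//]|-> //].
by move=> i a iC ai; apply/finset.bigcupP; exists i.
Qed.

Lemma mass_ratio_cvg p m (i : 'I_(nn p)) : (1 <= p < q)%N -> i \in @C p m ->
  mass (pi n) (V n i) / mass (pi n) (V n m) @[n --> \oo] --> @M p m i.
Proof.
move=> hp iC; have hp' : (1 <= p <= q)%N by case/andP: hp => -> /ltnW ->.
have [nu [nu0 nur nuc]] := reversing_measure hp'.
rewrite (class_stationaryE hp nu0 nur iC).
have Sc : (\sum_(j in @C p m) mass (pi n) (V n j) / mass (pi n) (V n i)) @[n --> \oo]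
    --> \sum_(j in @C p m) nu j / nu i.
  by apply: cvg_sumr => j jC; apply: nuc; rewrite -(class_connect _ hp iC).
have S0 : \sum_(j in @C p m) nu j / nu i != 0.
  rewrite lt0r_neq0// (bigD1 i)//= divff ?lt0r_neq0// ltr_pwDl// sumr_ge0// => j _.
  by rewrite divr_ge0// ltW.
have -> : nu i / (\sum_(j in C m) nu j) = (\sum_(j in C m) nu j / nu i)^-1.
  by rewrite -mulr_suml invf_div.
rewrite (_ : (fun n => _) = (fun n =>
    (\sum_(j in C m) mass (pi n) (V n j) / mass (pi n) (V n i))^-1)).
  exact: cvgV.
by apply/funext => n; rewrite -mulr_suml invf_div merged_mass.
Qed.

(** * Limits of the conditional laws on the wells *)

Lemma ltn_le p : (1 <= p < q)%N -> (1 <= p <= q)%N.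
Proof. by case/andP => -> /ltnW ->. Qed.

Lemma cond_sum p n (j : 'I_(nn p)) (F : site Xi (n0 + n) -> R) : (1 <= p <= q)%N ->
  \sum_a cond (pi n) (V n j) a * F a = \sum_(a in V n j) pi n a / mass (pi n) (V n j) * F a.
Proof.
move=> hp; rewrite [RHS]big_mkcond; apply: eq_bigr => a _.
rewrite condE; last by rewrite lt0r_neq0// mass_well_gt0.
by case: ifP => //; rewrite mul0r.
Qed.

Lemma cond_merge p n m (F : site Xi (n0 + n) -> R) : (1 <= p < q)%N ->
  \sum_a cond (pi n) (@V p.+1 n m) a * F a =
  \sum_(i in @C p m) mass (pi n) (V n i) / mass (pi n) (V n m) *
    \sum_a cond (pi n) (V n i) a * F a.
Proof.
move=> hp; have hp' := ltn_le hp; have hpS : (1 <= p.+1 <= q)%N by case/andP: hp => _ ->.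
have [_ Vd] := V_wells n hp'.
rewrite cond_sum//; set Z := mass _ (V n m).
rewrite [LHS](eq_bigl (mem (\bigcup_(j in @C p m) @V p n j)%SET)); last first.
  by move=> a /=; rewrite V_merge.
rewrite (eq_bigr (fun i => \sum_(a in V n i) pi n a / Z * F a)) => [|i iC].
  rewrite (exchange_big_dep (fun a => a \in (\bigcup_(j in @C p m) @V p n j)%SET)) /=.
    apply: eq_bigr => a /finset.bigcupP[i iC ai].
    by rewrite (big_pred1 i)// => j; apply/andP/eqP => [[_ /(Vd _ _ _ ai)->//]|-> //].
  by move=> i a iC ai; apply/finset.bigcupP; exists i.
rewrite cond_sum// mulr_sumr; apply: eq_bigr => a ai.
have h1 := lt0r_neq0 (mass_well_gt0 n i hp'); have h2 := lt0r_neq0 (mass_well_gt0 n m hpS).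
by rewrite /Z; field; rewrite h1 h2.
Qed.

(** The conditional law on a merged well is the mixture of the conditional laws
    on its parts with the ratios of masses as weights, and these converge to the
    stationary state of the class. Both [deep_weight_cvg] and [limit_state_cvg]
    are instances. *)
Lemma cond_cvg (F : forall n, site Xi (n0 + n) -> R)
    (a : forall p, 'I_(nn p.+1) -> R) :
  (forall p m, a p.+1 m = \sum_i @M p.+1 m i * a p i) ->
  (forall j, \sum_b cond (pi n) (@V 1 n j) b * F n b @[n --> \oo] --> a 0%N j) ->
  forall p, (p.+1 <= q)%N -> forall j,
    \sum_b cond (pi n) (@V p.+1 n j) b * F n b @[n --> \oo] --> a p j.
Proof.
move=> aS a0; elim => [_ j|p IH hp m]; first exact: a0.
have hp' : (1 <= p.+1 < q)%N by [].
rewrite aS; have -> : \sum_i @M p.+1 m i * a p i = \sum_(i in @C p.+1 m) @M p.+1 m i * a p i.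
  rewrite [RHS]big_mkcond; apply: eq_bigr => i _.
  by case: ifPn => // iC; rewrite M_supp// mul0r.
rewrite (_ : (fun n => _) = (fun n => \sum_(i in @C p.+1 m)
    mass (pi n) (V n i) / mass (pi n) (V n m) *
    \sum_a cond (pi n) (V n i) a * F n a)); last first.
  by apply/funext => n; rewrite cond_merge.
apply: cvg_sumr => i iC; apply: cvgM; first exact: mass_ratio_cvg.
by apply: IH; exact: ltnW.
Qed.

Definition unit_weight (J : finType) (j : J) : simplex R J.
Proof.
apply: (@mk_simplex R J (fun k => (k == j)%:R)) => [k|]; first exact: ler0n.
by rewrite (bigD1 j)//= eqxx big1 ?addr0// => k /negbTE ->.
Defined.

Lemma unit_weightE (J : finType) (j k : J) : unit_weight j k = (k == j)%:R.
Proof. exact: mk_simplexE. Qed.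

(** The weights of pi^(p+1)_j on the points [x k], obtained by composing the
    stationary states of all lower scales. *)
Fixpoint deep_weight p : 'I_(nn p.+1) -> simplex R 'I_(nn 1) :=
  if p is p'.+1 then fun j => wmix (M j) (@deep_weight p')
  else fun j => unit_weight j.

Let pm k := point_mass R (x k).

Lemma limit_state_deep p (j : 'I_(nn p.+1)) :
  same_measure (limit_state x M j) (mixture (deep_weight j) pm).
Proof.
elim: p j => [|p IH] j /=; last exact: mixture_wmix.
move=> A mA; rewrite mixture_point_mass.
rewrite (bigD1 j)//= unit_weightE eqxx mul1r big1 ?addr0; last first.
  by move=> k /negbTE kj; rewrite unit_weightE kj mul0r.
by rewrite diracE.
Qed.

Lemma deep_weight_cvg p (j : 'I_(nn p.+1)) k : (p.+1 <= q)%N ->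
  \sum_a cond (pi n) (@V p.+1 n j) a * (a \in @V 1 n k)%:R @[n --> \oo]
    --> deep_weight j k.
Proof.
move=> hp; have hq : (1 <= 1 <= q)%N by rewrite (leq_ltn_trans _ hp).
apply: (cond_cvg (F := fun n a => (a \in @V 1 n k)%:R) (a := fun p j => deep_weight j k)) => //.
  by move=> p' m /=; rewrite wmixE.
move=> {hp}{}j /=; rewrite unit_weightE.
rewrite (_ : (fun n => _) = cst (k == j)%:R); first exact: cvg_cst.
apply/funext => n /=; have [_ Vd] := V_wells n hq.
have [->|kj] := eqVneq k j.
  rewrite -[RHS](wt_sum (cond (pi n) (V n j))); apply: eq_bigr => a _.
  rewrite condE ?lt0r_neq0 ?mass_well_gt0//.
  by case: ifP => _; rewrite ?mulr1 ?mulr0.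
rewrite big1// => a _; rewrite condE ?lt0r_neq0 ?mass_well_gt0//.
case: ifPn => [aj|_]; last by rewrite mul0r.
case: (boolP (a \in V n k)) => ak; last by rewrite mulr0.
by have := Vd _ _ _ ak aj => h; rewrite h eqxx in kj.
Qed.

Lemma limit_state_cvg p (j : 'I_(nn p.+1)) (f : carrier Xi -> R) : (p.+1 <= q)%N ->
  (forall k, (fun n => embed (cond (pi n) (@V 1 n k))) @ \oo --> pm k) ->
  continuous f ->
  \sum_a cond (pi n) (@V p.+1 n j) a * f (site_pt a) @[n --> \oo]
    --> \int[limit_state x M j]_y f y.
Proof.
move=> hp Vc cf.
apply: (cond_cvg (F := fun n a => f (site_pt a))
  (a := fun p j => \int[limit_state x M j]_y f y)) => // [p' m|k] /=.
  by rewrite Rintegral_mixture_continuous.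
rewrite (_ : (fun n => _) = (fun n => \int[embed (cond (pi n) (@V 1 n k))]_y f y)).
  by have /weak_cvgP/(_ f cf) := Vc k.
by apply/funext => n; rewrite Rintegral_embed.
Qed.

Lemma first_well_in p k : (p.+1 <= q)%N ->
  exists j, forall n, @V 1 n k \subset @V p.+1 n j.
Proof.
elim: p => [_|p IH hp]; first by exists k.
have [j jP] := IH (ltnW hp).
have [m jm] := @class_cover p.+1 j hp; exists m => n; rewrite (@V_merge p.+1)//.
apply/fintype.subsetP => a ak; apply/finset.bigcupP; exists j => //.
exact: (fintype.subsetP (jP n)).
Qed.

Definition merged_well p (hp : (p.+1 <= q)%N) k := projT1 (cid (first_well_in k hp)).

Section merged.
Variables (p : nat) (hp : (p.+1 <= q)%N).
Let hp' : (1 <= p.+1 <= q)%N. Proof. by []. Qed.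
Let hq : (1 <= 1 <= q)%N. Proof. by rewrite (leq_ltn_trans _ hp). Qed.

Lemma merged_wellP n k : @V 1 n k \subset V n (merged_well hp k).
Proof. exact: (projT2 (cid (first_well_in k hp))). Qed.

Lemma well_first n (j : 'I_(nn p.+1)) a : a \in V n j ->
  exists2 k, a \in @V 1 n k & merged_well hp k = j.
Proof.
move=> aj; have : a \in wells_union (@V p.+1 n) by apply/finset.bigcupP; exists j.
rewrite wells_union1// => /finset.bigcupP[k _ ak]; exists k => //.
have [_ Vd] := V_wells n hp'.
by apply: Vd aj; exact: (fintype.subsetP (merged_wellP n k)).
Qed.

Lemma deep_weight_out k j : merged_well hp k != j -> deep_weight j k = 0.
Proof.
move=> kj; rewrite -(cvg_lim (@Rhausdorff R) (@deep_weight_cvg p j k hp)).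
apply: cvg_lim => //; rewrite (_ : (fun n => _) = cst 0); first exact: cvg_cst.
apply/funext => n /=; rewrite big1// => a _; rewrite condE ?lt0r_neq0 ?mass_well_gt0//.
case: ifPn => [aj|_]; last by rewrite mul0r.
case: (boolP (a \in V n k)) => ak; last by rewrite mulr0.
have [_ Vd] := V_wells n hp'.
have h := Vd _ _ _ (fintype.subsetP (merged_wellP n k) _ ak) aj.
by rewrite h eqxx in kj.
Qed.

Lemma mass_deep_cvg k : mass (pi n) (@V 1 n k) / mass (pi n) (V n (merged_well hp k))
  @[n --> \oo] --> deep_weight (merged_well hp k) k.
Proof.
rewrite (_ : (fun n => _) = (fun n => \sum_a
    cond (pi n) (V n (merged_well hp k)) a * (a \in @V 1 n k)%:R)).
  exact: deep_weight_cvg.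
apply/esym/funext => n; rewrite cond_sum// mulr_suml.
rewrite (bigID (mem (@V 1 n k)))/= [X in _ + X]big1 ?addr0; last first.
  by move=> a /andP[_ /negbTE ->]; rewrite mulr0.
apply: eq_big => a.
  by apply/andP/idP => [[]//|ak]; split => //; exact: (fintype.subsetP (merged_wellP n k)).
by move=> /andP[_ ->]; rewrite mulr1.
Qed.

Lemma deep_weight_sum (w : simplex R 'I_(nn p.+1)) k :
  wmix w (@deep_weight p) k = w (merged_well hp k) * deep_weight (merged_well hp k) k.
Proof.
rewrite wmixE (bigD1 (merged_well hp k))//= big1 ?addr0// => j jk.
by rewrite deep_weight_out ?mulr0// eq_sym.
Qed.

Lemma deep_weight_inj (w w' : simplex R 'I_(nn p.+1)) :
  wmix w (@deep_weight p) =1 wmix w' (@deep_weight p) -> w =1 w'.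
Proof.
move=> H j.
have E (v : simplex R 'I_(nn p.+1)) :
    v j = \sum_(k | merged_well hp k == j) wmix v (@deep_weight p) k.
  rewrite (eq_bigr (fun k => v j * deep_weight j k)) => [|k /eqP kj]; last first.
    by rewrite deep_weight_sum kj.
  rewrite -mulr_sumr (_ : \sum_(k | _) _ = 1) ?mulr1//.
  rewrite -(wt_sum (deep_weight j)) [RHS](bigID (fun k => merged_well hp k == j))/=.
  by rewrite [X in _ + X]big1 ?addr0// => k; exact: deep_weight_out.
by rewrite !E; apply: eq_bigr => k _; exact: H.
Qed.

Lemma mixture_deep (w : simplex R 'I_(nn p.+1)) :
  same_measure (mixture w (@limit_state _ _ nn x M p))
    (mixture (wmix w (@deep_weight p)) pm).
Proof. by apply: mixture_wmix => j; exact: limit_state_deep. Qed.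

(** Each point [x k] is charged by a single state, the one whose well contains
    the k-th well of the first scale. *)
Lemma mixture_state_inj (w w' : simplex R 'I_(nn p.+1)) :
  same_measure (mixture w (@limit_state _ _ nn x M p))
    (mixture w' (@limit_state _ _ nn x M p)) -> w =1 w'.
Proof.
move=> H; apply: deep_weight_inj; apply: (point_mixture_inj x_inj).
apply: same_measure_trans (mixture_deep w').
exact: same_measure_trans (same_measure_sym (mixture_deep w)) H.
Qed.

End merged.

(** * Flatness of densities with a bounded rate *)

Lemma prec_level p : (1 <= p <= q)%N -> prec beta (theta p).
Proof.
case: p => // p; elim: p => [_|p IH hp]; first exact: beta_prec.
have hlt : (1 <= p.+1 < q)%N by exact: hp.
have hpq := ltn_le hlt; have h := IH hpq.
have := cvgM h (theta_prec hlt); rewrite mulr0 => H.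
rewrite /prec (_ : (fun n => _) = (fun n => beta n / theta p.+1 n) \*
  (fun n => theta p.+1 n / theta p.+2 n)); first exact: H.
apply/funext => n /=; have h1 := lt0r_neq0 (theta_gt0 n hpq).
by have h2 := lt0r_neq0 (theta_gt0 n hp); field; rewrite h1 h2.
Qed.

Lemma poincare_dform n k (h : site Xi (n0 + n) -> R) y : (1 <= q)%N -> y \in @V 1 n k ->
  \sum_z cond (pi n) (@V 1 n k) z * (h z - h y) ^+ 2 <=
  beta n * dform (@rate n) (pi n) h / mass (pi n) (@V 1 n k).
Proof.
move=> q1 yk; have hq : (1 <= 1 <= q)%N by [].
have -> : \sum_z cond (pi n) (@V 1 n k) z * (h z - h y) ^+ 2 =
    \sum_(z in @V 1 n k) cond (pi n) (@V 1 n k) z * (h z - h y) ^+ 2.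
  rewrite [RHS]big_mkcond; apply: eq_bigr => z _.
  by rewrite condE ?lt0r_neq0 ?mass_well_gt0//; case: ifP => // _; rewrite mul0r.
apply: (le_trans (poincare h yk)).
rewrite -mulrA ler_pM2l// /dirichlet mulrAC ler_wpM2r ?invr_ge0 ?(ltW (mass_well_gt0 n k hq))//.
rewrite /dform ler_pM2l ?invr_gt0// [leRHS](bigID (mem (@V 1 n k)))/=.
have t0 a b : 0 <= pi n a * rate a b * (h b - h a) ^+ 2.
  by rewrite mulr_ge0 ?sqr_ge0// mulr_ge0 ?wt_ge0.
rewrite ler_wpDr//; first by apply: sumr_ge0 => a _; exact: sumr_ge0.
apply: ler_sum => a _; rewrite [leRHS](bigID (mem (@V 1 n k :\ a)))/=.
by rewrite lerDl sumr_ge0.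
Qed.

Lemma near_forall_fin (I : finType) (Q : I -> nat -> Prop) :
  (forall k, \forall n \near \oo, Q k n) -> \forall n \near \oo, forall k, Q k n.
Proof.
move=> H.
have /choice[N NP] : forall k, exists N, forall n, (N <= n)%N -> Q k n.
  by move=> k; have [N _ HN] := H k; exists N.
exists (\max_k N k) => // n /= Nn k; apply: NP.
by apply: leq_trans Nn; exact: leq_bigmax.
Qed.

(** Write [N] for the norm of the square root [g] of the density in [L^2] of the
    conditional law on a well of the first scale. The Poincare inequality bounds
    [N - g a] uniformly in [a]. The square of [N] is a ratio of masses, and its
    difference with the square of the amplitude tends to zero, because [pi n] and
    the limit weights share out a well of scale p+1 among its parts in the same
    proportions. *)
Lemma density_flat p (hp : (p.+1 <= q)%N) (w : simplex R 'I_(nn p.+1))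
    (mu : forall n, simplex R (site Xi (n0 + n))) (B : R) :
  (forall k, mass (mu n) (@V 1 n k) @[n --> \oo] --> wmix w (@deep_weight p) k) ->
  forall e, 0 < e -> \forall n \near \oo,
    theta p.+1 n * dform (@rate n) (pi n) (fun a => Num.sqrt (mu n a / pi n a)) <= B ->
    forall i a, a \in V n i ->
      `|Num.sqrt (mu n a / pi n a) - amplitude pi (@V p.+1) n w i| <= e.
Proof.
move=> muc e e0; have hp' : (1 <= p.+1 <= q)%N by [].
have q1 : (1 <= q)%N by exact: leq_trans hp.
have hq : (1 <= 1 <= q)%N by [].
pose g n a := Num.sqrt (mu n a / pi n a).
suff H k : \forall n \near \oo,
    theta p.+1 n * dform (@rate n) (pi n) (g n) <= B -> forall a, a \in @V 1 n k ->
    `|g n a - amplitude pi (@V p.+1) n w (merged_well hp k)| <= e.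
  have := near_forall_fin H; apply: filterS => n Hn nB i a ai.
  by have [k ak <-] := well_first hp ai; exact: Hn.
pose m1 n := mass (pi n) (@V 1 n k); pose mI n := mass (pi n) (V n (merged_well hp k)).
have m10 n : 0 < m1 n by exact: mass_well_gt0.
have mI0 n : 0 < mI n by exact: mass_well_gt0.
pose e2 := (e / 2) ^+ 2; have e20 : 0 < e2 by rewrite exprn_gt0// divr_gt0.
have c2 : 0 < c0 / 2 by rewrite divr_gt0.
have wI := deep_weight_sum hp w k.
have d1 : `|mass (mu n) (@V 1 n k) - w (merged_well hp k) * (m1 n / mI n)| @[n --> \oo] --> (0 : R).
  rewrite -(normr0 R); apply: cvg_norm.
  have -> : (0 : R) = w (merged_well hp k) * deep_weight (merged_well hp k) k -
     w (merged_well hp k) * deep_weight (merged_well hp k) k by rewrite subrr.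
  apply: cvgB; first by rewrite -wI; exact: muc.
  by apply: cvgMl_tmp; exact: mass_deep_cvg.
have d2 : beta n / theta p.+1 n @[n --> \oo] --> (0 : R) by exact: prec_level.
near=> n => nB a ak.
have m1c : c0 / 2 <= m1 n.
  have := V_mass n k hq; rewrite ler_pdivlMr; last first.
    by apply: (mass_gt0 (pi0 (n := n)) (x := a)); apply/finset.bigcupP; exists k.
  apply: le_trans; rewrite ler_pM2l//.
  by near: n; apply: (cvgr_ge 1) => //; rewrite invf_lt1// ltr1n.
pose N := Num.sqrt (mass (mu n) (@V 1 n k) / m1 n).
have mu0 : 0 <= mass (mu n) (@V 1 n k) by apply: sumr_ge0 => b _; exact: wt_ge0.
have g0 b : 0 <= g n b by exact: sqrtr_ge0.
have NE : N ^+ 2 = \sum_b cond (pi n) (@V 1 n k) b * g n b ^+ 2.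
  rewrite sqr_sqrtr ?divr_ge0 ?(ltW (m10 n))// cond_sum// /mass mulr_suml.
  apply: eq_bigr => b _; rewrite /g sqr_sqrtr ?divr_ge0 ?wt_ge0// -/(mass _ _) -/(m1 n).
  have h1 := lt0r_neq0 (m10 n); have h2 := lt0r_neq0 (pi0 b).
  by field; rewrite h1 h2.
have h1 : (N - g n a) ^+ 2 <= e2.
  have := l2_distance_to_norm (wt_ge0 (cond (pi n) (@V 1 n k))) (wt_sum _) (g0 a) (sqrtr_ge0 _) NE.
  move=> /le_trans; apply; apply: (le_trans (poincare_dform (g n) q1 ak)).
  have th := theta_gt0 n hp'; have b0 := beta_gt0 n.
  have dB : beta n * dform (rate (n:=n)) (pi n) (g n) <= beta n / theta p.+1 n * `|B|.
    rewrite -mulrA ler_pM2l// ler_pdivlMl//; apply: (le_trans nB); exact: ler_norm.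
  rewrite ler_pdivrMr; last exact: m10.
  apply: (le_trans dB).
  apply: (@le_trans _ _ (e2 * (c0 / 2))); last by rewrite ler_pM2l.
  near: n; apply: (cvgr_le 0); last by rewrite mulr_gt0.
  by rewrite -(mul0r `|B|); apply: cvgMr_tmp.
have h2 : `|N - amplitude pi (@V p.+1) n w (merged_well hp k)| <= e / 2.
  apply: le_trans (sqrt_dist _ _) _; rewrite ?divr_ge0 ?wt_ge0 ?(ltW (m10 n)) ?(ltW (mI0 n))//.
  have -> : e / 2 = Num.sqrt e2 by rewrite sqrtr_sqr ger0_norm ?divr_ge0 ?(ltW e0).
  rewrite ler_wsqrtr//.
  rewrite (_ : well_mass _ _ _ _ = mI n)//.
  have -> : mass (mu n) (@V 1 n k) / m1 n - w (merged_well hp k) / mI n =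
     (mass (mu n) (@V 1 n k) - w (merged_well hp k) * (m1 n / mI n)) / m1 n.
    have z1 := lt0r_neq0 (m10 n); have z2 := lt0r_neq0 (mI0 n).
    by field; rewrite z1 z2.
  rewrite normrM normfV (gtr0_norm (m10 n)) ler_pdivrMr//.
  apply: (@le_trans _ _ (e2 * (c0 / 2))); last by rewrite ler_pM2l.
  by near: n; apply: (cvgr_le 0) => //; rewrite mulr_gt0.
have h3 : `|g n a - N| <= e / 2.
  rewrite -ler_sqr ?nnegrE ?divr_ge0 ?(ltW e0)// real_normK ?num_real//.
  by rewrite -sqrrN opprB.
rewrite -(subrK N (g n a)) -addrA (le_trans (ler_normD _ _))//.
by rewrite [leRHS](splitr e) lerD.
Unshelve. all: by end_near.
Qed.

Hypothesis V1_dirac : forall k,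
  (fun n => embed (cond (pi n) (@V 1 n k))) @ \oo --> pm k.

Let state p := @limit_state _ _ nn x M p.
Let functional p := limit_rate x M r p.

(** * Zero sets of the limiting functionals *)

Lemma level2_rate_limit_form p : (1 <= p <= q)%N -> exists nu : 'I_(nn p) -> R,
  [/\ forall i, 0 < nu i, forall i j, nu i * r i j = nu j * r j i &
      forall w : simplex R 'I_(nn p),
        level2_rate (@r p) w = (limit_form (@r p) nu w)%:E].
Proof.
move=> hp; have [nu [nu0 nur _]] := reversing_measure hp.
exists nu; split => // w; apply: level2_rate_sqrt => // [i j ij|i].
  exact: r_ge0_level.
exact: wt_ge0.
Qed.

Lemma functional_lty p mu : (functional p mu < +oo)%E ->
  exists w : simplex R 'I_(nn p.+1), same_measure mu (mixture w (@state p)) /\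
    functional p mu = level2_rate (@r p.+1) w.
Proof.
rewrite /functional /limit_rate; case: pselect => [h _|_]; last by rewrite ltxx.
by exists (projT1 (cid h)); split => //; exact: (projT2 (cid h)).
Qed.

Lemma functional_mixture p mu (w : simplex R 'I_(nn p.+1)) : (p.+1 <= q)%N ->
  same_measure mu (mixture w (@state p)) ->
  functional p mu = level2_rate (@r p.+1) w.
Proof.
move=> hp mw; rewrite /functional /limit_rate; case: pselect => [h|]; last first.
  by case; exists w.
have H := projT2 (cid h); congr level2_rate; apply/funext => i.
apply: (mixture_state_inj hp).
exact: same_measure_trans (same_measure_sym H) mw.
Qed.

Lemma functional_ge0 p mu : (0 <= functional p mu)%E.
Proof.
rewrite /functional /limit_rate; case: pselect => [h|_]; last by rewrite leey.
exact: level2_rate_ge0.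
Qed.

(** A zero rate means that [w] is itself reversing, up to a constant on each
    class. *)
Lemma limit_form_eq0 p (nu : 'I_(nn p) -> R) (w : simplex R 'I_(nn p)) :
  (1 <= p <= q)%N -> (forall i, 0 < nu i) ->
  (forall i j, nu i * r i j = nu j * r j i) ->
  limit_form (@r p) nu w = 0 <->
  forall i j, connect (edge (@r p)) i j -> w i / nu i = w j / nu j.
Proof.
move=> hp nu0 nur.
have r0 i j : i != j -> 0 <= @r p i j by exact: r_ge0_level.
have wn i : 0 <= w i / nu i by rewrite divr_ge0 ?wt_ge0// ltW.
split => [H i j ij|H].
  have := dform_eq0_connect r0 nu0 H ij => E.
  by rewrite -[LHS]sqr_sqrtr// E sqr_sqrtr.
rewrite /limit_form /dform big1 ?mulr0// => i _; rewrite big1// => j _.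
have [->|ij] := eqVneq i j; first by rewrite subrr expr0n mulr0.
have [rij|rij] := ltP 0 (@r p i j).
  by rewrite (H i j) ?subrr ?expr0n ?mulr0// connect1// /edge ij.
have -> : @r p i j = 0 by apply/le_anti; rewrite rij r0.
by rewrite mulr0 mul0r.
Qed.

Lemma level2_rate_eq0 p (w : simplex R 'I_(nn p)) : (1 <= p < q)%N ->
  level2_rate (@r p) w = 0%E <->
  exists w' : simplex R 'I_(nn p.+1), w =1 wmix w' (@M p).
Proof.
move=> hp; have hp' := ltn_le hp.
have [nu [nu0 nur ->]] := level2_rate_limit_form hp'.
have ME := class_stationaryE hp nu0 nur.
have nun i : nu i != 0 by rewrite lt0r_neq0.
split => [[/(limit_form_eq0 w hp' nu0 nur) H]|[w' ww]].
  have w1 : \sum_m \sum_(i in @C p m) w i = 1.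
    rewrite (exchange_big_dep xpredT)//= -(wt_sum w); apply: eq_bigr => i _.
    have [m im] := class_cover i hp.
    rewrite (big_pred1 m)// => m'; apply/idP/eqP => [im'|->//].
    exact: class_uniq im' im.
  have w0 m : 0 <= \sum_(i in @C p m) w i by apply: sumr_ge0 => i _; exact: wt_ge0.
  exists (mk_simplex w0 w1) => i.
  have [m im] := class_cover i hp.
  rewrite wmixE (bigD1 m)//= big1 ?addr0 => [|m' m'm]; last first.
    by rewrite M_supp ?mulr0//; apply: contraNN m'm => im'; apply/eqP; exact: class_uniq im' im.
  rewrite mk_simplexE ME//.
  have S0 : \sum_(j in @C p m) nu j != 0.
    by rewrite lt0r_neq0// (bigD1 i)//= ltr_pwDl// sumr_ge0// => j _; rewrite ltW.
  have -> : \sum_(j in @C p m) w j = w i / nu i * \sum_(j in @C p m) nu j.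
    rewrite mulr_sumr; apply: eq_bigr => j jm.
    by rewrite (H i j) ?divfK// -(class_connect _ hp im).
  by have ni := nun i; field; rewrite ni S0.
congr (_%:E); apply/(limit_form_eq0 w hp' nu0 nur) => i j ij.
have [m im] := class_cover i hp.
have jm : j \in @C p m by rewrite (class_connect j hp im).
have E k : k \in @C p m -> w k / nu k = w' m / \sum_(j in @C p m) nu j.
  move=> km; rewrite ww wmixE (bigD1 m)//= big1 ?addr0 => [|m' m'm]; last first.
    by rewrite M_supp ?mulr0//; apply: contraNN m'm => im'; apply/eqP; exact: class_uniq im' km.
  by rewrite ME// mulrA mulrAC mulfK.
by rewrite !E.
Qed.

(** A mixture of the states of scale p+2 is a mixture of those of scale p+1 whose
    weight is a mixture of stationary states, and conversely. *)
Lemma functional_zeroS p mu : (p.+2 <= q)%N ->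
  (functional p.+1 mu < +oo)%E <-> functional p mu = 0%E.
Proof.
move=> hp; have hlt : (1 <= p.+1 < q)%N by exact: hp.
have hp2 : (1 <= p.+2 <= q)%N by exact: hp.
have mixM (w' : simplex R 'I_(nn p.+2)) :
    same_measure (mixture w' (@state p.+1)) (mixture (wmix w' (@M p.+1)) (@state p)).
  by apply: mixture_wmix.
split => [/functional_lty[w' [mw' _]]|f0].
  have mw := same_measure_trans mw' (mixM w').
  rewrite (functional_mixture (ltnW hp) mw).
  by apply/(level2_rate_eq0 _ hlt); exists w'.
have [|w [mw fw]] := @functional_lty p mu; first by rewrite f0 ltry.
have /(level2_rate_eq0 w hlt)[w' ww] : level2_rate (@r p.+1) w = 0%E by rewrite -fw.
have mw' : same_measure mu (mixture w' (@state p.+1)).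
  apply: (same_measure_trans mw); apply: same_measure_sym.
  move=> A mA; rewrite (mixM w' A mA) /mixture /= /mix.
  by apply: eq_bigr => i _; rewrite -ww.
rewrite (functional_mixture hp mw').
by have [nu [_ _ ->]] := level2_rate_limit_form hp2; rewrite ltry.
Qed.

(** With a single class all ratios [w / nu] agree, so [nu] normalised is the only
    weight of zero rate. *)
Lemma functional_zero_last p : p.+1 = q ->
  (exists! A : {set 'I_(nn p.+1)}, closed_irreducible_class (@r p.+1) A) ->
  exists mu0, forall mu, functional p mu = 0%E <-> same_measure mu mu0.
Proof.
move=> pq [A [_ Au]].
have hp : (1 <= p.+1 <= q)%N by rewrite pq leqnn -pq.
have hq : (p.+1 <= q)%N by rewrite pq.
have conn i j : connect (edge (@r p.+1)) i j.
  have h1 := Au _ (component_class i hp); have h2 := Au _ (component_class j hp).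
  have : j \in [set k | connect (edge (@r p.+1)) i k]%SET by rewrite -h1 h2 inE connect0.
  by rewrite inE.
have [nu [nu0 nur lf]] := level2_rate_limit_form hp.
have [i0 _] := r_pos hp.
have S0 : 0 < \sum_i nu i.
  by rewrite (bigD1 i0)//= ltr_pwDl// sumr_ge0// => j _; rewrite ltW.
have w1 : \sum_i nu i / \sum_j nu j = 1 by rewrite -mulr_suml divff// lt0r_neq0.
have w0 i : 0 <= nu i / \sum_j nu j by rewrite divr_ge0 ?ltW.
pose w := mk_simplex w0 w1.
exists (mixture w (@state p)) => mu; split => [f0|mw].
  have [|v [mv fv]] := @functional_lty p mu; first by rewrite f0 ltry.
  have : (limit_form (@r p.+1) nu v)%:E = 0%E by rewrite -lf -fv.
  move=> [/(limit_form_eq0 v hp nu0 nur) H].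
  have vE i : v i = w i.
    have S1 : v i0 / nu i0 * \sum_j nu j = 1.
      rewrite mulr_sumr -(wt_sum v); apply: eq_bigr => j _.
      by rewrite (H i0 j) ?divfK// lt0r_neq0.
    rewrite mk_simplexE.
    have -> : v i = v i0 / nu i0 * nu i by rewrite (H i0 i) ?divfK// lt0r_neq0.
    rewrite mulrC; congr (_ * _); apply: (mulIf (lt0r_neq0 S0)).
    by rewrite S1 mulVf// lt0r_neq0.
  apply: (same_measure_trans mv) => B mB; rewrite /mixture /= /mix.
  by apply: eq_bigr => i _; rewrite vE.
rewrite (functional_mixture hq mw) lf; congr (_%:E).
apply/(limit_form_eq0 _ hp nu0 nur) => i j _; rewrite !mk_simplexE.
by rewrite ![nu _ / _]mulrC !mulfK ?lt0r_neq0.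
Qed.

Hypothesis theta_1 : prec (fun=> 1) (theta 1).
Hypothesis V1_mass_cvg : forall p, (1 <= p <= q)%N ->
  forall (mu : forall n, simplex R (site Xi (n0 + n))) (w : simplex R 'I_(nn 1%N)),
    (fun n => embed (mu n)) @ \oo --> mixture w (fun j => point_mass R (x j)) ->
    (limn_einf (fun n =>
       (theta p n)%:E * rate_functional (@rate n) (embed (mu n))) < +oo)%E ->
    forall j, mass (mu n) (@V 1 n j) @[n --> \oo] --> w j.

Let n_gt0 n : (0 < n0 + n)%N. Proof. by rewrite addn_gt0 n0_gt0. Qed.

(** * Gamma-convergence *)

Lemma rate_functional_dform n (mu : simplex R (site Xi (n0 + n))) :
  level2_rate (@rate n) mu =
  (dform (@rate n) (pi n) (fun a => Num.sqrt (mu a / pi n a)))%:E.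
Proof.
by apply: level2_rate_sqrt => // [|a]; [exact: pi_rev|exact: wt_ge0].
Qed.

Lemma embed_wells_cvg (w : simplex R 'I_(nn 1)) :
  (fun n => embed (wmix w (fun k => cond (pi n) (@V 1 n k)))) @ \oo --> mixture w pm.
Proof.
apply/weak_cvgP => f cf; rewrite Rintegral_mixture_continuous//.
rewrite (_ : (fun n => _) = (fun n => \sum_k w k * \int[embed (cond (pi n) (@V 1 n k))]_y f y)).
  by apply: cvg_sumr => k _; apply: cvgMl_tmp; have /weak_cvgP := @V1_dirac k; apply.
apply/funext => n; rewrite Rintegral_embed//.
under [RHS]eq_bigr do rewrite Rintegral_embed// mulr_sumr.
rewrite exchange_big; apply: eq_bigr => a _; rewrite wmixE mulr_suml.
by apply: eq_bigr => k _; rewrite mulrA.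
Qed.

(** The hypothesis on masses of wells concerns sequences of measures all carried
    by the grids, whereas the rate may be finite only along a subsequence; the
    other terms are replaced by mixtures of the conditional laws on the wells,
    which have the same limit. *)
Lemma simplex_replacement (w : simplex R 'I_(nn 1))
    (mu_ : nat -> borel_prob (carrier Xi) R) mu :
  mu_ @ \oo --> mu -> same_measure mu (mixture w pm) ->
  exists nu : forall n, simplex R (site Xi (n0 + n)),
    (fun n => embed (nu n)) @ \oo --> mixture w pm /\
    forall n, (rate_functional (@rate n) (mu_ n) < +oo)%E ->
      rate_functional (@rate n) (mu_ n) = level2_rate (@rate n) (nu n).
Proof.
move=> mumu mw.
pose fallback n := wmix w (fun k => cond (pi n) (@V 1 n k)).
have H n : exists v : simplex R (site Xi (n0 + n)),
    (same_measure (mu_ n) (embed v) /\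
     rate_functional (@rate n) (mu_ n) = level2_rate (@rate n) v) \/
    (v = fallback n /\ ~ (rate_functional (@rate n) (mu_ n) < +oo)%E).
  have [h|h] := pselect (rate_functional (@rate n) (mu_ n) < +oo)%E.
    by have [v vP] := rate_functional_lty (n_gt0 n) h; exists v; left.
  by exists (fallback n); right.
pose nu n := projT1 (cid (H n)).
have nuP n : (same_measure (mu_ n) (embed (nu n)) /\
     rate_functional (@rate n) (mu_ n) = level2_rate (@rate n) (nu n)) \/
    (nu n = fallback n /\ ~ (rate_functional (@rate n) (mu_ n) < +oo)%E).
  exact: projT2 (cid (H n)).
exists nu; split => [|n nfin]; last by have [[]|[]] := nuP n.
apply/weak_cvgP => f cf.
have /weak_cvgP/(_ f cf) c1 := mumu; have /weak_cvgP/(_ f cf) c2 := @embed_wells_cvg w.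
rewrite (same_measure_integral _ mw) in c1.
apply/cvgrPdist_le => e e0.
move: c1 c2 => /cvgrPdist_le/(_ e e0) c1 /cvgrPdist_le/(_ e e0) c2.
near=> n; have [[h _]|[-> _]] := nuP n.
  by rewrite -(same_measure_integral _ h); near: n.
by near: n.
Unshelve. all: by end_near.
Qed.

(** Boundedness along a subsequence gives the convergence of the masses of the
    wells and, by [density_flat], the flatness of the densities. *)
Lemma gamma_lower_in_hull p (w : simplex R 'I_(nn p.+1))
    (mu_ : nat -> borel_prob (carrier Xi) R) mu (B : R) : (p.+1 <= q)%N ->
  mu_ @ \oo --> mu -> same_measure mu (mixture w (@state p)) ->
  (forall N, exists2 n, (N <= n)%N &
     ((theta p.+1 n)%:E * rate_functional (@rate n) (mu_ n) <= B%:E)%E) ->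
  (functional p mu <= B%:E)%E.
Proof.
move=> hp mumu mw fr; have hp' : (1 <= p.+1 <= q)%N by [].
have mw1 := same_measure_trans mw (@mixture_deep p w).
have [nu [nuc nuE]] := simplex_replacement mumu mw1.
have fr' N : exists2 n, (N <= n)%N & ((theta p.+1 n)%:E * level2_rate (@rate n) (nu n) <= B%:E)%E.
  have [n Nn nB] := fr N; exists n => //; rewrite -nuE//.
  move: nB; case: (rate_functional _ _) => [s|//|//]; first by rewrite ltry.
  by rewrite gt0_muley ?lte_fin ?theta_gt0// leye_eq.
have massc : forall k, mass (nu n) (@V 1 n k) @[n --> \oo] --> wmix w (@deep_weight p) k.
  apply: (V1_mass_cvg hp' nuc); apply: (@le_lt_trans _ _ B%:E); last exact: ltry.
  apply: limn_einf_le => N; have [n Nn nB] := fr' N; exists n => //.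
  by rewrite rate_functional_embed.
have [nuu [nu0 nur lf]] := level2_rate_limit_form hp'.
rewrite (functional_mixture hp mw) lf lee_fin.
have [i0 [j0 [ij0 _]]] := r_pos hp'.
have rl (i' j' : 'I_(nn p.+1)) := @r_lim p.+1 i' j' hp'.
pose g n a := Num.sqrt (nu n a / pi n a).
apply: (@level_liminf _ (fun n => site Xi (n0 + n)) rate rate_ge0 rate_diag rate_irr
  dO Omega P X X_ctmc pi pi_rev _ (@V p.+1) (fun n => V_wells n hp')
  (theta p.+1) (fun n => theta_gt0 n hp') (@r p.+1) rl i0 j0 ij0
  nuu nu0 nur w (wt_ge0 w) g B).
  by move=> e e0; exact: density_flat.
move=> N; have [n Nn nB] := fr' N; exists n => //.
by move: nB; rewrite rate_functional_dform -EFinM lee_fin.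
Qed.

Lemma gamma_upper p mu : (p.+1 <= q)%N ->
  exists mu_ : nat -> borel_prob (carrier Xi) R, mu_ @ \oo --> mu /\
    (limn_esup (fun n => (theta p.+1 n)%:E * rate_functional (@rate n) (mu_ n))
      <= functional p mu)%E.
Proof.
move=> hp; have hp' : (1 <= p.+1 <= q)%N by [].
have [fin|] := ltP (functional p mu) +oo%E; last first.
  by rewrite leye_eq => /eqP ->; exists (fun=> mu); split; [exact: cvg_cst|exact: leey].
have [w [mw ->]] := functional_lty fin.
have [nu [nu0 nur ->]] := level2_rate_limit_form hp'.
have [i0 [j0 [ij0 _]]] := r_pos hp'.
have rl (i' j' : 'I_(nn p.+1)) := @r_lim p.+1 i' j' hp'.
have Vm n (k : 'I_(nn p.+1)) := V_mass n k hp'.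
have Uc : mass (pi n) (wells_union (@V p.+1 n)) @[n --> \oo] --> (1 : R).
  by under eq_fun do rewrite wells_union1//.
have [v [vI vf]] := @level_recovery _ (fun n => site Xi (n0 + n)) rate rate_ge0 rate_diag rate_irr
  dO Omega P X X_ctmc pi pi_rev _ (@V p.+1) (fun n => V_wells n hp') (theta p.+1)
  (fun n => theta_gt0 n hp') i0 j0 ij0 c0 c0_gt0 Vm w (wt_ge0 w) (wt_sum w) Uc.
exists (fun n => embed (v n)); split.
  apply: (weak_cvg_same _ (same_measure_sym mw) (mu_ := fun n => embed (v n))) => //.
  apply/weak_cvgP => f cf; have [B fB] := continuous_bounded cf.
  rewrite Rintegral_mixture_continuous//.
  have h1 := vf (fun n a => f (site_pt a)) B (fun n a => fB (site_pt a)).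
  have h2 : \sum_i w i * (\sum_a cond (pi n) (@V p.+1 n i) a * f (site_pt a)) @[n --> \oo]
     --> \sum_i w i * \int[@state p i]_y f y.
    by apply: cvg_sumr => i _; apply: cvgMl_tmp; exact: limit_state_cvg.
  have := cvgD h1 h2; rewrite add0r => H.
  rewrite (_ : (fun n => _) = (fun n => \sum_a v n a * f (site_pt a) - 
     \sum_i w i * (\sum_a cond (pi n) (@V p.+1 n i) a * f (site_pt a))) \+
     (fun n => \sum_i w i * (\sum_a cond (pi n) (@V p.+1 n i) a * f (site_pt a)))).
    exact: H.
  by apply/funext => n /=; rewrite subrK Rintegral_embed.
apply: (@limn_esup_le_real _ _ (fun n =>
  coarse_form rate P X pi (@V p.+1) (theta p.+1) n (amplitude pi (@V p.+1) n w))).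
  move=> n; rewrite rate_functional_embed//.
  have t0 := theta_gt0 n hp'.
  apply: (@le_trans _ _ ((theta p.+1 n)%:E * ((theta p.+1 n)^-1 *
    coarse_form rate P X pi (@V p.+1) (theta p.+1) n
      (amplitude pi (@V p.+1) n w))%:E)%E).
    by rewrite lee_pmul2l.
  by rewrite -EFinM mulVKf// lt0r_neq0.
exact: (@coarse_form_cvg _ (fun n => site Xi (n0 + n)) rate rate_ge0 rate_diag rate_irr
  dO Omega P X X_ctmc pi pi_rev _ (@V p.+1) (fun n => V_wells n hp')
  (theta p.+1) (fun n => theta_gt0 n hp') (@r p.+1) rl i0 j0 ij0
  nu nu0 nur w (wt_ge0 w)).
Qed.

Variable I0 : borel_prob (carrier Xi) R -> \bar R.
Hypothesis I0_ge0 : forall mu, (0 <= I0 mu)%E.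
Hypothesis I0_gamma : gamma_cvg (fun n => rate_functional (@rate n)) I0.
Hypothesis I0_zero : forall mu, I0 mu = 0%E <->
  exists w : simplex R 'I_(nn 1%N),
    same_measure mu (mixture w (fun j => point_mass R (x j))).

Let I_ p := limit_functional x M r I0 p.

Lemma limit_functional_ge0 p mu : (0 <= I_ p mu)%E.
Proof. by case: p => [|p]; [exact: I0_ge0|exact: functional_ge0]. Qed.

(** At scale zero this is the description of the zero set of [I0]. *)
Lemma limit_functional_zeroS p mu : (p < q)%N ->
  (I_ p.+1 mu < +oo)%E <-> I_ p mu = 0%E.
Proof.
case: p => [hq|p hp]; last exact: functional_zeroS.
split => [/functional_lty[w [mw _]]|/I0_zero[w mw]].
  by apply/I0_zero; exists w.
have hp1 : (1 <= 1 <= q)%N by [].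
rewrite /I_ /= -/(functional 0 mu) (@functional_mixture 0 mu w hq mw).
by have [nu [_ _ ->]] := level2_rate_limit_form hp1; rewrite ltry.
Qed.

(** The scale zero, at which the rate is not multiplied, lets the induction on
    scales start from the functional [I0]. *)
Definition speed p n : R := if p is 0 then 1 else theta p n.

Lemma speed_gt0 p n : (p <= q)%N -> 0 < speed p n.
Proof. by case: p => [|p] hp //=; exact: theta_gt0. Qed.

Lemma speed_prec p : (p < q)%N -> prec (speed p) (speed p.+1).
Proof. by case: p => [|p] hp; [exact: theta_1|exact: theta_prec]. Qed.

(** If the claim failed at scale p+1, the rates multiplied by the p-th speed would
    tend to zero along a subsequence, so the limit would be in the zero set of the
    p-th functional, hence in the domain of the next one, where
    [gamma_lower_in_hull] applies. *)
Lemma gamma_lower p mu_ mu : (p <= q)%N -> mu_ @ \oo --> mu ->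
  (I_ p mu <=
   limn_einf (fun n => (speed p n)%:E * rate_functional (@rate n) (mu_ n)))%E.
Proof.
elim: p => [_ mumu|p IH hp mumu].
  by under eq_fun do rewrite mul1e; exact: I0_gamma.1.
set u := fun n => _; rewrite leNgt; apply/negP => Lu.
have [B uB BI] : exists2 B : R, (limn_einf u < B%:E)%E & (B%:E < I_ p.+1 mu)%E.
  move: Lu (limit_functional_ge0 p.+1 mu).
  case: (limn_einf u) => [l||]; last 1 first.
  - case: (I_ p.+1 mu) => [s _ _|_ _|]; last by rewrite ltxx.
      by exists (s - 1); rewrite ?ltNyr// lte_fin; lra.
    by exists 0; rewrite ?ltNyr ?ltry.
  - case: (I_ p.+1 mu) => [s|_ _|]; last by rewrite ltNge leNye.
      by rewrite lte_fin => ls _; exists ((l + s) / 2); rewrite lte_fin; lra.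
    by exists (l + 1); rewrite ?ltry// lte_fin ltrDl.
  by rewrite ltNge leey.
have fr N : exists2 n, (N <= n)%N & (u n <= B%:E)%E.
  by have [n Nn /ltW nB] := limn_einf_lt uB N; exists n.
have Ip0 : I_ p mu = 0%E.
  apply/le_anti; rewrite limit_functional_ge0 andbT.
  apply: (le_trans (IH (ltnW hp) mumu)); apply/lee_addgt0Pr => e e0; rewrite add0e.
  apply: limn_einf_le => N.
  have [N' _ HN'] : \forall n \near \oo, speed p n / speed p.+1 n * `|B| <= e.
    apply: (cvgr_le 0) => //; rewrite -(mul0r `|B|); apply: cvgMr_tmp.
    exact: speed_prec.
  have [n Nn nB] := fr (maxn N N'); exists n; first by rewrite (leq_trans _ Nn)// leq_maxl.
  have sp := speed_gt0 n (ltnW hp); have spS := speed_gt0 n hp.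
  have := HN' n (leq_trans (leq_maxr _ _) Nn); rewrite /= -lee_fin; apply: le_trans.
  have -> : ((speed p n)%:E * rate_functional (@rate n) (mu_ n) =
      (speed p n / speed p.+1 n)%:E * u n)%E.
    by rewrite /u muleA -EFinM divfK// lt0r_neq0.
  rewrite [leRHS]EFinM lee_pmul2l ?lte_fin ?divr_gt0//.
  by apply: (le_trans nB); rewrite lee_fin ler_norm.
have /(limit_functional_zeroS _ hp) fin := Ip0.
have [w [mw _]] := functional_lty fin.
have := gamma_lower_in_hull hp mumu mw fr.
by rewrite leNgt BI.
Qed.

Hypothesis q_ge1 : (1 <= q)%N.
Hypothesis C_uniq :
  exists! A : {set 'I_(nn q)}, closed_irreducible_class (@r q) A.

Lemma full_expansion :
  full_gamma_expansion (fun n => rate_functional (@rate n)) q theta I_.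
Proof.
split.
- by move=> p _ mu; exact: limit_functional_ge0.
- split=> //.
  have th0 : \forall n \near \oo, 0 < theta 1%N n by apply: nearW => n; exact: theta_gt0.
  apply/(gtr0_cvgV0 th0); move: theta_1; rewrite /prec.
  by under eq_fun do rewrite div1r.
- split=> // -[//|p] hp; split=> [mu_ mu mumu|mu].
    exact: (@gamma_lower p.+1).
  exact: gamma_upper.
- by move=> p hp mu; exact: limit_functional_zeroS.
have [p pq] : exists p, p.+1 = q by exists q.-1; rewrite prednK.
move: C_uniq; rewrite -pq; exact: functional_zero_last.
Qed.

End expansion.

(* Sequences indexed by the mesh parameter N >= n0 are written as functions of
   n = N - n0; the case n0 = 1 is that of sequences indexed by N >= 1. *)
Theorem theorem2p11 (R : realType) (d : nat) (Xi : state_space R d)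
  (n0 : nat) (n0_gt0 : (0 < n0)%N)
  (* the chains X^(n)_t and their stationary states *)
  (rate : forall n, site Xi (n0 + n) -> site Xi (n0 + n) -> R)
  (rate_ge0 : forall n x y, 0 <= rate n x y)
  (rate_diag : forall n x, rate n x x = 0)
  (rate_irr : forall n, irreducible_chain (rate n))
  (dO : nat -> measure_display) (Omega : forall n, measurableType (dO n))
  (P : forall n, site Xi (n0 + n) -> probability (Omega n) R)
  (X : forall n, R -> Omega n -> site Xi (n0 + n))
  (X_ctmc : forall n, is_ctmc (rate n) (P n) (X n))
  (pi : forall n, simplex R (site Xi (n0 + n)))
  (pi_stat : forall n, stationary (rate n) (pi n))
  (pi_rev : forall n, detailed_balance (rate n) (pi n))
  (* number of time-scales, numbers of wells, time-scales, wells *)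
  (q : nat) (q_ge1 : (1 <= q)%N) (nn : nat -> nat)
  (theta : nat -> nat -> R)
  (V : forall p n, 'I_(nn p) -> {set site Xi (n0 + n)})
  (* (A0) *)
  (I0 : borel_prob (carrier Xi) R -> \bar R)
  (I0_ge0 : forall mu, (0 <= I0 mu)%E)
  (I0_gamma : gamma_cvg (fun n => rate_functional (rate n)) I0)
  (x : 'I_(nn 1%N) -> carrier Xi) (x_inj : injective x)
  (I0_zero : forall mu, I0 mu = 0%E <->
     exists w : simplex R 'I_(nn 1%N),
       same_measure mu
         (mixture w (fun j => point_mass R (x j))))
  (* (A1) *)
  (theta_gt0 : forall p n, (1 <= p <= q)%N -> 0 < theta p n)
  (theta_1 : prec (fun=> 1) (theta 1%N))
  (theta_prec : forall p, (1 <= p < q)%N -> prec (theta p) (theta p.+1))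
  (V_wells : forall p n, (1 <= p <= q)%N -> wells (V p n))
  (r : forall p, 'I_(nn p) -> 'I_(nn p) -> R)
  (r_lim : forall p (i j : 'I_(nn p)), (1 <= p <= q)%N -> i != j ->
     theta p n * mean_rate (rate n) (P n) (X n) (pi n) (V p n) i j
       @[n --> \oo] --> r p i j)
  (r_pos : forall p, (1 <= p <= q)%N ->
     exists i j : 'I_(nn p), i != j /\ 0 < r p i j)
  (* (A2): C p enumerates the closed irreducible classes of the p-th reduced
     chain without repetition *)
  (C : forall p, 'I_(nn p.+1) -> {set 'I_(nn p)})
  (C_inj : forall p, (1 <= p < q)%N -> injective (C p))
  (C_classes : forall p (A : {set 'I_(nn p)}), (1 <= p < q)%N ->
     closed_irreducible_class (r p) A <-> exists m, A = C p m)
  (V_merge : forall p n m, (1 <= p < q)%N ->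
     V p.+1 n m = (\bigcup_(j in C p m) V p n j)%SET)
  (* the stationary states of the reduced chains on these classes *)
  (M : forall p, 'I_(nn p.+1) -> simplex R 'I_(nn p))
  (M_supp : forall p m k, (1 <= p < q)%N -> k \notin C p m -> M p m k = 0)
  (M_stat : forall p m, (1 <= p < q)%N -> stationary (r p) (M p m))
  (* (A3) *)
  (C_uniq : exists! A : {set 'I_(nn q)}, closed_irreducible_class (r q) A)
  (* (A4a) *)
  (V1_full : mass (pi n) (wells_union (V 1%N n)) @[n --> \oo] --> (1 : R))
  (V1_dirac : forall j : 'I_(nn 1%N),
     (fun n => embed (cond (pi n) (V 1%N n j))) @ \oo -->
     point_mass R (x j))
  (* (A5) *)
  (poincare : exists beta : nat -> R,
     [/\ forall n, 0 < beta n, prec beta (theta 1%N) &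
       forall n (j : 'I_(nn 1%N)) (h : site Xi (n0 + n) -> R) y,
         y \in V 1%N n j ->
         \sum_(z in V 1%N n j) cond (pi n) (V 1%N n j) z * (h z - h y) ^+ 2
           <= beta n * dirichlet (rate n) (pi n) (V 1%N n j) h])
  (* (A6a) *)
  (V_mass : exists c0 : R, 0 < c0 /\
     forall p n (j : 'I_(nn p)), (1 <= p <= q)%N ->
       c0 <= mass (pi n) (V p n j) / mass (pi n) (wells_union (V p n)))
  (* (A6b) *)
  (V1_mass_cvg : forall p, (1 <= p <= q)%N ->
     forall (mu : forall n, simplex R (site Xi (n0 + n)))
            (w : simplex R 'I_(nn 1%N)),
       (fun n => embed (mu n)) @ \oo -->
         mixture w (fun j => point_mass R (x j)) ->
       (limn_einf (fun n =>
          (theta p n)%:E * rate_functional (rate n) (embed (mu n))) < +oo)%E ->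
       forall j, mass (mu n) (V 1%N n j) @[n --> \oo] --> w j) :
  full_gamma_expansion (fun n => rate_functional (rate n)) q theta
    (limit_functional x M r I0).
Proof.
have [beta [beta_gt0 beta_prec beta_poincare]] := poincare.
have [c0 [c0_gt0 V_mass0]] := V_mass.
exact (full_expansion n0_gt0 rate_ge0 rate_diag rate_irr X_ctmc pi_rev x_inj
  theta_gt0 theta_prec V_wells r_lim r_pos C_inj C_classes V_merge M_supp M_stat
  c0_gt0 V_mass0 V1_full beta_gt0 beta_prec beta_poincare V1_dirac theta_1
  V1_mass_cvg I0_ge0 I0_gamma I0_zero q_ge1 C_uniq).
Qed.
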